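(* Let $z\in\mathfrak{F}_\infty$. Then $w\mapsto(P_{\mathsf{Sp}}(w),Q_{\mathsf{Sp}}(w))$ and $(P,Q)\mapsto w_{\mathsf{Sp}}(P,Q)$ are inverse bijections between the set of symplectic Hecke words (respectively, FPF-involution words) for $z$ of length $n\in\{0,1,2,\dots\}$ and the set of pairs $(P,Q)$ where $P$ is an increasing shifted tableau with $\mathrm{row}(P)\in\mathcal{H}_{\mathsf{Sp}}(z)$ (respectively, $\mathrm{row}(P)\in\hat{\mathcal{R}}_{\mathsf{FPF}}(z)$) and $Q$ is a standard shifted set-valued (respectively, marked) tableau with length $|Q|=n$ and the same shape as $P$.
   Context: **Words.** $\mathbb{P}=\{1,2,3,\dots\}$, $[n]=\{1,\dots,n\}$. A word is a finite sequence of positive integers. $\mathfrak{S}_\infty$ is the group of finitely supported permutations of $\mathbb{P}$, $s_i=(i,i+1)$, $\Theta(i)=i-(-1)^i$, $\mathfrak{F}_\infty=\{\pi^{-1}\Theta\pi:\pi\in\mathfrak{S}_\infty\}$. Let $\mathcal{N}_\infty$ be the free $\mathbb{Z}$-module with basis $\{N_z:z\in\mathfrak{F}_\infty\}$ and let $U_i$ ($i\in\mathbb{P}$) act on it on the right, linearly, by $N_zU_i=N_{s_izs_i}$ if $z(i)<z(i+1)$; $N_z$ if $i+1\neq z(i)>z(i+1)\neq i$; $0$ if $i+1=z(i)>z(i+1)=i$. $\mathcal{H}_{\mathsf{Sp}}(z)$ is the set of symplectic Hecke words for $z$: words $i_1\cdots i_l$ with $N_z=N_\Theta U_{i_1}\cdots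 U_{i_l}$. $\hat{\mathcal{R}}_{\mathsf{FPF}}(z)$ is the set of minimal-length words in $\mathcal{H}_{\mathsf{Sp}}(z)$, called FPF-involution words for $z$. A word is a symplectic Hecke word if it is one for some $z\in\mathfrak{F}_\infty$. **Tableaux.** A tableau is a map $T$ from a finite subset of $\mathbb{P}\times\mathbb{P}$ (its shape) to $\mathbb{P}$; $(i,j)\in T$ means $(i,j)$ is in the shape, and $T_{ij}=T(i,j)$. Position $(i,j)$ is in row $i$, column $j$. $T$ has $m$ rows (resp. $n$ columns) if its shape is contained in $[m]\times\mathbb{P}$ but not $[m-1]\times\mathbb{P}$ (resp. $\mathbb{P}\times[n]$ but not $\mathbb{P}\times[n-1]$); the empty tableau $\emptyset$ has $0$ of each. $T$ is increasing if $T_{ab}<T_{xy}$ whenever $(a,b)\neq(x,y)$ are in $T$ with $a\le x,b\le y$. $T$ is shifted if its shape is $\{(i,i+j-1):1\le j\le\lambda_i\}$ for a strict partition $\lambda$. The words $\mathrm{row}(T)$ and $\mathrm{col}(T)$ list the values $T_{ij}$ in the order in which $(-i,j)$, respectively $(j,-i)$, increases lexicographically. An outer corner of a shifted $T$ is $(i,j)\notin T$ such that $i=j$ or $(i,j-1)\in T$, and $i=1$ or $(i-1,j)\in T$; an inner corner is $(i,j)\in T$ with $(i,j+1),(i+1,j)\notin T$. A set-valued tableau is a map from a finite subset of $\mathbb{P}\times\mathbb{P}$ (its shape) to nonempty finite subsets of $\{1'<1<2'<2<\cdots\}$; it is marked if all entries are singletons; it is shifted if its shape is $\{(i,i+j-1):1\le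 j\le\lambda_i\}$ for a strict partition $\lambda$; $|T|$ is the sum of the sizes of its entries; it is increasing if $\max T_{ab}<\min T_{xy}$ whenever $(a,b)\neq(x,y)$ are in $T$ with $a\le x,b\le y$. A shifted set-valued tableau $T$ is standard if it is increasing, has no primed number in a box $(i,i)$, and exactly one of $i,i'$ appears in some box for each $i\in\{1,\dots,|T|\}$. **Shifted insertion states.** A shifted insertion state is a tableau that is either (a) increasing, shifted and nonempty (then called terminal), or (b) formed from an increasing shifted tableau with $m-2$ rows and $n-2$ columns by adding one extra box, the outer box, at a position in $[m-1]\times\{n\}$ or $\{m\}\times[n-1]$. A non-terminal state is initial if its outer box is in row 1. **Forward transitions.** Each non-terminal state $U$ (with $m-2$ rows and $n-2$ columns when its outer box is removed) has a unique labelled forward transition $U\to V$: *Outer box $(i,n)$.* If $U_{in}$ is maximal in its row, let $j\ge i$ be minimal with $(i,j)\notin U$. (R1) If moving the outer box to $(i,j)$ gives an increasing shifted tableau, $V$ is that tableau; (R2) otherwise $V$ is $U$ with the outer box removed. The label is $(i,j)$. If $U_{in}$ is not maximal in its row, let $x$ be minimal with $(i,x)\in U$, $U_{in}<U_{ix}$, and let $U'$ be formed from $U$ by replacing the value in $(i,x)$ by $U_{in}$ and removing the outer box. The label is $(i,x)$. If $i<x$: (R3) if $U'$ is not increasing, and $i+1<x$ or row $i+1$ of $U$ is nonempty, $V$ is formed from $U$ by moving the outer box to $(i+1,n)$ and changing its value to $U_{ix}$; (R4) if $U'$ is increasing, $V$ is $U'$ with an outer box of value $U_{ix}$ added at $(i+1,n)$;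 (D1) if $U_{ii}\le U_{in}<U_{i,i+1}$ (so $x=i+1$), row $i+1$ of $U$ is empty, and $U'$ is not increasing, $V$ is formed from $U$ by moving the outer box to $(m,i+1)$ and changing its value to $U_{i,i+1}$. If $x=i$: (D2) if $U_{in}\equiv U_{ii}\pmod 2$ and $U'$ is not increasing, $V$ is formed from $U$ by moving the outer box to $(m,i+1)$ and changing its value to $U_{ii}$; (D3) if $U_{in}\equiv U_{ii}\pmod 2$ and $U'$ is increasing, $V$ is $U'$ with an outer box of value $U_{ii}$ added at $(m,i+1)$; (D4) if $U_{in}\not\equiv U_{ii}\pmod 2$, $V$ is formed from $U$ by moving the outer box to $(m,i+1)$ and changing its value to $U_{ii}+1$. *Outer box $(m,j)$.* If $U_{mj}$ is maximal in its column, let $i$ be minimal with $(i,j)\notin U$. (C1) If moving the outer box to $(i,j)$ gives an increasing shifted tableau, $V$ is that tableau; (C2) otherwise $V$ is $U$ with the outer box removed. The label is $(i,j)$. If $U_{mj}$ is not maximal in its column, let $x$ be minimal with $(x,j)\in U$, $U_{mj}<U_{xj}$, and let $U'$ be formed from $U$ by replacing the value in $(x,j)$ by $U_{mj}$ and removing the outer box. The label is $(x,j)$. (C3) If $U'$ is not increasing, $V$ is formed from $U$ by moving the outer box to $(m,j+1)$ and changing its value to $U_{xj}$; (C4) if $U'$ is increasing, $V$ is $U'$ with an outer box of value $U_{xj}$ added at $(m,j+1)$. **Insertion.** For an increasing shifted tableau $T$ and $a\in\mathbb{P}$, $T\oplus a$ is the state formed by adding $a$ to the second unoccupied box of the first row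 of $T$. Following forward transitions from $T\oplus a$ leads to a unique terminal state, denoted $T\xleftarrow{\mathsf{Sp}}a$; the sequence of transitions is the insertion path. For $w=w_1\cdots w_n$, $P_{\mathsf{Sp}}(w)=(\cdots((\emptyset\xleftarrow{\mathsf{Sp}}w_1)\xleftarrow{\mathsf{Sp}}w_2)\cdots)\xleftarrow{\mathsf{Sp}}w_n$. For a symplectic Hecke word $w=w_1\cdots w_n$, $Q_{\mathsf{Sp}}(w)$ is defined inductively: $Q_{\mathsf{Sp}}(\emptyset)=\emptyset$; if $n>0$ and the last transition in the insertion path of $P_{\mathsf{Sp}}(w_1\cdots w_{n-1})\xleftarrow{\mathsf{Sp}}w_n$ has label $(i,j)$, form $Q_{\mathsf{Sp}}(w)$ from $Q_{\mathsf{Sp}}(w_1\cdots w_{n-1})$ by adding: $n$ to box $(i,j)$ if its type is (R1); $n'$ to box $(i,j)$ if (C1); $n$ to the last (highest row index) box in column $j-1$ if (R2); $n'$ to the last (highest column index) box in row $i-1$ if (C2). **Admissible states.** Put $T_{xy}=\infty$ for $(x,y)\notin T$. Let $T$ be a non-terminal state with $m-2$ rows and $n-2$ columns when its outer box is removed. If the outer box is $(i,n)$, $T$ is weakly admissible if [$i=1$ or there is a column $x\ge i$ with $T_{i-1,x}\le T_{in}<T_{ix}$] and [if $T_{i-1,i}=T_{in}$ then $(i,i)\in T$]; it is admissible if it is weakly admissible and $\mathrm{row}(T)$ is a symplectic Hecke word. If the outer box is $(m,j)$, $T$ is weakly admissible if $T_{mj}=T_{j-1,j}$ or there is a row $x<j$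 with $T_{x,j-1}\le T_{mj}<T_{xj}$; it is admissible if it is weakly admissible, $\mathrm{col}(T)$ is a symplectic Hecke word, [if $T_{mj}=T_{j-1,j}$ then $(j,j)\notin T$ or $T_{mj}$ is odd], and [if $T_{mj}=T_{x,j-1}$ then $x>1$]. A terminal state is admissible if its row reading word is a symplectic Hecke word. **Inverse transitions** $V\leadsto U$ from an admissible state $V$. Here ''the outer position in row $i$ (column $j$)'' of $U$ means $(i,n)$ (resp. $(m,j)$) where $U$ without that box has $m-2$ rows and $n-2$ columns. If $V$ is initial there are none. If $V$ is terminal: (iR1) for each inner corner $(i,j)$ of $V$, there is $V\overset{(i,j)}{\underset{\mathrm{row}}{\leadsto}}U$ where $U$ is formed from $V$ by moving box $(i,j)$ to the outer position in row $i$; (iR2) for each outer corner $(i,j)$ of $V$ with $i<j$, there is $V\overset{(i,j)}{\underset{\mathrm{row}}{\leadsto}}U$ where $U$ is formed from $V$ by adding an outer box in row $i$ whose value is whichever of $V_{i-1,j}$, $V_{i,j-1}$ is defined and larger; (iC1) for each inner corner $(i,j)$ with $i<j$, there is $V\overset{(i,j)}{\underset{\mathrm{col}}{\leadsto}}U$ where $U$ is formed by moving box $(i,j)$ to the outer position in column $j$; (iC2) for each outer corner $(i,j)$ with $i>1$, there is $V\overset{(i,j)}{\underset{\mathrm{col}}{\leadsto}}U$ where $U$ is formed by adding an outer box in column $j$ whose value is whichever of $V_{i-1,j}$, $V_{i,j-1}$ is defined and larger. If $V$ is neither terminal nor initial, with $m-2$ rows and $n-2$ columns when its outer box is removed, there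 is exactly one $V\leadsto U$. *Outer box $(i,n)$, $i>1$:* let $x\ge i$ be maximal with $V_{i-1,x}\le V_{in}$. (iR3) If $V_{i-1,x}=V_{in}$, $U$ is formed from $V$ by moving box $(i,n)$ to $(i-1,n)$ and changing its value to whichever of $V_{i-1,x-1}$, $V_{i-2,x}$ is defined and larger. (iR4) If $V_{i-1,x}<V_{in}$, $U$ is formed by moving box $(i-1,x)$ to $(i-1,n)$ and then box $(i,n)$ to $(i-1,x)$. *Outer box $(m,j)$, $V_{j-1,j-1}\le V_{mj}$* (then $V_{mj}\le V_{j-1,j}$): (iD1) if $V_{j-1,j-1}<V_{mj}=V_{j-1,j}$ and $V_{mj}$ is even, move box $(m,j)$ to $(j-1,n)$ and change its value to whichever of $V_{j-1,j-1}$, $V_{j-2,j}$ is defined and larger; (iD2) if $V_{j-1,j-1}=V_{mj}$ (then $j>2$) and $V_{j-2,j-1}$ is even, move box $(m,j)$ to $(j-1,n)$ and change its value to $V_{j-2,j-1}$; (iD3) if $V_{j-1,j-1}<V_{mj}<V_{j-1,j}$ and $V_{mj}$ is even, move box $(j-1,j-1)$ to $(j-1,n)$ and then box $(m,j)$ to $(j-1,j-1)$; (iD4) if $V_{j-1,j-1}<V_{mj}$ and $V_{mj}$ is odd, move box $(m,j)$ to $(j-1,n)$ and change its value to $V_{j-1,j-1}-1$; (iC3a) if $V_{j-1,j-1}=V_{mj}$ and $V_{j-2,j-1}$ is odd, move box $(m,j)$ to $(m,j-1)$ and change its value to $V_{j-2,j-1}$. *Outer box $(m,j)$, $V_{mj}<V_{j-1,j-1}$:*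 let $x<j-1$ be maximal with $V_{x,j-1}\le V_{mj}$. (iC3b) If $V_{x,j-1}=V_{mj}$ (then $x>1$), move box $(m,j)$ to $(m,j-1)$ and change its value to whichever of $V_{x-1,j-1}$, $V_{x,j-2}$ is defined and larger; (iC4) if $V_{x,j-1}<V_{mj}$, move box $(x,j-1)$ to $(m,j-1)$ and then box $(m,j)$ to $(x,j-1)$. **The map $w_{\mathsf{Sp}}$.** Let $P$ be an increasing shifted tableau, $Q$ a standard shifted set-valued tableau of the same shape with $|Q|=n>0$, and $w$ a word with $\mathrm{row}(P)w\in\mathcal{H}_{\mathsf{Sp}}(z)$. Exactly one of $n,n'$ appears in $Q$, in an inner corner $(i,j)$. Let $V_1$ be the admissible state such that: $P\overset{(i,j)}{\underset{\mathrm{row}}{\leadsto}}V_1$ if $Q_{ij}=\{n\}$; $P\overset{(i,j)}{\underset{\mathrm{col}}{\leadsto}}V_1$ if $Q_{ij}=\{n'\}$ ; $P\overset{(r,j+1)}{\underset{\mathrm{row}}{\leadsto}}V_1$ if $\{n\}\subsetneq Q_{ij}$, where $r$ is the row of the unique outer corner of $Q$ in column $j+1$; $P\overset{(i+1,s)}{\underset{\mathrm{col}}{\leadsto}}V_1$ if $\{n'\}\subsetneq Q_{ij}$, where $s$ is the column of the unique outer corner of $Q$ in row $i+1$. Follow inverse transitions $P\leadsto V_1\leadsto V_2\leadsto\cdots\leadsto V_l$ maximally; $V_l$ is initial, so $V_l=\hat P\oplus a$ for a shifted tableau $\hat P$ and $a\in\mathbb{P}$. Put $\mathrm{uninsert}(P,Q,w)=(\hat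 P,\hat Q,aw)$ where $\hat Q$ is formed from $Q$ by removing whichever of $n,n'$ appears (deleting the box if it becomes empty). For $P$ with $\mathrm{row}(P)\in\mathcal{H}_{\mathsf{Sp}}(z)$ and $Q$ standard of the same shape, $w_{\mathsf{Sp}}(P,Q)$ is the word such that applying $\mathrm{uninsert}$ exactly $|Q|$ times to $(P,Q,\emptyset)$ gives $(\emptyset,\emptyset,w_{\mathsf{Sp}}(P,Q))$. *)

(* Defs.v *)
From HB Require Import structures.
From mathcomp Require Import all_boot all_order all_algebra.
From mathcomp Require Import finmap.
From mathcomp.multinomials Require Import freeg.
From mathcomp Require Import boolp.

Set Implicit Arguments.
Unset Strict Implicit.
Unset Printing Implicit Defensive.

Import Order.TTheory GRing.Theory.

Local Open Scope nat_scope.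
Local Open Scope fset_scope.
Local Open Scope fmap_scope.

(* The positive integers are the nonzero elements of nat.  A permutation of
   the positive integers is a permutation of nat that fixes 0. *)

Definition in_Sinfty (p : nat -> nat) : Prop :=
  [/\ bijective p, p 0 = 0 & exists N, forall i, N < i -> p i = i].

(* i - (-1)^i for i > 0, and 0 for i = 0. *)
Definition Theta (i : nat) : nat := if odd i then i.+1 else i.-1.

Definition in_Finfty (z : nat -> nat) : Prop :=
  exists p q : nat -> nat,
    [/\ in_Sinfty p, cancel p q, cancel q p & z =1 q \o Theta \o p].

(* s_i = (i, i+1) for i > 0; the value at i = 0 is irrelevant. *)
Definition simple_refl (i k : nat) : nat :=
  if i == 0 then k else
  if k == i then i.+1 else if k == i.+1 then i else k.

Lemma simple_reflK i : involutive (simple_refl i).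
Proof.
case: i => [//|i] k; rewrite /simple_refl /=.
have [->|ki] := eqVneq k i.+1.
  by rewrite eqxx gtn_eqF.
have [->|ki'] := eqVneq k i.+2; first by rewrite eqxx.
by rewrite (negbTE ki) (negbTE ki').
Qed.

Lemma simple_refl0 i : simple_refl i 0 = 0.
Proof. by case: i. Qed.

Lemma in_Finfty_Theta : in_Finfty Theta.
Proof.
exists id, id; split=> //; split=> //; first by exists id.
by exists 0.
Qed.

Lemma in_Finfty_conj i z :
  in_Finfty z -> in_Finfty (simple_refl i \o z \o simple_refl i).
Proof.
case=> p [q [[bp p0 [N pN]] pK qK zE]].
exists (p \o simple_refl i), (simple_refl i \o q); split.
- split.
  + by apply: bij_comp => //; exists (simple_refl i); apply: simple_reflK.
  + by rewrite /= simple_refl0.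
  + exists (maxn N i.+1) => k; rewrite gtn_max => /andP[Nk ik] /=.
    rewrite /simple_refl; case: ifP => _; first exact: pN.
    by rewrite !gtn_eqF ?pN // ltnW.
- by move=> k /=; rewrite pK simple_reflK.
- by move=> k /=; rewrite simple_reflK qK.
- by move=> k /=; rewrite zE.
Qed.

Record Finfty : Type := MkFinfty {
  Finfty_fun :> nat -> nat;
  Finfty_prop : in_Finfty Finfty_fun }.

HB.instance Definition _ := gen_eqMixin Finfty.
HB.instance Definition _ := gen_choiceMixin Finfty.

Definition FTheta : Finfty := MkFinfty in_Finfty_Theta.
Definition Fconj (i : nat) (z : Finfty) : Finfty :=
  MkFinfty (in_Finfty_conj i (Finfty_prop z)).

(* {freeg Finfty} is the free Z-module with basis N_z = << z >>.  The right
   action x U_i is written U i x. *)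

Definition U_basis (i : nat) (z : Finfty) : {freeg Finfty} :=
  if z i < z i.+1 then << Fconj i z >>
  else if (z i != i.+1) && (z i.+1 != i) then << z >>
  else 0%R.

Definition U (i : nat) (x : {freeg Finfty}) : {freeg Finfty} :=
  fglift (U_basis i) x.

Definition sp_Hecke_word (z : Finfty) (w : seq nat) : Prop :=
  0 \notin w /\ foldl (fun x i => U i x) << FTheta >> w = << z >>.

Definition FPF_involution_word (z : Finfty) (w : seq nat) : Prop :=
  sp_Hecke_word z w /\ forall v, sp_Hecke_word z v -> size w <= size v.

Definition is_sp_Hecke_word (w : seq nat) : Prop :=
  exists z, sp_Hecke_word z w.

Notation box := (nat * nat)%type.
Notation shape := {fset box}.
Notation tableau := {fmap box -> nat}.

Definition rows (D : shape) : nat := \max_(p <- D) p.1.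
Definition cols (D : shape) : nat := \max_(p <- D) p.2.

Definition boxes_positive (D : shape) : Prop :=
  forall p, p \in D -> (0 < p.1) && (0 < p.2).

Definition is_tableau (T : tableau) : Prop :=
  boxes_positive (domf T) /\ forall p v, T.[? p] = Some v -> 0 < v.

Definition increasing_for (V : Type) (lt : rel V) (T : {fmap box -> V}) :
    Prop :=
  forall p q u v, T.[? p] = Some u -> T.[? q] = Some v ->
    p != q -> p.1 <= q.1 -> p.2 <= q.2 -> lt u v.

Definition increasing (T : tableau) : Prop := increasing_for ltn T.

Definition strict_partition (la : seq nat) : bool :=
  sorted gtn la && (0 \notin la).

Definition shifted (D : shape) : Prop :=
  exists2 la, strict_partition la &
    forall i j, ((i, j) \in D) =
      [&& 0 < i, i <= size la, i <= j & j < i + nth 0 la i.-1].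

Definition row_word (T : tableau) : seq nat :=
  flatten [seq pmap (fun j => T.[? (i, j)]) (iota 1 (cols (domf T)))
             | i <- rev (iota 1 (rows (domf T)))].

Definition col_word (T : tableau) : seq nat :=
  flatten [seq pmap (fun i => T.[? (i, j)]) (rev (iota 1 (rows (domf T))))
             | j <- iota 1 (cols (domf T))].

Definition outer_corner (D : shape) (i j : nat) : bool :=
  [&& (i, j) \notin D, (i == j) || ((i, j.-1) \in D) &
      (i == 1) || ((i.-1, j) \in D)].

Definition inner_corner (D : shape) (i j : nat) : bool :=
  [&& (i, j) \in D, (i, j.+1) \notin D & (i.+1, j) \notin D].

(* (k, true) stands for k' and (k, false) for k. *)
Definition letter : Type := (nat * bool)%type.

Definition letter_lt (a b : letter) : bool :=
  (a.1 < b.1) || [&& a.1 == b.1, a.2 & ~~ b.2].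

Notation svtableau := {fmap box -> {fset letter}}.

Definition is_svtableau (Q : svtableau) : Prop :=
  boxes_positive (domf Q) /\
  forall p E, Q.[? p] = Some E ->
    E != fset0 /\ forall a, a \in E -> 0 < a.1.

Definition letters_at (Q : svtableau) (p : box) : {fset letter} :=
  odflt fset0 Q.[? p].

Definition weight (Q : svtableau) : nat :=
  \sum_(p <- domf Q) #|` letters_at Q p|.

Definition appears (a : letter) (Q : svtableau) : bool :=
  has (fun p => a \in letters_at Q p) (domf Q).

(* For nonempty A and B this says max A < min B. *)
Definition letters_lt (A B : {fset letter}) : bool := allrel letter_lt A B.

Definition standard_shifted (Q : svtableau) : Prop :=
  [/\ is_svtableau Q /\ shifted (domf Q),
      increasing_for letters_lt Q,
      forall i k, (k, true) \notin letters_at Q (i, i) &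
      forall k, 0 < k <= weight Q ->
        appears (k, false) Q (+) appears (k, true) Q].

Definition marked (Q : svtableau) : Prop :=
  forall p E, Q.[? p] = Some E -> #|` E| = 1.

(* A shifted insertion state is stored as its increasing shifted tableau
   together with the row (column) and the value of the outer box, if any.
   The outer box is in column (row) [cols + 2] ([rows + 2]), see [state_tab]. *)
Inductive state : Type :=
  | Terminal of tableau
  | RowOuter of tableau & nat & nat
  | ColOuter of tableau & nat & nat.

Definition state_tab (U : state) : tableau :=
  match U with
  | Terminal T => T
  | RowOuter T i a => T.[(i, (cols (domf T)).+2) <- a]
  | ColOuter T j a => T.[((rows (domf T)).+2, j) <- a]
  end.

Definition is_increasing_shifted (T : tableau) : Prop :=
  [/\ is_tableau T, increasing T & shifted (domf T)].

Definition is_state (U : state) : Prop :=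
  match U with
  | Terminal T => is_increasing_shifted T /\ T <> [fmap]
  | RowOuter T i a =>
      [/\ is_increasing_shifted T, 0 < i <= (rows (domf T)).+1 & 0 < a]
  | ColOuter T j a =>
      [/\ is_increasing_shifted T, 0 < j <= (cols (domf T)).+1 & 0 < a]
  end.

(* The smallest and the largest k in [m, n] with P k. *)
Definition least (m n : nat) (P : pred nat) : option nat :=
  ohead [seq k <- index_iota m n.+1 | P k].
Definition greatest (m n : nat) (P : pred nat) : option nat :=
  ohead (rev [seq k <- index_iota m n.+1 | P k]).

Definition entry (T : tableau) (i j : nat) : nat := odflt 0 T.[? (i, j)].

(* Comparisons with T_{ij}, which is infinite outside the shape. *)
Definition entry_le (T : tableau) (i j a : nat) : bool :=
  if T.[? (i, j)] is Some v then v <= a else false.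
Definition lt_entry (a : nat) (T : tableau) (i j : nat) : bool :=
  if T.[? (i, j)] is Some v then a < v else true.

Inductive rule : Type :=
  | R1 | R2 | R3 | R4 | D1 | D2 | D3 | D4 | C1 | C2 | C3 | C4.

Definition transition : Type := (rule * box * state)%type.

(* The defaults 0 below are not reached: (i, i + cols T) and (rows T + 1, j)
   are outside T. *)
Definition fwd_row (T : tableau) (i a : nat) : transition :=
  let D := domf T in
  match least i (cols D) (fun x => ((i, x) \in D) && (a < entry T i x)) with
  | None =>
      let j := odflt 0 (least i (i + cols D) (fun j => (i, j) \notin D)) in
      let V := T.[(i, j) <- a] in
      if `[< increasing V /\ shifted (domf V) >]
      then (R1, (i, j), Terminal V)
      else (R2, (i, j), Terminal T)
  | Some x =>
      let b := entry T i x in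
      let T' := T.[(i, x) <- a] in
      if i < x then
        if `[< increasing T' >] then (R4, (i, x), RowOuter T' i.+1 b)
        else if (i.+1 < x) || has (fun p => p.1 == i.+1) D
        then (R3, (i, x), RowOuter T i.+1 b)
        else (* x = i + 1 and row i + 1 is empty *)
          (D1, (i, x), ColOuter T i.+1 b)
      else
        if odd a == odd b then
          if `[< increasing T' >] then (D3, (i, x), ColOuter T' i.+1 b)
          else (D2, (i, x), ColOuter T i.+1 b)
        else (D4, (i, x), ColOuter T i.+1 b.+1)
  end.

Definition fwd_col (T : tableau) (j a : nat) : transition :=
  let D := domf T in
  match least 1 (rows D) (fun x => ((x, j) \in D) && (a < entry T x j)) with
  | None =>
      let i := odflt 0 (least 1 (rows D).+1 (fun i => (i, j) \notin D)) in
      let V := T.[(i, j) <- a] in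
      if `[< increasing V /\ shifted (domf V) >]
      then (C1, (i, j), Terminal V)
      else (C2, (i, j), Terminal T)
  | Some x =>
      let b := entry T x j in
      let T' := T.[(x, j) <- a] in
      if `[< increasing T' >] then (C4, (x, j), ColOuter T' j.+1 b)
      else (C3, (x, j), ColOuter T j.+1 b)
  end.

Definition fwd (U : state) : option transition :=
  match U with
  | Terminal _ => None
  | RowOuter T i a => Some (fwd_row T i a)
  | ColOuter T j a => Some (fwd_col T j a)
  end.

(* The last transition of the path of forward transitions starting at U, with
   its final tableau; None if no terminal state is reached in n steps. *)
Fixpoint fwd_path (n : nat) (U : state) : option (rule * box * tableau) :=
  match n, fwd U with
  | n'.+1, Some (r, p, Terminal T) => Some (r, p, T)
  | n'.+1, Some (_, _, V) => fwd_path n' V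
  | _, _ => None
  end.

(* T <- a.  Along the path the outer box visits each of the rows 1, ...,
   rows + 1 at most once and then each of the columns 2, ..., cols + 1 at most
   once, whence the bound on the number of transitions. *)
Definition insertion (T : tableau) (a : nat) : option (rule * box * tableau) :=
  fwd_path (rows (domf T) + cols (domf T) + 2) (RowOuter T 1 a).

Definition P_Sp (w : seq nat) : option tableau :=
  foldl (fun oT a => obind (fun T => omap snd (insertion T a)) oT)
    (Some [fmap]) w.

Definition add_letter (Q : svtableau) (p : box) (a : letter) : svtableau :=
  Q.[p <- a |` letters_at Q p].

Definition last_in_col (D : shape) (j : nat) : box :=
  (odflt 0 (greatest 1 (rows D) (fun i => (i, j) \in D)), j).
Definition last_in_row (D : shape) (i : nat) : box :=
  (i, odflt 0 (greatest 1 (cols D) (fun j => (i, j) \in D))).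

Definition record_letter (Q : svtableau) (n : nat) (r : rule) (p : box) :
    option svtableau :=
  match r with
  | R1 => Some (add_letter Q p (n, false))
  | C1 => Some (add_letter Q p (n, true))
  | R2 => Some (add_letter Q (last_in_col (domf Q) p.2.-1) (n, false))
  | C2 => Some (add_letter Q (last_in_row (domf Q) p.1.-1) (n, true))
  | _ => None
  end.

(* v is the reversed word, so that its head is the last letter inserted. *)
Fixpoint Q_Sp_rev (v : seq nat) : option svtableau :=
  if v is a :: v' then
    match Q_Sp_rev v', obind (insertion^~ a) (P_Sp (rev v')) with
    | Some Q, Some (r, p, _) => record_letter Q (size v) r p
    | _, _ => None
    end
  else Some [fmap].

Definition Q_Sp (w : seq nat) : option svtableau := Q_Sp_rev (rev w).

Definition PQ_Sp (w : seq nat) : option (tableau * svtableau) :=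
  if (P_Sp w, Q_Sp w) is (Some P, Some Q) then Some (P, Q) else None.

(* The conditions compare the outer box with the boxes of the tableau T
   obtained by removing it. *)
Definition weakly_admissible (U : state) : Prop :=
  match U with
  | Terminal _ => True
  | RowOuter T i a =>
      (i = 1 \/
       exists x, [&& i <= x, entry_le T i.-1 x a & lt_entry a T i x]) /\
      (T.[? (i.-1, i)] = Some a -> (i, i) \in domf T)
  | ColOuter T j a =>
      T.[? (j.-1, j)] = Some a \/
      exists x, [&& 0 < x, x < j, entry_le T x j.-1 a & lt_entry a T x j]
  end.

Definition admissible (U : state) : Prop :=
  is_state U /\
  match U with
  | Terminal T => is_sp_Hecke_word (row_word T)
  | RowOuter T i a =>
      weakly_admissible U /\ is_sp_Hecke_word (row_word (state_tab U))
  | ColOuter T j a =>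
      [/\ weakly_admissible U, is_sp_Hecke_word (col_word (state_tab U)),
          T.[? (j.-1, j)] = Some a -> (j, j) \notin domf T \/ odd a &
          forall x, T.[? (x, j.-1)] = Some a -> 1 < x]
  end.

(* Whichever of T_{p} and T_{q} is defined and larger; entries are positive. *)
Definition larger (T : tableau) (p q : box) : nat :=
  maxn (entry T p.1 p.2) (entry T q.1 q.2).

Definition inv_terminal_row (V : tableau) (i j : nat) : option state :=
  if inner_corner (domf V) i j
  then Some (RowOuter V.[~ (i, j)] i (entry V i j))               (* iR1 *)
  else if outer_corner (domf V) i j && (i < j)
  then Some (RowOuter V i (larger V (i.-1, j) (i, j.-1)))         (* iR2 *)
  else None.

Definition inv_terminal_col (V : tableau) (i j : nat) : option state :=
  if inner_corner (domf V) i j && (i < j)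
  then Some (ColOuter V.[~ (i, j)] j (entry V i j))               (* iC1 *)
  else if outer_corner (domf V) i j && (1 < i)
  then Some (ColOuter V j (larger V (i.-1, j) (i, j.-1)))         (* iC2 *)
  else None.

(* For i > 1, with h = i - 1. *)
Definition inv_row (V : tableau) (i a : nat) : option state :=
  let h := i.-1 in
  if greatest i (cols (domf V)) (fun x => entry_le V h x a) is Some x then
    if entry V h x == a
    then Some (RowOuter V h (larger V (h, x.-1) (h.-1, x)))       (* iR3 *)
    else Some (RowOuter V.[(h, x) <- a] h (entry V h x))          (* iR4 *)
  else None.

(* With h = j - 1; V_{hh} is infinite when (h, h) is not in V. *)
Definition inv_col (V : tableau) (j a : nat) : option state :=
  let h := j.-1 in
  let d := entry V h h in
  if entry_le V h h a then
    if d == a then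
      let b := entry V h.-1 h in
      if odd b then Some (ColOuter V h b)                         (* iC3a *)
      else Some (RowOuter V h b)                                  (* iD2 *)
    else if odd a then Some (RowOuter V h d.-1)                   (* iD4 *)
    else if V.[? (h, j)] == Some a
    then Some (RowOuter V h (larger V (h, h) (h.-1, j)))          (* iD1 *)
    else if lt_entry a V h j then Some (RowOuter V.[(h, h) <- a] h d) (* iD3 *)
    else None
  else if greatest 1 h.-1 (fun x => entry_le V x h a) is Some x then
    if entry V x h == a
    then Some (ColOuter V h (larger V (x.-1, h) (x, h.-1)))       (* iC3b *)
    else Some (ColOuter V.[(x, h) <- a] h (entry V x h))          (* iC4 *)
  else None.

Definition inv (V : state) : option state :=
  if `[< admissible V >] then
    match V with
    | Terminal _ => None
    | RowOuter T i a => if i == 1 then None else inv_row T i a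
    | ColOuter T j a => inv_col T j a
    end
  else None.

(* The (hat P, a) such that the path of inverse transitions starting at V ends
   at the initial state in which a is added to the first row of hat P; None if
   no initial state is reached in n steps. *)
Fixpoint inv_path (n : nat) (V : state) : option (tableau * nat) :=
  match V with
  | RowOuter T 1 a => Some (T, a)
  | _ => if n is n'.+1 then obind (inv_path n') (inv V) else None
  end.

Definition outer_corner_row (D : shape) (j : nat) : option nat :=
  least 1 (rows D).+1 (fun r => outer_corner D r j).
Definition outer_corner_col (D : shape) (i : nat) : option nat :=
  least 1 (cols D).+1 (fun s => outer_corner D i s).

(* The box containing n or n', for n = |Q|. *)
Definition max_box (Q : svtableau) : option box :=
  ohead [seq p <- domf Q |
    ((weight Q, false) \in letters_at Q p) ||
    ((weight Q, true) \in letters_at Q p)].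

(* The inner corner containing n or n' holds exactly one of these two letters,
   so the four cases for V_1 reduce to the tests below. *)
Definition first_inv (P : tableau) (Q : svtableau) : option state :=
  let n := weight Q in
  if `[< admissible (Terminal P) >] then
    if max_box Q is Some (i, j) then
      let E := letters_at Q (i, j) in
      if E == [fset (n, false)] then inv_terminal_row P i j
      else if E == [fset (n, true)] then inv_terminal_col P i j
      else if (n, false) \in E then
        obind (fun r => inv_terminal_row P r j.+1)
          (outer_corner_row (domf Q) j.+1)
      else
        obind (fun s => inv_terminal_col P i.+1 s)
          (outer_corner_col (domf Q) i.+1)
    else None
  else None.

(* Q with n and n' removed, for n = |Q|. *)
Definition remove_max (Q : svtableau) : svtableau :=
  if max_box Q is Some p then
    let E := letters_at Q p `\ (weight Q, false) `\ (weight Q, true) in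
    if E == fset0 then Q.[~ p] else Q.[p <- E]
  else Q.

Definition uninsert (x : tableau * svtableau * seq nat) :
    option (tableau * svtableau * seq nat) :=
  let: (P, Q, w) := x in
  (* The outer box of an inverse path visits each row and column at most once. *)
  obind (fun V1 =>
      omap (fun Pa : tableau * nat => (Pa.1, remove_max Q, Pa.2 :: w))
        (inv_path (rows (domf P) + cols (domf P) + 2) V1))
    (first_inv P Q).

Definition w_Sp (PQ : tableau * svtableau) : option (seq nat) :=
  if iter (weight PQ.2) (obind uninsert) (Some (PQ, [::])) is Some (P, Q, w)
  then if (P == [fmap]) && (Q == [fmap]) then Some w else None
  else None.

(* f and g restrict to mutually inverse bijections between A and B; in
   particular f is defined on A and g is defined on B. *)
Definition inverse_bijections (X Y : Type)
    (f : X -> option Y) (g : Y -> option X) (A : X -> Prop) (B : Y -> Prop) :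
    Prop :=
  (forall x, A x -> exists y, [/\ f x = Some y, B y & g y = Some x]) /\
  (forall y, B y -> exists x, [/\ g y = Some x, A x & f x = Some y]).

(* Main.v *)
Require Import Defs.
From HB Require Import structures.
From mathcomp Require Import all_boot all_order all_algebra.
From mathcomp Require Import finmap.
From mathcomp.multinomials Require Import freeg.
From mathcomp Require Import boolp zify.

(** The theorem says that insertion is reversible step by step, with the recording
    tableau remembering where to start the reverse process.

    The generators [U_i] satisfy the 0-Hecke relations, and [N_Theta] satisfies in
    addition [N_Theta U_a U_(a+1) = N_Theta U_a U_(a-1)] for even [a], while
    [N_Theta U_a = 0] for odd [a] ([act1_idem], [act1_far], [act1_braid],
    [act_switch], [alive_head]).  A single transition changes the reading word of a
    state, by rows or by columns according to the position of its outer box, only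
    by these relations ([link_word]).  Row and column readings of a shifted tableau
    are equivalent since boxes strictly south-east of each other carry commuting
    letters ([heq_sh_row_col]); this is what allows a path to turn from rows to
    columns.  Among the rules, only D4 uses the extra relation.

    Because the reading word of an admissible state is a symplectic Hecke word, the
    entries on the diagonal, and some of those next to it, are even
    ([alive_front] and the lemmas that use it).  With this information, the forward
    rules and the inverse rules can be merged into a single relation [link] with
    one constructor for each rule.  It is contained in the graph of the forward map
    and in the converse of the graph of the inverse map ([link_fwd], [link_inv]),
    and every admissible state that is not terminal (not initial) is the source
    (target) of a link ([exists_fwd], [exists_inv]).  Admissibility passes along
    links in both directions ([link_Adm]).  Hence on admissible states both maps walk along the same paths
    in opposite directions.  The outer box visits each row and then each column at
    most once, so the paths end ([insertion_complete], [inv_path_terminal]).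

    The last transition of a path either adds an inner corner to the shape or is
    tied to an outer corner of it, and is of row or of column type.  The letter
    added to the recording tableau encodes these data: it lies in an inner corner,
    which is the new box, or the box next to the outer corner along the boundary,
    and it is primed for column type ([link_targetP]).  So the largest letter of a
    standard tableau determines the last transition ([first_inv_complete]), and
    induction on the length of the word gives the bijection ([sp_bijection]).

    For words of minimal length, note that the reading word of [P] is a word for
    the same [z] as [w], of length the number of boxes of the common shape, which
    is at most [|Q| = n], with equality exactly when [Q] is marked
    ([size_row_word_weight]).  Thus [w] of length [n] is minimal if and only if [Q]
    is marked and the reading word of [P] is minimal. *)

Set Implicit Arguments.
Unset Strict Implicit.
Unset Printing Implicit Defensive.

Local Open Scope fset_scope.
Local Open Scope fmap_scope.
Local Open Scope nat_scope.

(** * The action on fixed-point-free involutions *)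

Lemma Finfty_ext (x y : Finfty) : x =1 y -> x = y.
Proof.
case: x y => [f fP] [g gP] /= /funext fg; subst g.
by congr MkFinfty; apply: Prop_irrelevance.
Qed.

Lemma ThetaK : involutive Theta.
Proof.
move=> i; rewrite /Theta; have := odd_double_half i.
by case: (odd i) => iE; case: ifP; rewrite -{1}iE; lia.
Qed.

Lemma FinftyK (x : Finfty) : involutive x.
Proof.
case: x => f [p [q [_ pK qK fE]]] k /=.
by rewrite !fE /= qK ThetaK pK.
Qed.

Lemma Finfty_inj (x : Finfty) : injective x.
Proof. exact: inv_inj (FinftyK x). Qed.

Lemma Finfty_fix (x : Finfty) k : 0 < k -> x k != k.
Proof.
case: x => f [p [q [[_ p0 _] pK qK fE]]] /= k0.
apply/eqP; rewrite fE /= => /(congr1 p); rewrite qK => E.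
have p1 : p k != 0 by apply: contraTneq k0 => pk; rewrite -(pK k) pk -p0 pK.
by move: E; rewrite /Theta; case: ifP; lia.
Qed.

(** The right action of [U_i] sends a basis vector to a basis vector or to
    zero, so it is a partial action on [Finfty] itself. *)
Definition act1 (i : nat) (x : Finfty) : option Finfty :=
  if x i < x i.+1 then Some (Fconj i x)
  else if (x i != i.+1) && (x i.+1 != i) then Some x else None.

Definition act (w : seq nat) (o : option Finfty) : option Finfty :=
  foldl (fun o i => obind (act1 i) o) o w.

Lemma act_cat u v o : act (u ++ v) o = act v (act u o).
Proof. exact: foldl_cat. Qed.

Lemma act_None w : act w None = None.
Proof. by elim: w. Qed.

Definition vec (o : option Finfty) : {freeg Finfty} :=
  if o is Some x then << x >> else 0%R.

Lemma U_vec i o : U i (vec o) = vec (obind (act1 i) o).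
Proof.
case: o => [x|] /=; last by rewrite /U -(freegU0 _ FTheta) liftU GRing.scale0r freegU0.
rewrite /U liftU GRing.scale1r /U_basis /act1.
by case: ifP => // _; case: ifP.
Qed.

Lemma foldl_U_vec w o : foldl (fun y i => U i y) (vec o) w = vec (act w o).
Proof. by elim: w o => //= i w IH o; rewrite U_vec IH. Qed.

Lemma vec_inj : injective vec.
Proof.
have N x : << x >> != 0%R :> {freeg Finfty} by rewrite freegU_eq0 GRing.oner_eq0.
move=> [x|] [y|] //= E.
- have := congr1 (coeff y) E; rewrite !coeffU eqxx !GRing.mul1r.
  by case: eqP => [->|].
- by have := N x; rewrite E eqxx.
- by have := N y; rewrite -E eqxx.
Qed.

Lemma sp_Hecke_wordE z w :
  sp_Hecke_word z w <-> (0 \notin w) /\ act w (Some FTheta) = Some z.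
Proof.
rewrite /sp_Hecke_word -/(vec (Some FTheta)) -/(vec (Some z)) foldl_U_vec.
by split=> [[-> /vec_inj ->]|[-> ->]].
Qed.

(** Equality in the 0-Hecke monoid, as far as the action can see it. *)
Definition heq (u v : seq nat) : Prop := forall o, act u o = act v o.

Lemma heq_sym u v : heq u v -> heq v u. Proof. by move=> h o. Qed.
Lemma heq_trans u v w : heq u v -> heq v w -> heq u w.
Proof. by move=> h1 h2 o; rewrite h1. Qed.
Lemma heq_cat u u' v v' : heq u u' -> heq v v' -> heq (u ++ v) (u' ++ v').
Proof. by move=> hu hv o; rewrite !act_cat hu hv. Qed.
Lemma heq_catl u v v' : heq v v' -> heq (u ++ v) (u ++ v').
Proof. exact: heq_cat. Qed.
Lemma heq_catr u u' v : heq u u' -> heq (u ++ v) (u' ++ v).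
Proof. by move=> h; apply: heq_cat. Qed.

Definition far (a b : nat) : bool := (a.+1 < b) || (b.+1 < a).

Lemma simple_refl_spec i k :
  [\/ i = 0 /\ simple_refl i k = k, [/\ 0 < i, k = i & simple_refl i k = i.+1],
     [/\ 0 < i, k = i.+1 & simple_refl i k = i] |
     [/\ 0 < i, k <> i, k <> i.+1 & simple_refl i k = k]].
Proof.
rewrite /simple_refl; case: eqP => ?; first by constructor 1.
have ? : 0 < i by lia.
case: eqP => ?; first by constructor 2.
by case: eqP => ?; [constructor 3|constructor 4].
Qed.

(* The innermost reflection goes first: its value is the argument of the next
   one. *)
Ltac refl_lia :=
  repeat match goal with
  | |- context [simple_refl ?i ?k] =>
    lazymatch k with context [simple_refl _ _] => fail | _ => idtac end;
    let s := fresh "s" in let H := fresh "H" in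
    have H := simple_refl_spec i k;
    move: (simple_refl i k) H => s; move=> [[? ?]|[? ? ?]|[? ? ?]|[? ? ? ?]]; subst
  end; try lia.

Lemma simple_refl_l i : 0 < i -> simple_refl i i = i.+1.
Proof. by move=> i0; refl_lia. Qed.
Lemma simple_refl_r i : 0 < i -> simple_refl i i.+1 = i.
Proof. by move=> i0; refl_lia. Qed.
Lemma simple_refl_id i k : k != i -> k != i.+1 -> simple_refl i k = k.
Proof. by move=> k1 k2; refl_lia. Qed.

Lemma simple_refl_far a b k :
  far a b -> simple_refl a (simple_refl b k) = simple_refl b (simple_refl a k).
Proof. by rewrite /far => ab; refl_lia. Qed.

Lemma simple_refl_braid a k : 0 < a ->
  simple_refl a (simple_refl a.+1 (simple_refl a k)) =
  simple_refl a.+1 (simple_refl a (simple_refl a.+1 k)).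
Proof. by move=> a0; refl_lia. Qed.

Lemma act1_idem i o : 0 < i -> obind (act1 i) (obind (act1 i) o) = obind (act1 i) o.
Proof.
move=> i0; case: o => [x|] //=; rewrite {2 3}/act1.
case: ifP => [lt|nlt]; last by case: ifP => //= E; rewrite /act1 nlt E.
have n1 := Finfty_fix x i0; have n2 := @Finfty_fix x i.+1 isT.
have E1 := FinftyK x i; have E2 := FinftyK x i.+1.
have a1 : x i != i.+1 by apply/eqP => a; rewrite a in E1 lt; lia.
have a2 : x i.+1 != i by apply/eqP => a; rewrite a in E2 lt; lia.
rewrite /= /act1 /= simple_refl_l // simple_refl_r // !simple_refl_id //.
by rewrite ltnNge ltnW //= n1 n2.
Qed.

(** Conjugation by [s_a] can disturb the comparison of [x b] with [x b.+1] only
    if [x] exchanges the pairs {a, a+1} and {b, b+1}. *)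
Lemma act1_conj a b (x : Finfty) : 0 < a -> 0 < b -> far a b ->
    ~~ ((x b == a) && (x b.+1 == a.+1)) -> ~~ ((x b == a.+1) && (x b.+1 == a)) ->
  act1 b (Fconj a x) = omap (Fconj a) (act1 b x).
Proof.
move=> a0 b0 ab n1 n2; rewrite /act1 /=.
have bb : x b != x b.+1 by apply/eqP => /Finfty_inj; lia.
rewrite !(@simple_refl_id a b) ?(@simple_refl_id a b.+1); try by move: ab; rewrite /far; lia.
have -> : (simple_refl a (x b) < simple_refl a (x b.+1)) = (x b < x b.+1).
  by move: ab bb n1 n2; rewrite /far; refl_lia.
have -> : (simple_refl a (x b) != b.+1) = (x b != b.+1).
  by move: ab bb n1 n2; rewrite /far; refl_lia.
have -> : (simple_refl a (x b.+1) != b) = (x b.+1 != b).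
  by move: ab bb n1 n2; rewrite /far; refl_lia.
case: ifP => _ /=; last by case: ifP.
congr Some; apply: Finfty_ext => k /=.
by rewrite !(simple_refl_far _ ab).
Qed.

Lemma act1_cases i x :
  [\/ act1 i x = Some (Fconj i x), act1 i x = Some x | act1 i x = None].
Proof.
by rewrite /act1; case: ifP => _; [constructor 1|case: ifP => _; [constructor 2|constructor 3]].
Qed.

Lemma act1_far a b o : 0 < a -> 0 < b -> far a b ->
  obind (act1 a) (obind (act1 b) o) = obind (act1 b) (obind (act1 a) o).
Proof.
move=> a0 b0 ab; case: o => [x|] //=.
have ba : far b a by rewrite /far orbC.
have Kb := FinftyK x b; have Kb' := FinftyK x b.+1.
(* Here [x] carries [s_b] to [s_a]: acting with either letter gives the same
   involution, on which the other letter acts trivially. *)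
have [/andP[/eqP Eb /eqP Eb']|n1] := boolP ((x b == a) && (x b.+1 == a.+1)).
  rewrite Eb in Kb; rewrite Eb' in Kb'.
  have E k : simple_refl b (x k) = x (simple_refl a k).
    have [->|ka] := eqVneq k a; first by rewrite simple_refl_l // Kb Kb' simple_refl_l.
    have [->|ka'] := eqVneq k a.+1; first by rewrite simple_refl_r // Kb Kb' simple_refl_r.
    rewrite (simple_refl_id ka ka') simple_refl_id //.
      by rewrite -Kb (inj_eq (@Finfty_inj x)).
    by rewrite -Kb' (inj_eq (@Finfty_inj x)).
  have E' k : simple_refl a (x k) = x (simple_refl b k).
    by rewrite -[in RHS](FinftyK x k) E FinftyK.
  have [sab sab' sba sba'] : [/\ simple_refl a b = b, simple_refl a b.+1 = b.+1,
      simple_refl b a = a & simple_refl b a.+1 = a.+1].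
    by split; apply: simple_refl_id; move: ab; rewrite /far; lia.
  have N k : (k.+1 < k) = false by lia.
  rewrite /act1 Eb Eb' ltnSn Kb Kb' ltnSn /= sab sab' sba sba' Eb Eb' Kb Kb'.
  rewrite !simple_refl_l // !simple_refl_r // !N.
  rewrite !ifT; try by move: ab; rewrite /far; lia.
  by congr Some; apply: Finfty_ext => k /=; rewrite E E' (simple_refl_far _ ab).
have [/andP[/eqP Eb /eqP Eb']|n2] := boolP ((x b == a.+1) && (x b.+1 == a)).
  rewrite Eb in Kb; rewrite Eb' in Kb'.
  rewrite /act1 Eb Eb' Kb Kb' (ltnNge a.+1) leqnSn (ltnNge b.+1) leqnSn /=.
  rewrite !ifT; try by move: ab; rewrite /far; lia.
  by rewrite /= Eb Eb' Kb Kb' !(ltnNge _.+1) !leqnSn /= !ifT //; move: ab; rewrite /far; lia.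
have Ca := act1_conj a0 b0 ab n1 n2.
have Cb : act1 a (Fconj b x) = omap (Fconj b) (act1 a x).
  apply: act1_conj => //; [apply: contra n1|apply: contra n2];
    by move=> /andP[/eqP<- /eqP<-]; rewrite !FinftyK !eqxx.
have C : Fconj a (Fconj b x) = Fconj b (Fconj a x).
  by apply: Finfty_ext => k /=; rewrite !(simple_refl_far _ ab).
by case: (act1_cases a x) Cb => Ea; case: (act1_cases b x) Ca => Eb;
  rewrite Ea Eb /= => Ca Cb; rewrite ?Ca ?Cb ?Ea ?Eb ?C.
Qed.

(** If [x] exchanges two of [a], [a+1], [a+2], only the position of the image of
    the third one matters; otherwise the relative order of the three images
    determines which of the six letters conjugate. *)
Lemma act1_braid a o : 0 < a ->
  obind (act1 a) (obind (act1 a.+1) (obind (act1 a) o)) =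
  obind (act1 a.+1) (obind (act1 a) (obind (act1 a.+1) o)).
Proof.
move=> a0; case: o => [x|] //=.
have Ka := FinftyK x a; have Kb := FinftyK x a.+1; have Kc := FinftyK x a.+2.
have Fa := Finfty_fix x a0; have Fb := @Finfty_fix x a.+1 isT; have Fc := @Finfty_fix x a.+2 isT.
have ab : x a != x a.+1 by apply/eqP => /Finfty_inj; lia.
have bc : x a.+1 != x a.+2 by apply/eqP => /Finfty_inj; lia.
have ac : x a != x a.+2 by apply/eqP => /Finfty_inj; lia.
have laa := simple_refl_l a0; have laa' := simple_refl_r a0.
have lbb := simple_refl_l (ltn0Sn a); have lbb' := simple_refl_r (ltn0Sn a).
have lac : simple_refl a a.+2 = a.+2 by apply: simple_refl_id; lia.
have lba : simple_refl a.+1 a = a by apply: simple_refl_id; lia.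
have B k := simple_refl_braid k a0.
have N k : (k.+1 < k) = false by lia.
have N2 k : (k.+2 < k) = false by lia.
have I k : (k < k.+2) by lia.
have n1 k : k == k.+1 = false by lia.
have n1' k : k.+1 == k = false by lia.
have n2 k : k == k.+2 = false by lia.
have n2' k : k.+2 == k = false by lia.
have out k : x k != a -> x k != a.+1 -> x k != a.+2 ->
  [/\ simple_refl a (x k) = x k & simple_refl a.+1 (x k) = x k].
  by move=> ? ? ?; split; apply: simple_refl_id.
have cmp k : x k != a -> x k != a.+1 -> x k != a.+2 ->
   ((x k < a = true) * (x k < a.+1 = true) * (x k < a.+2 = true) *
    (a < x k = false) * (a.+1 < x k = false) * (a.+2 < x k = false) +
   ((x k < a = false) * (x k < a.+1 = false) * (x k < a.+2 = false) *
    (a < x k = true) * (a.+1 < x k = true) * (a.+2 < x k = true)))%type.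
  by move=> ? ? ?; case: (ltnP (x k) a) => ?; [left|right]; do !split; lia.
pose ev := (laa, laa', lbb, lbb', lac, lba, N, N2, I, ltnSn, n1, n1', n2, n2', eqxx).
have [Eab|Nab] := eqVneq (x a) a.+1.
  have Eba : x a.+1 = a by rewrite -Eab.
  have c1 : x a.+2 != a by apply/eqP => E; move: Kc; rewrite E Eab; lia.
  have c2 : x a.+2 != a.+1 by apply/eqP => E; move: Kc; rewrite E Eba; lia.
  have [sc sc'] := out _ c1 c2 Fc.
  by case: (cmp _ c1 c2 Fc) => H;
    rewrite /act1; do !progress (rewrite ?(Eab, Eba, sc, sc', c1, c2, Fa, Fb, Fc, H, ev) /=).
have [Eac|Nac] := eqVneq (x a) a.+2.
  have Eca : x a.+2 = a by rewrite -Eac.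
  have c1 : x a.+1 != a by apply/eqP => E; move: Kb; rewrite E Eac; lia.
  have c2 : x a.+1 != a.+2 by apply/eqP => E; move: Kb; rewrite E Eca; lia.
  have [sc sc'] := out _ c1 Fb c2.
  by case: (cmp _ c1 Fb c2) => H;
    rewrite /act1; do !progress (rewrite ?(Eac, Eca, sc, sc', c1, c2, Fa, Fb, Fc, H, ev) /=).
have [Ebc|Nbc] := eqVneq (x a.+1) a.+2.
  have Ecb : x a.+2 = a.+1 by rewrite -Ebc.
  have c1 : x a != a.+1 by apply/eqP => E; move: Ka; rewrite E Ebc; lia.
  have c2 : x a != a.+2 by apply/eqP => E; move: Ka; rewrite E Ecb; lia.
  have [sc sc'] := out _ Fa c1 c2.
  by case: (cmp _ Fa c1 c2) => H;
    rewrite /act1; do !progress (rewrite ?(Ebc, Ecb, sc, sc', c1, c2, Fa, Fb, Fc, H, ev) /=).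
have Nba : x a.+1 != a by apply/eqP => E; move: Kb; rewrite E; lia.
have Nca : x a.+2 != a by apply/eqP => E; move: Kc; rewrite E; lia.
have Ncb : x a.+2 != a.+1 by apply/eqP => E; move: Kc; rewrite E; lia.
have [sa sa'] := out _ Fa Nab Nac.
have [sb sb'] := out _ Nba Fb Nbc.
have [sc sc'] := out _ Nca Ncb Fc.
have tot k l : x k != x l ->
  ((x k < x l = true) * (x l < x k = false) + ((x k < x l = false) * (x l < x k = true)))%type.
  by move=> ?; case: (ltnP (x k) (x l)) => ?; [left|right]; split; lia.
case: (tot _ _ ab) => Hab; case: (tot _ _ bc) => Hbc; case: (tot _ _ ac) => Hac;
  rewrite /act1; do !progress (rewrite ?(Hab, Hbc, Hac, sa, sa', sb, sb', sc, sc', ev, Fa, Fb, Fc, Nab, Nac, Nbc, Nba, Nca, Ncb) /=);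
  congr Some; apply: Finfty_ext => k /=; rewrite ?B ?simple_reflK //;
  by case: Hab => ? ?; case: Hbc => ? ?; case: Hac => ? ?; lia.
Qed.

(** * Word relations *)

Notation posw := (all (leq 1)).

Lemma heq_far a b : 0 < a -> 0 < b -> far a b -> heq [:: a; b] [:: b; a].
Proof. by move=> a0 b0 ab o; rewrite /act /= act1_far // /far orbC. Qed.

Lemma heq_idem a : 0 < a -> heq [:: a; a] [:: a].
Proof. by move=> a0 o; rewrite /act /= act1_idem. Qed.

Lemma heq_braid a : 0 < a -> heq [:: a; a.+1; a] [:: a.+1; a; a.+1].
Proof. by move=> a0 o; rewrite /act /= act1_braid. Qed.

Lemma far_sym a b : far a b = far b a.
Proof. by rewrite /far orbC. Qed.

Lemma heq_comm a u : 0 < a -> posw u -> all (far a) u ->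
  heq (a :: u) (u ++ [:: a]).
Proof.
move=> a0; elim: u => [|b u IH] //= /andP[b0 u0] /andP[ab au].
apply: (heq_trans (v := b :: a :: u)).
  exact: (heq_catr (u := [:: a; b]) (u' := [:: b; a]) u (heq_far a0 b0 ab)).
exact: (heq_catl [:: b] (IH u0 au)).
Qed.

Lemma heq_comm_cat a u v : 0 < a -> posw u -> all (far a) u ->
  heq (a :: u ++ v) (u ++ a :: v).
Proof.
move=> a0 u0 au; rewrite -cat_cons -[u ++ a :: v]/(u ++ [:: a] ++ v) catA.
exact: heq_catr (heq_comm a0 u0 au).
Qed.

(** Move the first letter to the right until it meets its copy; a repeated letter
    can be dropped. *)
Lemma heq_absorb a u v : 0 < a -> posw u -> all (far a) u ->
  heq (a :: u ++ a :: v) (u ++ a :: v).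
Proof.
move=> a0 u0 au; apply: heq_trans (heq_comm_cat _ a0 u0 au) _.
by apply: heq_catl; exact: (heq_catr v (heq_idem a0)).
Qed.

(** Pull the first letter of the first listing to the front of the second one.
    It only passes cells that the two listings order differently. *)
Lemma heq_reorder (C : eqType) (f : C -> nat) (r1 r2 : rel C) (s1 s2 : seq C) :
    uniq s1 -> perm_eq s1 s2 -> pairwise r1 s1 -> pairwise r2 s2 ->
    {in s1, forall x, 0 < f x} ->
    {in s1 &, forall x y, r1 x y -> r2 y x -> far (f x) (f y)} ->
  heq (map f s1) (map f s2).
Proof.
elim: s1 s2 => [|x s1 IH] s2 /=; first by move=> _; rewrite perm_sym => /perm_nilP->.
move=> /andP[xs1 us1] p12 /andP[rx1 r1s] r2s fpos com.
have x2 : x \in s2 by rewrite -(perm_mem p12) mem_head.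
case/splitPr: x2 p12 r2s => p q p12 r2s.
have p12' : perm_eq s1 (p ++ q).
  by move: p12; rewrite perm_sym perm_catC /= perm_cons perm_catC perm_sym.
have sub y : y \in p ++ q -> y \in x :: s1 by rewrite -(perm_mem p12') inE orbC => ->.
move: r2s; rewrite pairwise_cat /= allrel_consr.
move=> /and3P[/andP[r2x r2pq] r2p /andP[_ r2q]].
have H : heq (map f s1) (map f (p ++ q)).
  apply: IH => //.
  - by rewrite pairwise_cat r2pq r2p.
  - by move=> y ys; apply: fpos; rewrite inE ys orbT.
  - by move=> y y' ys ys'; apply: com; rewrite inE ?ys ?ys' orbT.
apply: (heq_trans (v := f x :: map f (p ++ q))); first exact: (heq_catl [:: f x] H).
rewrite !map_cat; apply: heq_comm_cat.
- by apply: fpos; rewrite mem_head.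
- by apply/allP => _ /mapP[y yp ->]; apply: fpos; apply: sub; rewrite mem_cat yp.
- apply/allP => _ /mapP[y yp ->].
  have ypq : y \in p ++ q by rewrite mem_cat yp.
  apply: com; rewrite ?mem_head ?sub //.
  + by apply: (allP rx1); rewrite (perm_mem p12').
  + exact: (allP r2x).
Qed.

(** For positive letters, these are the symplectic Hecke words. *)
Definition alive (w : seq nat) : Prop := act w (Some FTheta) <> None.

Lemma alive_prefix u v : alive (u ++ v) -> alive u.
Proof. by rewrite /alive act_cat => h E; apply: h; rewrite E act_None. Qed.

Lemma alive_heq u v : heq u v -> alive u -> alive v.
Proof. by rewrite /alive => ->. Qed.

(** [Theta] exchanges [a] and [a+1] for odd [a], so [U_a] kills [N_Theta]. *)
Lemma alive_head a w : 0 < a -> alive (a :: w) -> ~~ odd a.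
Proof.
move=> a0; rewrite -cat1s => /alive_prefix; rewrite /alive /act /=.
rewrite /act1 /= /Theta /=; case: (odd a) => //=.
by rewrite ltnNge leqW //= eqxx.
Qed.

(** A letter that commutes with everything before it can be moved to the front.
    The parity statements about tableaux below rest on this. *)
Lemma alive_front u a v : 0 < a -> posw u -> all (far a) u ->
  alive (u ++ a :: v) -> ~~ odd a.
Proof.
move=> a0 u0 au /(alive_heq (heq_sym (heq_comm_cat v a0 u0 au))).
exact: alive_head.
Qed.

(** For even [a] both words conjugate [Theta] to the same involution, although
    they differ in the 0-Hecke monoid.  Rule D4 changes the reading word by
    exactly this relation, which is only available at the start of a word. *)
Lemma act_switch a : 0 < a -> ~~ odd a ->
  act [:: a; a.+1] (Some FTheta) = act [:: a; a.-1] (Some FTheta).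
Proof.
case: a => [|[|m]] // _ /=; rewrite negbK => om.
have T1 : Theta m.+1 = m.+2 by rewrite /Theta /= om.
have T2 : Theta m.+2 = m.+1 by rewrite /Theta /= om.
have T3 : Theta m.+3 = m.+4 by rewrite /Theta /= om.
have T4 : Theta m.+4 = m.+3 by rewrite /Theta /= om.
have A i : simple_refl i.+1 i.+1 = i.+2 by apply: simple_refl_l.
have B i : simple_refl i.+1 i.+2 = i.+1 by apply: simple_refl_r.
have C i : simple_refl i.+1 i.+3 = i.+3 by apply: simple_refl_id; lia.
have D i : simple_refl i.+1 i.+4 = i.+4 by apply: simple_refl_id; lia.
have E i : simple_refl i.+2 i.+1 = i.+1 by apply: simple_refl_id; lia.
have F i : simple_refl i.+3 i.+1 = i.+1 by apply: simple_refl_id; lia.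
rewrite /act /= /act1 /= T2 T3 /= ifT; last by lia.
rewrite /= !(A, B, C, D, E, F, T1, T2, T3, T4) !ifT; try lia.
congr Some; apply: Finfty_ext => k /=.
have [->|k1] := eqVneq k m.+1; first by rewrite !(A, B, C, D, E, F, T1, T2, T3, T4).
have [->|k2] := eqVneq k m.+2; first by rewrite !(A, B, C, D, E, F, T1, T2, T3, T4).
have [->|k3] := eqVneq k m.+3; first by rewrite !(A, B, C, D, E, F, T1, T2, T3, T4).
have [->|k4] := eqVneq k m.+4; first by rewrite !(A, B, C, D, E, F, T1, T2, T3, T4).
have T j i : Theta j = i -> k != i -> Theta k != j.
  by move=> ji ki; apply: contra ki => /eqP; rewrite -ji => <-; rewrite ThetaK.
have := T _ _ T1 k2; have := T _ _ T2 k1; have := T _ _ T3 k4; have := T _ _ T4 k3.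
by move=> ? ? ? ?; rewrite !(simple_refl_id (k := k)) // !(simple_refl_id (k := Theta k)).
Qed.

Lemma heq_cons a u v : heq u v -> heq (a :: u) (a :: v).
Proof. exact: (heq_catl [:: a]). Qed.

Lemma heq_absorb_r a u v : 0 < a -> posw u -> all (far a) u ->
  heq (a :: u ++ a :: v) (a :: u ++ v).
Proof.
move=> a0 u0 au; apply: (heq_trans (v := [:: a; a] ++ u ++ v)).
  by apply: heq_cons; apply: heq_sym; apply: heq_comm_cat.
exact: (heq_catr (u ++ v) (heq_idem a0)).
Qed.

Lemma heq_swap a b v : 0 < a -> 0 < b -> far a b -> heq [:: a, b & v] [:: b, a & v].
Proof. by move=> a0 b0 ab; exact: (heq_catr v (heq_far a0 b0 ab)). Qed.

Lemma heq_dup a v : 0 < a -> heq [:: a, a & v] (a :: v).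
Proof. by move=> a0; exact: (heq_catr v (heq_idem a0)). Qed.

(** Either a braid relation, or both sides reduce to the product of two commuting
    letters. *)
Lemma heq_aba a b v : 0 < a -> a < b -> heq [:: a, b, a & v] [:: b, a, b & v].
Proof.
move=> a0 ab; have [->|ne] := eqVneq b a.+1.
  exact: (heq_catr v (heq_braid a0)).
have b0 : 0 < b by lia.
have ab' : far a b by rewrite /far; lia.
apply: heq_trans (heq_cons _ (heq_swap _ b0 a0 _)) _; first by rewrite far_sym.
apply: heq_trans (heq_dup _ a0) _; apply: heq_sym.
apply: heq_trans (heq_swap _ b0 a0 _) _; first by rewrite far_sym.
by apply: heq_cons; apply: heq_dup.
Qed.

(** * Reading words of fillings *)

(** A missing box has value 0, so this is the word read along [s]. *)
Definition vals (I : Type) (f : I -> nat) (s : seq I) : seq nat :=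
  [seq v <- map f s | 0 < v].

Lemma vals_cat I (f : I -> nat) s1 s2 : vals f (s1 ++ s2) = vals f s1 ++ vals f s2.
Proof. by rewrite /vals map_cat filter_cat. Qed.

Lemma vals_cons I (f : I -> nat) x s : 0 < f x -> vals f (x :: s) = f x :: vals f s.
Proof. by rewrite /vals /= => ->. Qed.

Lemma all_vals (I : eqType) (P : pred nat) (f : I -> nat) s :
  {in s, forall x, 0 < f x -> P (f x)} -> all P (vals f s).
Proof.
move=> H; apply/allP => v; rewrite mem_filter => /andP[v0 /mapP[x xs E]].
by subst v; apply: H.
Qed.

Lemma posw_vals (I : eqType) (f : I -> nat) s : posw (vals f s).
Proof. exact: all_vals. Qed.

Lemma vals_nil (I : eqType) (f : I -> nat) s : {in s, forall x, f x = 0} -> vals f s = [::].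
Proof.
elim: s => // x s IH H; rewrite /vals /= (H x) ?mem_head //=.
by apply: IH => y ys; apply: H; rewrite inE ys orbT.
Qed.

Lemma eq_vals (I : eqType) (f g : I -> nat) s : {in s, f =1 g} -> vals f s = vals g s.
Proof. by rewrite /vals => /eq_in_map->. Qed.

Lemma vals_filter I (f : I -> nat) s : vals f s = map f [seq x <- s | 0 < f x].
Proof. by rewrite /vals filter_map. Qed.

Lemma flatten_vals (I J : Type) (f : I -> J -> nat) s r :
  flatten [seq vals (f x) r | x <- s] =
  vals (fun p => f p.1 p.2) [seq (x, y) | x <- s, y <- r].
Proof.
elim: s => //= x s ->; rewrite vals_cat; congr (_ ++ _).
by rewrite /vals -map_comp.
Qed.

(** Tableaux become total functions, with 0 at the missing boxes, so that most
    statements about entries reduce to linear arithmetic. *)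
Definition filling := nat -> nat -> nat.
Implicit Types t : filling.

Definition upd t (i x a : nat) : filling :=
  fun k l => if (k == i) && (l == x) then a else t k l.

Section Readings.
Variables (N : nat) (t : filling).

Definition rowt i := vals (t i) (iota 1 N).
Definition colt j := vals (t^~ j) (rev (iota 1 N)).
Definition rowsw s := flatten [seq rowt i | i <- s].
Definition colsw s := flatten [seq colt j | j <- s].
Definition rhi i := rowsw (rev (iota i.+1 (N - i))).
Definition rlo i := rowsw (rev (iota 1 i.-1)).
Definition clo j := colsw (iota 1 j.-1).
Definition chi j := colsw (iota j.+1 (N - j)).
Definition rword := rowsw (rev (iota 1 N)).
Definition cword := colsw (iota 1 N).
(** The reading words of a state with outer box of value [a] in row [i] (column
    [j]): the outer box comes last in its row (first in its column). *)
Definition Wrow i a := rhi i ++ rowt i ++ a :: rlo i.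
Definition Wcol j a := clo j ++ a :: colt j ++ chi j.

Lemma iota_split i : 0 < i <= N -> iota 1 N = iota 1 i.-1 ++ i :: iota i.+1 (N - i).
Proof.
move=> iN; have {1}-> : N = i.-1 + (N - i).+1 by lia.
by rewrite iotaD /=; do !f_equal; lia.
Qed.

Lemma rword_split i : 0 < i <= N -> rword = rhi i ++ rowt i ++ rlo i.
Proof.
move=> iN; rewrite /rword (iota_split iN) rev_cat rev_cons /rowsw !map_cat !flatten_cat.
by rewrite map_rcons flatten_rcons -!catA.
Qed.

Lemma cword_split j : 0 < j <= N -> cword = clo j ++ colt j ++ chi j.
Proof. by move=> jN; rewrite /cword (iota_split jN) /colsw map_cat flatten_cat. Qed.

Lemma rhi_rec i : i < N -> rhi i = rhi i.+1 ++ rowt i.+1.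
Proof.
move=> iN; rewrite /rhi; have -> : N - i = (N - i.+1).+1 by lia.
by rewrite /= rev_cons /rowsw map_rcons flatten_rcons.
Qed.

Lemma rlo_rec i : 0 < i -> rlo i.+1 = rowt i ++ rlo i.
Proof.
case: i => // i _; rewrite /rlo (_ : iota 1 _ = iota 1 i ++ [:: i.+1]).
  by rewrite rev_cat.
by rewrite -[i.+2.-1]addn1 iotaD add1n.
Qed.

Lemma clo_rec j : 0 < j -> clo j.+1 = clo j ++ colt j.
Proof.
case: j => // j _; rewrite /clo (_ : iota 1 _ = iota 1 j ++ [:: j.+1]).
  by rewrite /colsw map_cat flatten_cat /= cats0.
by rewrite -[j.+2.-1]addn1 iotaD add1n.
Qed.

Lemma chi_rec j : j < N -> chi j = colt j.+1 ++ chi j.+1.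
Proof. by move=> jN; rewrite /chi; have -> : N - j = (N - j.+1).+1 by lia. Qed.

Definition rowL i x := vals (t i) (iota 1 x.-1).
Definition rowR i x := vals (t i) (iota x.+1 (N - x)).
Definition colD j x := vals (t^~ j) (rev (iota x.+1 (N - x))).
Definition colU j x := vals (t^~ j) (rev (iota 1 x.-1)).

Lemma rowt_split i x : 0 < x <= N -> 0 < t i x -> rowt i = rowL i x ++ t i x :: rowR i x.
Proof. by move=> xN tx; rewrite /rowt (iota_split xN) vals_cat vals_cons. Qed.

Lemma colt_split j x : 0 < x <= N -> 0 < t x j -> colt j = colD j x ++ t x j :: colU j x.
Proof.
move=> xN tx; rewrite /colt (iota_split xN) rev_cat rev_cons -cats1 -catA /=.
by rewrite vals_cat vals_cons.
Qed.

Lemma all_rowsw (P : pred nat) s :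
  (forall i j, i \in s -> 0 < j <= N -> 0 < t i j -> P (t i j)) -> all P (rowsw s).
Proof.
move=> H; apply/allP => v /flattenP[_ /mapP[i si ->]]; apply: (allP _).
by apply: all_vals => j; rewrite mem_iota => jN; apply: H => //; lia.
Qed.

Lemma all_colsw (P : pred nat) s :
  (forall i j, j \in s -> 0 < i <= N -> 0 < t i j -> P (t i j)) -> all P (colsw s).
Proof.
move=> H; apply/allP => v /flattenP[_ /mapP[j sj ->]]; apply: (allP _).
by apply: all_vals => i; rewrite mem_rev mem_iota => iN; apply: H => //; lia.
Qed.

Lemma all_rhi (P : pred nat) h :
  (forall i j, h < i <= N -> 0 < j <= N -> 0 < t i j -> P (t i j)) -> all P (rhi h).
Proof. by move=> H; apply: all_rowsw => i j; rewrite mem_rev mem_iota => ?; apply: H; lia. Qed.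
Lemma all_clo (P : pred nat) h :
  (forall i j, 0 < j < h -> 0 < i <= N -> 0 < t i j -> P (t i j)) -> all P (clo h).
Proof. by move=> H; apply: all_colsw => i j; rewrite mem_iota => ?; apply: H; lia. Qed.

Lemma all_rowL (P : pred nat) i x :
  (forall j, 0 < j < x -> 0 < t i j -> P (t i j)) -> all P (rowL i x).
Proof. by move=> H; apply: all_vals => j; rewrite mem_iota => ?; apply: H; lia. Qed.
Lemma all_rowR (P : pred nat) i x :
  (forall j, x < j <= N -> 0 < t i j -> P (t i j)) -> all P (rowR i x).
Proof. by move=> H; apply: all_vals => j; rewrite mem_iota => ?; apply: H; lia. Qed.
Lemma all_colU (P : pred nat) j x :
  (forall i, 0 < i < x -> 0 < t i j -> P (t i j)) -> all P (colU j x).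
Proof. by move=> H; apply: all_vals => i; rewrite mem_rev mem_iota => ?; apply: H; lia. Qed.
Lemma all_colD (P : pred nat) j x :
  (forall i, x < i <= N -> 0 < t i j -> P (t i j)) -> all P (colD j x).
Proof. by move=> H; apply: all_vals => i; rewrite mem_rev mem_iota => ?; apply: H; lia. Qed.

Lemma posw_rowsw s : posw (rowsw s).
Proof. exact: all_rowsw. Qed.
Lemma posw_colsw s : posw (colsw s).
Proof. exact: all_colsw. Qed.

End Readings.

Lemma eq_rowsw N t t' s : (forall i j, i \in s -> 0 < j <= N -> t i j = t' i j) ->
  rowsw N t s = rowsw N t' s.
Proof.
move=> H; congr flatten; apply/eq_in_map => i si.
by apply: eq_vals => j; rewrite mem_iota => ?; apply: H => //; lia.
Qed.

Lemma eq_colsw N t t' s : (forall i j, j \in s -> 0 < i <= N -> t i j = t' i j) ->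
  colsw N t s = colsw N t' s.
Proof.
move=> H; congr flatten; apply/eq_in_map => j sj.
by apply: eq_vals => i; rewrite mem_rev mem_iota => ?; apply: H => //; lia.
Qed.

(** Among the fillings of finite support, these local conditions single out the
    increasing shifted tableaux. *)
Record shtab t : Prop := Shtab {
  sh_dom : forall i j, 0 < t i j -> 0 < i <= j;
  sh_row : forall i j, i <= j -> 0 < t i j.+1 -> 0 < t i j < t i j.+1;
  sh_col : forall i j, 0 < i -> 0 < t i.+1 j -> 0 < t i j < t i.+1 j }.

Lemma sh_up t n i j : shtab t -> 0 < i -> 0 < t (i + n) j ->
  0 < t i j /\ t i j + n <= t (i + n) j.
Proof.
move=> st i0; elim: n => [|n IH]; first by rewrite !addn0; lia.
have in0 : 0 < i + n by lia.
by rewrite addnS => /(sh_col st in0) /andP[p q]; have [] := IH p; lia.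
Qed.

Lemma sh_left t n i j : shtab t -> i <= j -> 0 < t i (j + n) ->
  0 < t i j /\ t i j + n <= t i (j + n).
Proof.
move=> st ij; elim: n => [|n IH]; first by rewrite !addn0; lia.
have ijn : i <= j + n by lia.
by rewrite addnS => /(sh_row st ijn) /andP[p q]; have [] := IH p; lia.
Qed.

(** Go from [(i, j)] right or down to [(i', j')]: shiftedness keeps the path
    inside the shape, and every step increases the entry.  In particular the
    entries of boxes strictly south-east of each other commute as letters. *)
Lemma sh_dist t i j i' j' : shtab t -> 0 < t i' j' ->
  0 < i <= i' -> i <= j <= j' -> 0 < t i j /\ t i j + (i' - i) + (j' - j) <= t i' j'.
Proof.
move=> st t0 /andP[i0 ii] /andP[ij jj].
have := @sh_up t (i' - i) i j' st i0; rewrite subnKC // => /(_ t0) [p1 d1].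
have := @sh_left t (j' - j) i j st ij; rewrite subnKC // => /(_ p1) [p2 d2].
by split=> //; lia.
Qed.

Lemma pairwise_allpairs (I J : eqType) (rI : rel I) (rJ : rel J) s r :
  pairwise rI s -> pairwise rJ r ->
  pairwise (fun p q => rI p.1 q.1 || (p.1 == q.1) && rJ p.2 q.2) [seq (x, y) | x <- s, y <- r].
Proof.
move=> ps pr; elim: s ps => //= x s IH /andP[xs ps].
rewrite pairwise_cat IH // pairwise_map andbT; apply/andP; split.
  apply/allrelP => _ q /mapP[y _ ->] /allpairsP[[x' y'] /= [x's _ ->]] /=.
  by rewrite (allP xs).
by apply: sub_pairwise pr => y y' /= ->; rewrite eqxx orbT.
Qed.

Lemma pairwise_iota m n : pairwise ltn (iota m n).
Proof. by rewrite -sorted_pairwise ?iota_ltn_sorted //; exact: ltn_trans. Qed.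

Lemma pairwise_rev (T : Type) (r : rel T) s : pairwise r (rev s) = pairwise (fun x y => r y x) s.
Proof.
elim: s => //= x s IH; rewrite rev_cons -cats1 pairwise_cat IH /= andbT.
by rewrite allrel1r all_rev.
Qed.

(** The two readings list two cells in opposite orders only when one lies
    strictly south-east of the other. *)
Lemma heq_row_col N t :
    (forall i j i' j', 0 < t i j -> 0 < t i' j' -> i < i' -> j < j' -> far (t i j) (t i' j')) ->
  heq (rword N t) (cword N t).
Proof.
move=> H; rewrite /rword /cword /rowsw /colsw /rowt /colt.
rewrite (flatten_vals t) (flatten_vals (fun j i => t i j)).
set sR := [seq (i, j) | i <- rev (iota 1 N), j <- iota 1 N].
set sC := [seq (j, i) | j <- iota 1 N, i <- rev (iota 1 N)].
pose swap (p : nat * nat) := (p.2, p.1).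
have -> : vals (fun p : nat * nat => t p.2 p.1) sC = vals (fun p => t p.1 p.2) (map swap sC).
  by rewrite /vals -map_comp.
have uR : uniq sR by apply: allpairs_uniq; rewrite ?rev_uniq ?iota_uniq // => -[? ?] [].
have uC : uniq sC by apply: allpairs_uniq; rewrite ?rev_uniq ?iota_uniq // => -[? ?] [].
have swapI : injective swap by move=> [? ?] [? ?] [-> ->].
pose rR (p q : nat * nat) := (q.1 < p.1) || (p.1 == q.1) && (p.2 < q.2).
pose rC (p q : nat * nat) := (p.2 < q.2) || (p.2 == q.2) && (q.1 < p.1).
have pR : pairwise rR sR.
  apply: (@pairwise_allpairs _ _ (fun x y => y < x) (fun x y => x < y)); rewrite ?pairwise_rev;
  exact: pairwise_iota.
have pC : pairwise rC (map swap sC).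
  rewrite pairwise_map; apply: (@pairwise_allpairs _ _ (fun x y => x < y) (fun x y => y < x));
  rewrite ?pairwise_rev; exact: pairwise_iota.
rewrite !vals_filter; apply: (@heq_reorder _ _ rR rC); rewrite ?filter_uniq //.
- apply: uniq_perm; rewrite ?filter_uniq ?map_inj_uniq // => -[i j]; rewrite !mem_filter.
  congr (_ && _); apply/allpairsP/mapP => [[[a b] /= [ha hb [-> ->]]]|[p /allpairsP[[a b] /= [ha hb ->]] [-> ->]]].
    by exists (b, a) => //; apply/allpairsP; exists (b, a).
  by exists (b, a).
- exact: pairwise_filter.
- exact: pairwise_filter.
- by move=> p; rewrite mem_filter => /andP[].
- move=> [i j] [k l]; rewrite !mem_filter /rR /rC /= => /andP[p0 _] /andP[q0 _] r1 r2.
  have [c1 c2] : k < i /\ l < j by case/orP: r1; case/orP: r2; lia.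
  by rewrite far_sym; apply: H.
Qed.

Lemma sh_far t i j i' j' : shtab t -> 0 < t i j -> 0 < t i' j' ->
  i < i' -> j < j' -> far (t i j) (t i' j').
Proof.
move=> st t0 t0' ii jj; rewrite /far.
have d := sh_dom st t0; have [] := @sh_dist t i j i' j' st t0'; lia.
Qed.

Lemma heq_sh_row_col N t : shtab t -> heq (rword N t) (cword N t).
Proof. by move=> st; apply: heq_row_col => *; apply: sh_far. Qed.

Lemma rowR_rec N t i x : x < N -> 0 < t i x.+1 ->
  rowR N t i x = t i x.+1 :: rowR N t i x.+1.
Proof.
move=> xN tx; rewrite /rowR; have -> : N - x = (N - x.+1).+1 by lia.
by rewrite /= vals_cons.
Qed.

Lemma colU_rec t j x : 0 < x -> 0 < t x j -> colU t j x.+1 = t x j :: colU t j x.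
Proof.
case: x => // x _ tx; rewrite /colU (_ : iota 1 _ = iota 1 x ++ [:: x.+1]).
  by rewrite rev_cat vals_cons.
by rewrite -[x.+2.-1]addn1 iotaD add1n.
Qed.

Section Update.
Variables (N : nat) (t : filling) (i x a : nat).

Lemma upd_eq : upd t i x a i x = a.
Proof. by rewrite /upd !eqxx. Qed.
Lemma upd_ne1 k l : k != i -> upd t i x a k l = t k l.
Proof. by rewrite /upd => /negbTE->. Qed.
Lemma upd_ne2 k l : l != x -> upd t i x a k l = t k l.
Proof. by rewrite /upd => /negbTE->; rewrite andbF. Qed.

Lemma rhi_upd h : i <= h -> rhi N (upd t i x a) h = rhi N t h.
Proof.
move=> ih; apply: eq_rowsw => k l; rewrite mem_rev mem_iota => ? ?.
by apply: upd_ne1; lia.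
Qed.
Lemma rlo_upd h : h <= i -> rlo N (upd t i x a) h = rlo N t h.
Proof.
move=> ih; apply: eq_rowsw => k l; rewrite mem_rev mem_iota => ? ?.
by apply: upd_ne1; lia.
Qed.
Lemma chi_upd h : x <= h -> chi N (upd t i x a) h = chi N t h.
Proof. by move=> ih; apply: eq_colsw => k l; rewrite mem_iota => ? ?; apply: upd_ne2; lia. Qed.
Lemma clo_upd h : h <= x -> clo N (upd t i x a) h = clo N t h.
Proof. by move=> ih; apply: eq_colsw => k l; rewrite mem_iota => ? ?; apply: upd_ne2; lia. Qed.

Lemma rowL_upd : rowL (upd t i x a) i x = rowL t i x.
Proof. by apply: eq_vals => l; rewrite mem_iota => ?; apply: upd_ne2; lia. Qed.
Lemma rowR_upd : rowR N (upd t i x a) i x = rowR N t i x.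
Proof. by apply: eq_vals => l; rewrite mem_iota => ?; apply: upd_ne2; lia. Qed.
Lemma colU_upd : colU (upd t i x a) x i = colU t x i.
Proof. by apply: eq_vals => l; rewrite mem_rev mem_iota => ?; apply: upd_ne1; lia. Qed.
Lemma colD_upd : colD N (upd t i x a) x i = colD N t x i.
Proof. by apply: eq_vals => l; rewrite mem_rev mem_iota => ?; apply: upd_ne1; lia. Qed.

Lemma rowt_upd : 0 < x <= N -> 0 < a ->
  rowt N (upd t i x a) i = rowL t i x ++ a :: rowR N t i x.
Proof. by move=> xN a0; rewrite (rowt_split xN) upd_eq // rowL_upd rowR_upd. Qed.
Lemma colt_upd : 0 < i <= N -> 0 < a ->
  colt N (upd t i x a) x = colD N t x i ++ a :: colU t x i.
Proof. by move=> xN a0; rewrite (colt_split xN) upd_eq // colU_upd colD_upd. Qed.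

Lemma rowt_upd0 : 0 < x <= N -> rowt N (upd t i x 0) i = rowL t i x ++ rowR N t i x.
Proof.
move=> xN; rewrite /rowt (iota_split xN) vals_cat; congr (_ ++ _).
  by apply: eq_vals => l; rewrite mem_iota /upd => ?; rewrite ifF //; lia.
rewrite /vals /= /upd !eqxx /=; apply: eq_vals => l; rewrite mem_iota => ?.
by rewrite ifF //; lia.
Qed.
Lemma colt_upd0 : 0 < i <= N -> colt N (upd t i x 0) x = colD N t x i ++ colU t x i.
Proof.
move=> iN; rewrite /colt (iota_split iN) rev_cat rev_cons -cats1 -catA vals_cat; congr (_ ++ _).
  by apply: eq_vals => l; rewrite mem_rev mem_iota /upd => ?; rewrite ifF //; lia.
rewrite /vals /= /upd !eqxx /=; apply: eq_vals => l; rewrite mem_rev mem_iota => ?.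
by rewrite ifF //; lia.
Qed.

End Update.

(** * Transitions and reading words *)

Section RowRules.
Variables (N : nat) (t : filling).
Hypothesis st : shtab t.

Let shE i j i' j' : 0 < t i' j' -> 0 < i <= i' -> i <= j <= j' ->
  0 < t i j /\ t i j + (i' - i) + (j' - j) <= t i' j'.
Proof. exact: sh_dist. Qed.

Lemma word_R1 i j a : 0 < i <= N -> 0 < j <= N -> 0 < a ->
  (forall l, j <= l -> t i l = 0) ->
  Wrow N t i a = rword N (upd t i j a).
Proof.
move=> iN jN a0 tl; rewrite (rword_split _ iN) /Wrow rhi_upd // rlo_upd // rowt_upd //.
rewrite [rowR _ _ _ _]vals_nil; last by move=> l; rewrite mem_iota => ?; apply: tl; lia.
rewrite /rowt (iota_split jN) vals_cat [vals _ (j :: _)]vals_nil ?cats0 -?catA // => l.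
by rewrite inE mem_iota => /orP[/eqP->|?]; apply: tl; lia.
Qed.

(** An outer box equal to an entry of the row above is absorbed by it: the entries
    read in between are smaller by at least two. *)
Lemma absorb_above i x a : 1 < i -> 0 < x <= N -> a = t i.-1 x -> 0 < a ->
  (forall l, l < x -> 0 < t i.-1 l -> (t i.-1 l).+2 <= a) ->
  heq (a :: rlo N t i) (rlo N t i).
Proof.
move=> i1 xN aE a0 H; have -> : i = i.-1.+1 by lia.
rewrite rlo_rec; last by lia.
rewrite (@rowt_split _ t i.-1 x) -?aE // -catA /=; apply: heq_absorb; rewrite ?posw_vals //.
apply: all_rowL => l ? tl; rewrite /far; have := H l; lia.
Qed.

(** The transpose of the previous fact; here the copy is read first. *)
Lemma absorb_left j x a v : 1 < j -> 0 < x <= N -> a = t x j.-1 -> 0 < a ->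
  (forall l, l < x -> 0 < t l j.-1 -> (t l j.-1).+2 <= a) ->
  heq (clo N t j ++ a :: v) (clo N t j ++ v).
Proof.
move=> j1 xN aE a0 H; have -> : j = j.-1.+1 by lia.
rewrite clo_rec; last by lia.
rewrite (@colt_split _ t j.-1 x) -?aE // -!catA /=; do 2!apply: heq_catl.
apply: heq_absorb_r; rewrite ?posw_vals //.
apply: all_colU => l ? tl; rewrite /far; have := H l; lia.
Qed.

(** The value is that of the left or of the upper neighbour of the missing box.
    In the first case the row ends with a repeated letter, in the second one the
    outer box is absorbed by the row above. *)
Lemma word_R2 i j a : 0 < i < N -> i < j <= N ->
  t i j = 0 -> 0 < t i j.-1 -> (1 < i -> 0 < t i.-1 j) -> a = maxn (t i j.-1) (t i.-1 j) ->
  heq (Wrow N t i a) (rword N t).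
Proof.
move=> iN jN tj tj' ti aE; have iN' : 0 < i <= N by lia.
have tl l : j <= l -> t i l = 0.
  move=> jl; case: (posnP (t i l)) => // tl; have [] := @shE i j i l; lia.
have jN' : 0 < j.-1 <= N by lia.
rewrite (rword_split _ iN') /Wrow; apply: heq_catl.
have [E|ne] := eqVneq a (t i j.-1).
  rewrite (rowt_split jN' tj') (_ : rowR _ _ _ _ = [::]); last first.
    by apply: vals_nil => l; rewrite mem_iota => ?; apply: tl; lia.
  by rewrite E -!catA; apply: heq_catl; apply: heq_dup.
have i1 : 1 < i.
  by have := @sh_dom t st i.-1 j; lia.
apply: heq_catl; apply: (@absorb_above i j) => //; [lia|lia|lia|move=> l lj tl0].
have := sh_dom st tl0 => ?.
by have [] := @shE i.-1 l i j.-1; lia.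
Qed.

(** If [a] is the left neighbour of [b], the letters [a b a] at the bumping place
    are braided into [b a b]; the first [b] moves into the next row.  If [a] is
    the upper neighbour, it is absorbed by the row above, and the [b] that leaves
    row [i] is absorbed by the one that stays. *)
Lemma word_R3 i x a b : 0 < i < N -> i < x <= N -> b = t i x -> 0 < b ->
  a = maxn (t i x.-1) (t i.-1 x) ->
  heq (Wrow N t i a) (Wrow N t i.+1 b).
Proof.
move=> iN xN Eb b0 aE; have iN' : 0 < i <= N by lia.
have tx : 0 < t i x by rewrite -Eb.
have xN' : 0 < x <= N by lia.
have [tx' dx] := @shE i x.-1 i x tx ltac:(lia) ltac:(lia).
have ab : a < b.
  case: (posnP (t i.-1 x)) => [|p]; first by lia.
  by have := sh_dom st p => ?; have [] := @shE i.-1 x i x tx; lia.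
rewrite /Wrow (@rhi_rec _ _ i); last by lia.
rewrite -!catA /=; do 2!apply: heq_catl; rewrite rlo_rec; last by lia.
have hR : all (far a) (rowR N t i x).
  apply: all_rowR => l ? tl0; rewrite /far.
  by have [] := @shE i x i l tl0; lia.
have [E|ne] := eqVneq a (t i x.-1); last first.
  have i1 : 1 < i.
    by have := @sh_dom t st i.-1 x; lia.
  apply: (heq_trans (v := rowt N t i ++ rlo N t i)).
    apply: heq_catl; apply: (@absorb_above i x) => //; [lia|lia|move=> l lx tl0].
    by have := sh_dom st tl0 => ?; have [] := @shE i.-1 l i x.-1 tx'; lia.
  apply: heq_sym; rewrite (rowt_split xN' tx) -Eb -catA; apply: heq_absorb => //.
    exact: posw_vals.
  apply: all_rowL => l ? tl0; rewrite /far; have := sh_dom st tl0 => ?.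
  by have [] := @shE i l i x.-1 tx'; lia.
have Ex : x = x.-1.+1 by lia.
have a0 : 0 < a by lia.
have -> : rowt N t i = rowL t i x.-1 ++ [:: a, b & rowR N t i x].
  rewrite (@rowt_split _ _ _ x.-1) //; last by lia.
  by rewrite (@rowR_rec _ _ _ x.-1) -?Ex -?E -?Eb //; lia.
rewrite -!catA /=; apply: (heq_trans (v := rowL t i x.-1 ++ [:: b, a, b & rowR N t i x ++ rlo N t i])).
  apply: heq_catl; apply: heq_trans (heq_aba _ a0 ab).
  by do 2!apply: heq_cons; apply: heq_sym; apply: heq_comm_cat; rewrite ?posw_vals.
apply: heq_sym; apply: heq_comm_cat => //; first exact: posw_vals.
apply: all_rowL => l ? tl0; rewrite /far; have := sh_dom st tl0 => ?.
by have [] := @shE i l i x.-1 tx'; lia.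
Qed.

(** [a] moves left past the entries larger than [b], then [b] moves left past
    those smaller than [a]. *)
Lemma word_R4 i x a b : 0 < i < N -> i < x <= N -> b = t i x -> 0 < a < b ->
  t i x.-1 < a ->
  heq (Wrow N t i a) (Wrow N (upd t i x a) i.+1 b).
Proof.
move=> iN xN Eb /andP[a0 ab] la; have iN' : 0 < i <= N by lia.
have b0 : 0 < b by lia.
have tx : 0 < t i x by rewrite -Eb.
have xN' : 0 < x <= N by lia.
have [tx' dx] := @shE i x.-1 i x tx ltac:(lia) ltac:(lia).
rewrite /Wrow (@rhi_rec _ _ i); last by lia.
rewrite rhi_upd // (_ : rowt N (upd t i x a) i.+1 = rowt N t i.+1); last first.
  by apply: eq_vals => l _; apply: upd_ne1; lia.
rewrite -!catA /=; do 2!apply: heq_catl; rewrite rlo_rec ?rlo_upd ?rowt_upd //; try lia.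
rewrite (rowt_split xN' tx) -Eb -!catA /=.
apply: (heq_trans (v := rowL t i x ++ [:: b, a & rowR N t i x ++ rlo N t i])).
  apply: heq_catl; apply: heq_cons; apply: heq_sym; apply: heq_comm_cat; rewrite ?posw_vals //.
  apply: all_rowR => l ? tl0; rewrite /far.
  by have [] := @shE i x i l tl0; lia.
apply: heq_sym; apply: heq_comm_cat => //; first exact: posw_vals.
apply: all_rowL => l ? tl0; rewrite /far; have := sh_dom st tl0 => ?.
by have [] := @shE i l i x.-1 tx'; lia.
Qed.

End RowRules.

Lemma heq_comm_r b u v : 0 < b -> posw u -> all (far b) u -> heq (u ++ b :: v) (b :: u ++ v).
Proof. by move=> *; apply: heq_sym; apply: heq_comm_cat. Qed.

Section TurnAndColumnRules.
Variables (N : nat) (t : filling).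
Hypothesis st : shtab t.

Let shE i j i' j' : 0 < t i' j' -> 0 < i <= i' -> i <= j <= j' ->
  0 < t i j /\ t i j + (i' - i) + (j' - j) <= t i' j'.
Proof. exact: sh_dist. Qed.

(** A turn from rows to columns passes through the reading word of the tableau
    without its outer box: [a] is absorbed on the row side, [b] on the column
    side. *)
Lemma word_D1 i a b : 0 < i -> i.+1 < N -> b = t i i.+1 -> 0 < b -> t i.+1 i.+1 = 0 ->
  a = maxn (t i i) (t i.-1 i.+1) -> (t i i).+2 <= b ->
  heq (Wrow N t i a) (Wcol N t i.+1 b).
Proof.
move=> i0 iN Eb b0 tn aE db; have iN' : 0 < i <= N by lia.
have tb : 0 < t i i.+1 by rewrite -Eb.
have [td _] := @shE i i i i.+1 tb ltac:(lia) ltac:(lia).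
have iN2 : 0 < i.+1 <= N by lia.
apply: (heq_trans (v := rword N t)).
  rewrite (rword_split _ iN') /Wrow; apply: heq_catl.
  have [E|ne] := eqVneq a (t i i); last first.
    have i1 : 1 < i.
      by have := @sh_dom t st i.-1 i.+1; lia.
    apply: heq_catl; apply: (@absorb_above _ _ i i.+1) => //; [lia|lia|move=> l li tl0].
    by have := sh_dom st tl0 => ?; have [] := @shE i.-1 l i i td; lia.
  rewrite (rowt_split iN' td) -E -!catA; apply: heq_catl.
  apply: heq_absorb_r; rewrite ?posw_vals //; first by lia.
  apply: all_rowR => l ? tl0; rewrite /far.
  by have [] := @shE i i.+1 i l tl0; lia.
apply: heq_trans (heq_sh_row_col _ st) _.
rewrite (cword_split _ iN2) /Wcol; apply: heq_catl; apply: heq_sym.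
rewrite (colt_split iN' tb) -Eb -catA; apply: heq_absorb => //; first exact: posw_vals.
apply: all_colD => l ? tl0; have := sh_dom st tl0 => ?.
by have [] := @shE i.+1 i.+1 l i.+1 tl0; lia.
Qed.

(** As for D1, but both letters are absorbed by row [i-1] and column [i]
    respectively; this needs the gap between [a] and the diagonal entry above. *)
Lemma word_D2 i a b : 1 < i < N -> a = t i.-1 i -> b = t i i -> 0 < a ->
  (t i.-1 i.-1).+2 <= a -> a.+2 <= b ->
  heq (Wrow N t i a) (Wcol N t i.+1 b).
Proof.
move=> iN Ea Eb a0 ea ab; have iN' : 0 < i <= N by lia.
have tb : 0 < t i i by lia.
have iN2 : 0 < i.+1 <= N by lia.
apply: (heq_trans (v := rword N t)).
  rewrite (rword_split _ iN') /Wrow; do 2!apply: heq_catl.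
  apply: (@absorb_above _ _ i i) => //; [lia|move=> l li tl0].
  have := sh_dom st tl0 => ?; have -> : l = i.-1 by lia.
  by [].
apply: heq_trans (heq_sh_row_col _ st) _.
rewrite (cword_split _ iN2) /Wcol; apply: heq_sym.
apply: (@absorb_left _ _ _ i) => //; [lia|lia|move=> l li tl0].
have ta : 0 < t i.-1 i by rewrite -Ea.
have := sh_dom st tl0 => /= ?.
by have [] := @shE l i i.-1 i ta; lia.
Qed.

(** Both words are [b] followed by the word of the new tableau: [b] commutes with
    the rows below row [i], and with the columns up to the new column [i]. *)
Lemma word_D3 i a b : 0 < i < N -> b = t i i -> 0 < a -> a.+2 <= b ->
  shtab (upd t i i a) ->
  heq (Wrow N t i a) (Wcol N (upd t i i a) i.+1 b).
Proof.
move=> iN Eb a0 ab st'; have iN' : 0 < i <= N by lia.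
have tb : 0 < t i i by lia.
have iN2 : 0 < i.+1 <= N by lia.
have b0 : 0 < b by lia.
apply: (heq_trans (v := b :: rword N (upd t i i a))); last first.
  apply: heq_trans (heq_cons _ (heq_sh_row_col _ st')) _.
  rewrite (cword_split _ iN2) /Wcol; apply: heq_comm_cat => //; first exact: posw_colsw.
  apply: all_clo => k l lj kN tl0; have := sh_dom st' tl0 => ?.
  have := @sh_dist _ k l i i st'; rewrite upd_eq => /(_ a0) [] //; rewrite /far; lia.
rewrite (rword_split _ iN') rhi_upd // rlo_upd // rowt_upd // /Wrow.
rewrite (rowt_split iN' tb) -Eb -!catA /=.
apply: (heq_trans (v := rhi N t i ++ rowL t i i ++ [:: b, a & rowR N t i i ++ rlo N t i])).
  do 2!apply: heq_catl; apply: heq_cons; apply: heq_comm_r; rewrite ?posw_vals //.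
  apply: all_rowR => l ? tl0; rewrite /far.
  by have [] := @shE i i i l tl0; lia.
rewrite !catA; apply: heq_comm_r => //.
  by rewrite all_cat posw_rowsw posw_vals.
rewrite all_cat; apply/andP; split.
  apply: all_rhi => k l ? ? tl0; have := sh_dom st tl0 => ?.
  by rewrite /far; have [] := @shE i i k l tl0; lia.
by apply: all_rowL => l ? tl0; have := sh_dom st tl0; lia.
Qed.

(** The diagonal entry [b] and the outer box commute with everything else read
    before them, so the two words start with [b, b-1] and [b, b+1] and agree
    afterwards.  The rest is the filling with the box [(i, i)] erased; it is not
    shifted, but its row and column readings are still equivalent. *)
Lemma word_D4 i b : 0 < i < N -> b = t i i -> 0 < b -> ~~ odd b ->
  act (Wrow N t i b.-1) (Some FTheta) = act (Wcol N t i.+1 b.+1) (Some FTheta).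
Proof.
move=> iN Eb b0 evb; have iN' : 0 < i <= N by lia.
have tb : 0 < t i i by lia.
have b2 : 0 < b.-1 by lia.
have st0 : heq (rword N (upd t i i 0)) (cword N (upd t i i 0)).
  apply: heq_row_col => k l k' l'; rewrite /upd; case: ifP => //; case: ifP => // _ _.
  exact: sh_far.
have H1 : heq (Wrow N t i b.-1) ([:: b; b.-1] ++ rword N (upd t i i 0)).
  rewrite (rword_split _ iN') rhi_upd // rlo_upd // rowt_upd0 // /Wrow.
  rewrite (rowt_split iN' tb) -Eb -!catA /=.
  have hA c : b.-1 <= c <= b -> all (far c) (rhi N t i ++ rowL t i i).
    move=> cb; rewrite all_cat; apply/andP; split.
      apply: all_rhi => k l ? ? tl0; have := sh_dom st tl0 => ?.
      by rewrite /far; have [] := @shE i i k l tl0; lia.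
    by apply: all_rowL => l ? tl0; have := sh_dom st tl0; lia.
  have pA : posw (rhi N t i ++ rowL t i i) by rewrite all_cat posw_rowsw posw_vals.
  rewrite catA; apply: heq_trans (heq_comm_r _ b0 pA (hA b _)) _; first by lia.
  apply: heq_cons; rewrite [X in heq _ (_ :: X)]catA.
  apply: heq_trans (heq_comm_r _ b2 pA (hA b.-1 _)); last by lia.
  apply: heq_catl; apply: heq_comm_r; rewrite ?posw_vals //.
  apply: all_rowR => l ? tl0; rewrite /far.
  by have [] := @shE i i i l tl0; lia.
have H2 : heq (Wcol N t i.+1 b.+1) ([:: b; b.+1] ++ cword N (upd t i i 0)).
  rewrite (cword_split _ iN') chi_upd // clo_upd // colt_upd0 // /Wcol.
  rewrite clo_rec ?(@chi_rec _ _ i); try lia.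
  rewrite (colt_split iN' tb) -Eb -!catA /=.
  have hA c : b <= c -> all (far c) (clo N t i ++ colD N t i i).
    move=> cb; rewrite all_cat; apply/andP; split.
      apply: all_clo => k l ? ? tl0; have := sh_dom st tl0 => ?.
      by rewrite /far; have [] := @shE k l i i tb; lia.
    by apply: all_colD => l ? tl0; have := sh_dom st tl0; lia.
  have pA : posw (clo N t i ++ colD N t i i) by rewrite all_cat posw_colsw posw_vals.
  rewrite catA; apply: heq_trans (heq_comm_r _ b0 pA (hA b _)) _ => //.
  apply: heq_cons; rewrite [X in heq _ (_ :: X)]catA.
  apply: heq_trans (heq_comm_r _ _ pA (hA b.+1 _)) => //.
  apply: heq_catl; apply: heq_comm_r; rewrite ?posw_vals //.
  apply: all_colU => l ? tl0; rewrite /far.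
  by have [] := @shE l i i i tb; lia.
by rewrite H1 H2 !act_cat act_switch // st0.
Qed.

(** The column rules are transposes of the row rules R1 to R4. *)
Lemma word_C1 i j a : 0 < i <= N -> 0 < j <= N -> 0 < a ->
  (forall l, i <= l -> t l j = 0) ->
  Wcol N t j a = cword N (upd t i j a).
Proof.
move=> iN jN a0 tl; rewrite (cword_split _ jN) /Wcol chi_upd // clo_upd // colt_upd //.
rewrite [colD _ _ _ _]vals_nil; last by move=> l; rewrite mem_rev mem_iota => ?; apply: tl; lia.
rewrite /= /colt (iota_split iN) rev_cat vals_cat [vals _ (rev (i :: _))]vals_nil // => l.
by rewrite mem_rev inE mem_iota => /orP[/eqP->|?]; apply: tl; lia.
Qed.

Lemma word_C2 i j a : 1 < i <= j -> j <= N -> t i j = 0 -> 0 < t i.-1 j ->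
  (i < j -> 0 < t i j.-1) -> a = maxn (t i.-1 j) (t i j.-1) ->
  heq (Wcol N t j a) (cword N t).
Proof.
move=> ij jN t0 tu tl aE; have jN' : 0 < j <= N by lia.
rewrite (cword_split _ jN') /Wcol.
have [E|ne] := eqVneq a (t i.-1 j).
  have iN : 0 < i.-1 <= N by lia.
  apply: heq_catl; rewrite (colt_split iN tu) -E -!catA; apply: heq_absorb; rewrite ?posw_vals //; first by lia.
  apply: all_colD => l ? tl0; have := sh_dom st tl0 => ?.
  by have [] := @shE i j l j tl0; lia.
have lj : i < j.
  by have := @sh_dom _ st i j.-1; lia.
apply: (@absorb_left _ _ _ i); [lia|lia|lia|lia|move=> l li tl0].
have := sh_dom st tl0 => ?.
by have [] := @shE l j.-1 i.-1 j tu; lia.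
Qed.

Lemma word_C3 x j a b : 1 < x <= j -> j < N -> b = t x j -> 0 < b ->
  a = maxn (t x.-1 j) (t x j.-1) ->
  heq (Wcol N t j a) (Wcol N t j.+1 b).
Proof.
move=> xj jN Eb b0 aE.
have tb : 0 < t x j by lia.
have [tu du] := @shE x.-1 j x j tb ltac:(lia) ltac:(lia).
have xN : 0 < x <= N by lia.
rewrite /Wcol clo_rec; last by lia.
rewrite (@chi_rec _ _ j jN) -!catA /=.
have [E|ne] := eqVneq a (t x.-1 j).
  have ab : a < b by lia.
  have a0 : 0 < a by lia.
  have -> : colt N t j = colD N t j x ++ [:: b, a & colU t j x.-1].
    rewrite (colt_split xN tb) -Eb; congr (_ ++ _ :: _).
    by rewrite {1}(_ : x = x.-1.+1) ?colU_rec -?E //; lia.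
  rewrite -!catA /=; apply: heq_catl.
  apply: (heq_trans (v := colD N t j x ++ [:: b, a, b & colU t j x.-1 ++ colt N t j.+1 ++ chi N t j.+1])).
    apply: (heq_trans (v := colD N t j x ++ [:: a, b, a & colU t j x.-1 ++ colt N t j.+1 ++ chi N t j.+1])).
      apply: heq_comm_cat => //; first exact: posw_vals.
      apply: all_colD => l ? tl0; rewrite /far.
      have := sh_dom st tl0 => ?.
      by have [] := @shE x j l j tl0; lia.
    by apply: heq_catl; apply: heq_aba.
  apply: heq_catl; do 2!apply: heq_cons; apply: heq_comm_cat => //; first exact: posw_vals.
  apply: all_colU => l ? tl0; rewrite /far.
  by have [] := @shE l j x.-1 j tu; lia.
have lj : x < j.
  by have := @sh_dom _ st x j.-1; lia.
apply: (heq_trans (v := clo N t j ++ colt N t j ++ colt N t j.+1 ++ chi N t j.+1)).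
  apply: (@absorb_left _ _ _ x); [lia|lia|lia|lia|move=> l li tl0].
  have := sh_dom st tl0 => ?.
  by have [] := @shE l j.-1 x.-1 j tu; lia.
apply: heq_catl; apply: heq_sym; rewrite (colt_split xN tb) -Eb -!catA /=; apply: heq_catl.
apply: heq_absorb_r => //; first exact: posw_vals.
apply: all_colU => l ? tl0; rewrite /far.
have [] := @shE l j x.-1 j tu; try lia.
have [] := @shE x j.-1 x j tb; lia.
Qed.

Lemma word_C4 x j a b : 0 < x <= j -> j < N -> b = t x j -> 0 < a < b ->
  t x.-1 j < a ->
  heq (Wcol N t j a) (Wcol N (upd t x j a) j.+1 b).
Proof.
move=> xj jN Eb /andP[a0 ab] ua.
have tb : 0 < t x j by lia.
have b0 : 0 < b by lia.
have xN : 0 < x <= N by lia.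
rewrite /Wcol clo_rec; last by lia.
rewrite (@chi_rec _ _ j jN) clo_upd // chi_upd // colt_upd //.
rewrite (_ : colt N (upd t x j a) j.+1 = colt N t j.+1); last first.
  by apply: eq_vals => l _; apply: upd_ne2; lia.
rewrite (colt_split xN tb) -Eb -!catA /=; apply: heq_catl.
apply: (heq_trans (v := colD N t j x ++ [:: a, b & colU t j x ++ colt N t j.+1 ++ chi N t j.+1])).
  apply: heq_comm_cat => //; first exact: posw_vals.
  apply: all_colD => l ? tl0; rewrite /far.
  have := sh_dom st tl0 => ?.
  by have [] := @shE x j l j tl0; lia.
apply: heq_catl; apply: heq_cons; apply: heq_comm_cat => //; first exact: posw_vals.
apply: all_colU => l ? tl0; rewrite /far.
have [tu _] := @shE x.-1 j x j tb ltac:(lia) ltac:(lia).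
by have [] := @shE l j x.-1 j tu; lia.
Qed.

End TurnAndColumnRules.

(** * Tableaux and fillings *)

Definition positive (T : tableau) : Prop := forall p v, T.[? p] = Some v -> 0 < v.

Section Entries.
Variable T : tableau.
Hypothesis Tpos : positive T.

Lemma entry_gt0 (i j : nat) : (0 < entry T i j) = ((i, j) \in domf T).
Proof.
rewrite /entry; case: fndP => [p|np] /=; last by apply/esym/negbTE.
by rewrite (Tpos (in_fnd p)); apply/esym.
Qed.

Lemma entry_eq0 (i j : nat) : (entry T i j == 0) = ((i, j) \notin domf T).
Proof. by rewrite -entry_gt0; lia. Qed.

Lemma fnd_entry (i j v : nat) : 0 < v -> (T.[? (i, j)] = Some v) <-> (entry T i j = v).
Proof.
move=> v0; rewrite /entry; case: fndP => [p|_] /=; first by split=> [[]|->].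
by split=> // E; rewrite -E in v0.
Qed.

Lemma entry_leE (i j a : nat) : entry_le T i j a = (0 < entry T i j <= a).
Proof.
rewrite /entry_le /entry; case: fndP => [p|_] //=.
by rewrite (Tpos (in_fnd p)).
Qed.

Lemma lt_entryE (i j a : nat) : lt_entry a T i j = (entry T i j == 0) || (a < entry T i j).
Proof.
rewrite /lt_entry /entry; case: fndP => [p|_] //=.
by have := Tpos (in_fnd p); lia.
Qed.

End Entries.

Lemma entry_set (T : tableau) (i j a k l : nat) : entry T.[(i, j) <- a] k l = upd (entry T) i j a k l.
Proof. by rewrite /entry fnd_set /upd xpair_eqE; case: ifP. Qed.

Lemma entry_rem (T : tableau) (i j k l : nat) : entry T.[~ (i, j)] k l = upd (entry T) i j 0 k l.
Proof. by rewrite /entry fnd_rem1 xpair_eqE /upd; case: (_ && _). Qed.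

Lemma entry_fmap0 i j : entry [fmap] i j = 0.
Proof. by rewrite /entry fnd_fmap0. Qed.

Lemma positive_set T p a : positive T -> 0 < a -> positive T.[p <- a].
Proof. by move=> Tp a0 q v; rewrite fnd_set; case: ifP => [_ [<-]|_ /Tp]. Qed.

Lemma positive_rem T p : positive T -> positive T.[~ p].
Proof. by move=> Tp q v; rewrite fnd_rem1; case: ifP => // _ /Tp. Qed.

Lemma rows_ge (D : {fset box}) p : p \in D -> p.1 <= rows D.
Proof. by move=> pD; apply: (@leq_bigmax_seq _ (enum_fset D) xpredT (fun q : box => q.1)). Qed.

Lemma cols_ge (D : {fset box}) p : p \in D -> p.2 <= cols D.
Proof. by move=> pD; apply: (@leq_bigmax_seq _ (enum_fset D) xpredT (fun q : box => q.2)). Qed.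

Lemma rows_le (D : {fset box}) n : (forall p, p \in D -> p.1 <= n) -> rows D <= n.
Proof. by move=> H; rewrite /rows; apply/bigmax_leqP_seq => p pD _; apply: H. Qed.
Lemma cols_le (D : {fset box}) n : (forall p, p \in D -> p.2 <= n) -> cols D <= n.
Proof. by move=> H; rewrite /cols; apply/bigmax_leqP_seq => p pD _; apply: H. Qed.

Lemma rows_mem (D : {fset box}) : 0 < rows D -> exists j, (rows D, j) \in D.
Proof.
move=> r0; apply/not_existsP => H.
suff : rows D <= (rows D).-1 by lia.
apply: rows_le => -[i j] pD /=; have /= := rows_ge pD.
by have [E|] := eqVneq i (rows D); [rewrite E in pD; case: (H j)|lia].
Qed.

Lemma increasing_shifted_sh T : is_increasing_shifted T -> positive T /\ shtab (entry T).
Proof.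
case=> -[Tb Tp] Ti [la /andP[las la0] laE]; have Tp' : positive T by move=> p v; apply: Tp.
split=> //; split.
- by move=> i j; rewrite entry_gt0 // laE => /and4P[]; lia.
- move=> i j ij t0; have E : entry T i j.+1 = entry T i j.+1 by [].
  have := t0; rewrite entry_gt0 // laE => /and4P[h1 h2 h3 h4].
  have t1 : 0 < entry T i j by rewrite entry_gt0 // laE; apply/and4P; split; lia.
  rewrite t1 /=; apply: (Ti (i, j) (i, j.+1)); rewrite /= ?xpair_eqE; try lia;
  by apply/fnd_entry.
- move=> i j i0 t0.
  have := t0; rewrite entry_gt0 // laE => /and4P[h1 h2 h3 h4].
  rewrite /= in h4.
  have lt : nth 0 la i < nth 0 la i.-1.
    apply: (sorted_ltn_nth (leT := gtn)) => //; rewrite ?inE; try lia.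
    by move=> x y z /= h h'; apply: ltn_trans h' h.
  have t1 : 0 < entry T i j by rewrite entry_gt0 // laE; apply/and4P; split; lia.
  rewrite t1 /=; apply: (Ti (i, j) (i.+1, j)); rewrite /= ?xpair_eqE; try lia;
  by apply/fnd_entry.
Qed.

Lemma sh_increasing T : positive T -> shtab (entry T) -> increasing T.
Proof.
move=> Tp st [i j] [k l] u v Tu Tv ne /= ik jl.
have u0 := Tp _ _ Tu; have v0 := Tp _ _ Tv.
have Eu := (fnd_entry T i j u0).1 Tu; have Ev := (fnd_entry T k l v0).1 Tv.
have t0 : 0 < entry T i j by rewrite Eu.
have t1 : 0 < entry T k l by rewrite Ev.
rewrite xpair_eqE in ne; have d := sh_dom st t0.
by have [] := @sh_dist _ i j k l st t1; lia.
Qed.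

(** The parts of the strict partition are the row lengths, found by searching each
    row for its first missing box. *)
Lemma sh_shifted T : positive T -> shtab (entry T) -> shifted (domf T).
Proof.
move=> Tp st; set t := entry T in st *; set D := domf T.
have memD i j : ((i, j) \in D) = (0 < t i j) by rewrite entry_gt0.
have tD i j : 0 < t i j -> i <= rows D /\ j <= cols D.
  rewrite -memD => ijD; split; [exact: (rows_ge ijD)|exact: (cols_ge ijD)].
pose len i := find (fun k => t i (i + k) == 0) (iota 0 (cols D).+1).
have lenP i j : 0 < i -> i <= j -> (0 < t i j) = (j < i + len i).
  move=> i0 ij.
  have hasz : has (fun k => t i (i + k) == 0) (iota 0 (cols D).+1).
    apply/hasP; exists (cols D); first by rewrite mem_iota; lia.
    by apply/eqP; case: (posnP (t i (i + cols D))) => // /tD; lia.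
  have ls : len i < (cols D).+1 by move: hasz; rewrite has_find size_iota.
  have zl : t i (i + len i) == 0.
    by have := nth_find 0 hasz; rewrite nth_iota.
  apply/idP/idP => [t0|jl].
    rewrite ltnNge; apply/negP => lj.
    by have [] := @sh_dist t i (i + len i) i j st t0; lia.
  have jl' : j - i < len i by lia.
  have := before_find 0 jl'; rewrite nth_iota; last by lia.
  by rewrite add0n subnKC //; lia.
exists [seq len i | i <- iota 1 (rows D)].
  apply/andP; split; last first.
    apply/mapP => -[i]; rewrite mem_iota => /andP[i0 ir] E.
    have [|j] := @rows_mem D; first by lia.
    rewrite memD => t0; have := sh_dom st t0 => ?.
    have [p _] := @sh_dist t i i (rows D) j st t0 ltac:(lia) ltac:(lia).
    by move: p; rewrite lenP //; lia.
  apply/(sortedP 0) => i; rewrite size_map size_iota => ir.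
  rewrite !(nth_map 0) ?size_iota ?nth_iota; try lia.
  have [|j] := @rows_mem D; first by lia.
  rewrite memD => t0; have := sh_dom st t0 => ?.
  have [p _] := @sh_dist t i.+2 i.+2 (rows D) j st t0 ltac:(lia) ltac:(lia).
  have l0 : 0 < len i.+2 by move: p; rewrite lenP //; lia.
  have q : 0 < t i.+2 (i.+1 + len i.+2) by rewrite lenP; lia.
  by have := sh_col st (ltn0Sn i) q; rewrite lenP ?add1n; lia.
have nthE i : 0 < i <= rows D -> nth 0 [seq len i | i <- iota 1 (rows D)] i.-1 = len i.
  move=> ir; rewrite (nth_map 0) ?size_iota ?nth_iota; try lia.
  by congr len; lia.
move=> i j; rewrite size_map size_iota memD.
apply/idP/idP => [t0|/and4P[i0 ir ij]].
  have [? ?] := tD _ _ t0; have := sh_dom st t0 => ?.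
  have ? : j < i + len i by rewrite -lenP //; lia.
  by rewrite nthE; [apply/and4P; split; lia|lia].
by rewrite nthE; [rewrite -lenP //; lia|lia].
Qed.

Lemma sh_increasing_shifted T : positive T -> shtab (entry T) -> is_increasing_shifted T.
Proof.
move=> Tp st; split; [split=> //|exact: sh_increasing|exact: sh_shifted].
by move=> [i j]; rewrite -entry_gt0 //= => /(sh_dom st); lia.
Qed.

Lemma pmap_row T i s : positive T ->
  pmap (fun j => T.[? (i, j)]) s = vals (entry T i) s.
Proof.
move=> Tp; elim: s => // j s IH; rewrite /vals /= IH.
case E: T.[? (i, j)] => [v|] /=; rewrite /entry E //=.
by rewrite (Tp _ _ E).
Qed.

Lemma pmap_col T j s : positive T ->
  pmap (fun i => T.[? (i, j)]) s = vals ((entry T)^~ j) s.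
Proof.
move=> Tp; elim: s => // i s IH; rewrite /vals /= IH.
case E: T.[? (i, j)] => [v|] /=; rewrite /entry E //=.
by rewrite (Tp _ _ E).
Qed.

Lemma entry_rows (T : tableau) (i j : nat) : rows (domf T) < i -> entry T i j = 0.
Proof. by rewrite /entry; case: fndP => //= p; have /= := rows_ge p; lia. Qed.
Lemma entry_cols (T : tableau) (i j : nat) : cols (domf T) < j -> entry T i j = 0.
Proof. by rewrite /entry; case: fndP => //= p; have /= := cols_ge p; lia. Qed.

Lemma iota_le m n : n <= m -> iota 1 m = iota 1 n ++ iota n.+1 (m - n).
Proof. by move=> nm; rewrite -{1}(subnKC nm) iotaD add1n. Qed.

Lemma flatten_nil (I : eqType) (T : Type) (f : I -> seq T) s :
  {in s, forall i, f i = [::]} -> flatten (map f s) = [::].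
Proof.
elim: s => //= i s IH H; rewrite H ?mem_head // IH // => k ks.
by apply: H; rewrite inE ks orbT.
Qed.

Lemma row_wordE N T : positive T -> rows (domf T) <= N -> cols (domf T) <= N ->
  row_word T = rword N (entry T).
Proof.
move=> Tp rN cN; rewrite /rword /rowsw (iota_le rN) rev_cat map_cat flatten_cat.
rewrite [X in _ = X ++ _]flatten_nil ?cat0s.
  congr flatten; apply: eq_map => i; rewrite pmap_row // /rowt (iota_le cN) vals_cat.
  rewrite [X in _ = _ ++ X]vals_nil ?cats0 // => j; rewrite mem_iota => ?.
  by apply: entry_cols; lia.
move=> i; rewrite mem_rev mem_iota => ?; apply: vals_nil => j _.
by apply: entry_rows; lia.
Qed.

Lemma col_wordE N T : positive T -> rows (domf T) <= N -> cols (domf T) <= N ->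
  col_word T = cword N (entry T).
Proof.
move=> Tp rN cN; rewrite /cword /colsw (iota_le cN) map_cat flatten_cat.
rewrite [X in _ = _ ++ X]flatten_nil ?cats0.
  congr flatten; apply: eq_map => j; rewrite pmap_col // /colt (iota_le rN) rev_cat vals_cat.
  rewrite [X in _ = X ++ _]vals_nil ?cat0s // => i; rewrite mem_rev mem_iota => ?.
  by apply: entry_rows; lia.
move=> j; rewrite mem_iota => ?; apply: vals_nil => i _.
by apply: entry_cols; lia.
Qed.

Lemma rows_set (T : tableau) (i j a : nat) : rows (domf T.[(i, j) <- a]) <= maxn i (rows (domf T)).
Proof.
apply: rows_le => p; rewrite dom_setf in_fset1U => /orP[/eqP->|/rows_ge] /=; lia.
Qed.
Lemma cols_set (T : tableau) (i j a : nat) : cols (domf T.[(i, j) <- a]) <= maxn j (cols (domf T)).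
Proof.
apply: cols_le => p; rewrite dom_setf in_fset1U => /orP[/eqP->|/cols_ge] /=; lia.
Qed.

(** The reading word that the admissibility of a state is about. *)
Definition hword (U : state) : seq nat :=
  match U with
  | ColOuter _ _ _ => col_word (state_tab U)
  | _ => row_word (state_tab U)
  end.

(** The outer box of a state stands beyond the last column, hence it is read at
    the end of its row; any bound [N] on the dimensions may be used, so that the
    words of two states can be compared. *)
Lemma hword_Row N T (i a : nat) : positive T -> 0 < i <= N -> 0 < a ->
  rows (domf T) <= N -> (cols (domf T)).+2 <= N ->
  hword (RowOuter T i a) = Wrow N (entry T) i a.
Proof.
move=> Tp iN a0 rN cN; rewrite /hword /= (@row_wordE N).
- rewrite (@word_R1 N (entry T) i (cols (domf T)).+2) //; last first.
    by move=> l cl; apply: entry_cols; lia.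
  by apply: eq_rowsw => k l _ _; rewrite entry_set.
- exact: positive_set.
- by apply: leq_trans (rows_set _ _ _ _) _; lia.
- by apply: leq_trans (cols_set _ _ _ _) _; lia.
Qed.

Lemma hword_Col N T (j a : nat) : positive T -> 0 < j <= N -> 0 < a ->
  (rows (domf T)).+2 <= N -> cols (domf T) <= N ->
  hword (ColOuter T j a) = Wcol N (entry T) j a.
Proof.
move=> Tp jN a0 rN cN; rewrite /hword /= (@col_wordE N).
- rewrite (@word_C1 N (entry T) (rows (domf T)).+2 j) //; last first.
    by move=> l cl; apply: entry_rows; lia.
  by apply: eq_colsw => k l _ _; rewrite entry_set.
- exact: positive_set.
- by apply: leq_trans (rows_set _ _ _ _) _; lia.
- by apply: leq_trans (cols_set _ _ _ _) _; lia.
Qed.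

Lemma posw_row_word T : positive T -> posw (row_word T).
Proof.
by move=> Tp; rewrite (@row_wordE (maxn (rows (domf T)) (cols (domf T)))) ?posw_rowsw //; lia.
Qed.
Lemma posw_col_word T : positive T -> posw (col_word T).
Proof.
by move=> Tp; rewrite (@col_wordE (maxn (rows (domf T)) (cols (domf T)))) ?posw_colsw //; lia.
Qed.

Lemma poswE w : posw w = (0 \notin w).
Proof. by rewrite -has_pred1 -all_predC; apply: eq_all => x /=; lia. Qed.

Lemma Hecke_alive w : posw w -> is_sp_Hecke_word w <-> alive w.
Proof.
rewrite poswE /alive => w0; split=> [[z /sp_Hecke_wordE[_ ->]] //|].
by case E: act => [z|] // _; exists z; apply/sp_Hecke_wordE.
Qed.

Definition okT (T : tableau) : Prop := positive T /\ shtab (entry T).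

Lemma okTE T : is_increasing_shifted T <-> okT T.
Proof.
by split=> [/increasing_shifted_sh|[Tp st]]; last exact: sh_increasing_shifted.
Qed.

(** Admissibility without its condition on the reading word, in terms of the
    entries of the tableau. *)
Definition adm (U : state) : Prop :=
  match U with
  | Terminal T => okT T /\ T <> [fmap]
  | RowOuter T i a => let t := entry T in
      [/\ okT T, 0 < i <= (rows (domf T)).+1, 0 < a,
         i = 1 \/ exists x, [&& i <= x, 0 < t i.-1 x <= a & (t i x == 0) || (a < t i x)] &
         t i.-1 i = a -> 0 < t i i]
  | ColOuter T j a => let t := entry T in
      [/\ okT T /\ 0 < a, 0 < j <= (cols (domf T)).+1,
         t j.-1 j = a \/
         exists x, [&& 0 < x, x < j, 0 < t x j.-1 <= a & (t x j == 0) || (a < t x j)],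
         t j.-1 j = a -> t j j = 0 \/ odd a &
         forall x, t x j.-1 = a -> 1 < x]
  end.

Lemma adm_is_state U : adm U -> is_state U.
Proof.
by case: U => [T|T i a|T j a] /=; [case|case|case=> -[]]; rewrite -okTE.
Qed.

Lemma adm_posw U : adm U -> posw (hword U).
Proof.
case: U => [T|T i a|T j a] /=.
- by case=> -[Tp _] _; apply: posw_row_word.
- by case=> -[Tp _] _ a0 _ _; apply: posw_row_word; apply: positive_set.
- by case=> -[[Tp _] a0] _ _ _ _; apply: posw_col_word; apply: positive_set.
Qed.

Lemma admissibleE U : admissible U <-> adm U /\ alive (hword U).
Proof.
split.
  case; case: U => [T|T i a|T j a] /=.
  - by case=> /okTE ok n0 /(Hecke_alive (posw_row_word ok.1)).
  - case=> /okTE ok ir a0 [[w1 w2]].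
    move/(Hecke_alive (posw_row_word (positive_set ok.1 a0))) => al.
    split=> //; split=> //.
    + case: w1 => [->|[x /and3P[ix p p0]]]; [by left|right; exists x].
      by rewrite ix -(entry_leE ok.1) p -(lt_entryE ok.1) p0.
    + by move/(fnd_entry T _ _ a0)/w2; rewrite (entry_gt0 ok.1).
  - case=> /okTE ok jr a0 [w1].
    move/(Hecke_alive (posw_col_word (positive_set ok.1 a0))) => al w2 w3.
    split=> //; split=> //.
    + case: w1 => [/(fnd_entry T _ _ a0)|[x /and4P[x0 xj p p0]]]; [by left|right; exists x].
      by rewrite x0 xj -(entry_leE ok.1) p -(lt_entryE ok.1) p0.
    + move/(fnd_entry T _ _ a0)/w2 => [|]; last by right.
      by rewrite -(entry_eq0 ok.1) => /eqP; left.
    + by move=> x /(fnd_entry T _ _ a0)/w3.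
case=> ad al; split; first exact: adm_is_state.
have al' := (Hecke_alive (adm_posw ad)).2 al.
case: U ad {al} al' => [T|T i a|T j a] //=.
- case=> ok ir a0 w1 w2 al; split=> //; split.
  + case: w1 => [->|[x /and3P[ix p p0]]]; [by left|right; exists x].
    by rewrite ix (entry_leE ok.1) p (lt_entryE ok.1) p0.
  + by move/(fnd_entry T _ _ a0)/w2; rewrite (entry_gt0 ok.1).
- case=> -[ok a0] jr w1 w2 w3 al; split=> //.
  + case: w1 => [/(fnd_entry T _ _ a0)|[x /and4P[x0 xj p p0]]]; [by left|right; exists x].
    by rewrite x0 xj (entry_leE ok.1) p (lt_entryE ok.1) p0.
  + move/(fnd_entry T _ _ a0)/w2 => [/eqP|]; last by right.
    by rewrite (entry_eq0 ok.1); left.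
  + by move=> x /(fnd_entry T _ _ a0)/w3.
Qed.

(** * Matched transitions *)

Lemma least_cons m n P : m <= n -> least m n P = if P m then Some m else least m.+1 n P.
Proof.
move=> mn; rewrite /least /index_iota (_ : n.+1 - m = (n.+1 - m.+1).+1); last by lia.
by rewrite /=; case: ifP.
Qed.

Lemma least_none m n (P : pred nat) : (forall y, m <= y <= n -> ~~ P y) -> least m n P = None.
Proof.
move=> H; rewrite /least; suff -> : [seq k <- index_iota m n.+1 | P k] = [::] by [].
apply/eqP; rewrite -[_ == _]negbK -has_filter; apply/hasPn => y.
by rewrite mem_index_iota ltnS; apply: H.
Qed.

Lemma least_some m n (P : pred nat) x : m <= x <= n -> P x -> (forall y, m <= y < x -> ~~ P y) ->
  least m n P = Some x.
Proof.
move=> /andP[mx xn] Px H; have [k E] : exists k, k = x - m by exists (x - m).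
elim: k m mx E H => [|k IH] m mx E H.
  by have Em : m = x; [lia|subst m; rewrite least_cons // Px].
rewrite least_cons; last by lia.
rewrite (negbTE (H m _)); last by lia.
by apply: IH => [||y ?]; [lia|lia|apply: H; lia].
Qed.

Lemma leastP m n (P : pred nat) :
  (exists x, [/\ least m n P = Some x, m <= x <= n, P x & forall y, m <= y < x -> ~~ P y]) \/
  (least m n P = None /\ forall y, m <= y <= n -> ~~ P y).
Proof.
have [h|h] := boolP (has P (index_iota m n.+1)); last first.
  right; have H y : m <= y <= n -> ~~ P y.
    by move=> yn; apply: (hasPn h); rewrite mem_index_iota ltnS.
  by rewrite least_none.
left; have ex : exists x, (m <= x <= n) && P x.
  by case/hasP: h => x; rewrite mem_index_iota ltnS => xm Px; exists x; rewrite xm.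
case: (ex_minnP ex) => x /andP[xn Px] min.
have H y : m <= y < x -> ~~ P y.
  by move=> yx; apply/negP => Py; have := min y; rewrite Py andbT; lia.
by exists x; split=> //; apply: least_some.
Qed.

Lemma greatest_some m n (P : pred nat) x : m <= x <= n -> P x -> (forall y, x < y <= n -> ~~ P y) ->
  greatest m n P = Some x.
Proof.
move=> xn Px H; rewrite /greatest.
have -> : index_iota m n.+1 = iota m (x - m) ++ x :: iota x.+1 (n - x).
  have -> : index_iota m n.+1 = iota m ((x - m) + (n - x).+1).
    by rewrite /index_iota; congr iota; lia.
  by rewrite iotaD /=; congr (_ ++ _ :: _); [lia|congr iota; lia].
rewrite filter_cat /= Px rev_cat rev_cons.
suff -> : [seq k <- iota x.+1 (n - x) | P k] = [::] by [].
apply/eqP; rewrite -[_ == _]negbK -has_filter; apply/hasPn => y.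
by rewrite mem_iota => ?; apply: H; lia.
Qed.

(** Only the four neighbours of the box have to be compared with its new value. *)
Lemma sh_upd t i x a : shtab t -> 0 < i <= x -> 0 < a ->
  (i < x -> 0 < t i x.-1 < a) -> (1 < i -> 0 < t i.-1 x < a) ->
  (t i x.+1 = 0 \/ a < t i x.+1) -> (t i.+1 x = 0 \/ a < t i.+1 x) ->
  shtab (upd t i x a).
Proof.
move=> st ix a0 l u r d; split.
- move=> k m; rewrite /upd; case: ifP => [/andP[/eqP-> /eqP->]//|_]; exact: sh_dom.
- move=> k m km; rewrite /upd.
  case: (boolP ((k == i) && (m.+1 == x))) => [/andP[/eqP ek /eqP em]|n1].
    have -> : (k == i) && (m == x) = false by lia.
    by subst k x; move=> _; apply: l; lia.
  case: (boolP ((k == i) && (m == x))) => [/andP[/eqP ek /eqP em]|n2].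
    by subst k m => ?; case: r; lia.
  exact: sh_row.
- move=> k m k0; rewrite /upd.
  case: (boolP ((k.+1 == i) && (m == x))) => [/andP[/eqP ek /eqP em]|n1].
    have -> : (k == i) && (m == x) = false by lia.
    by subst i m; move=> _; apply: u; lia.
  case: (boolP ((k == i) && (m == x))) => [/andP[/eqP ek /eqP em]|n2].
    by subst k m => ?; case: d; lia.
  exact: sh_col.
Qed.

Lemma okT_set (T : tableau) (i x a : nat) : okT T -> 0 < a -> shtab (upd (entry T) i x a) ->
  okT T.[(i, x) <- a].
Proof.
move=> [Tp st] a0 st'; split; first exact: positive_set.
suff -> : entry T.[(i, x) <- a] = upd (entry T) i x a by [].
by apply/funext => k; apply/funext => l; rewrite entry_set.
Qed.

Lemma okT_set_sh (T : tableau) (i x a : nat) : okT T.[(i, x) <- a] -> shtab (upd (entry T) i x a).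
Proof.
move=> [_]; suff -> : entry T.[(i, x) <- a] = upd (entry T) i x a by [].
by apply/funext => k; apply/funext => l; rewrite entry_set.
Qed.

Lemma increasing_setE (T : tableau) (i x a : nat) : okT T -> 0 < a -> 0 < entry T i x ->
  increasing T.[(i, x) <- a] <-> okT T.[(i, x) <- a].
Proof.
move=> okT0 a0 tx; split=> [inc|[Tp st]]; last exact: sh_increasing.
have [[Tb Tp] _ Ts] := (okTE T).2 okT0.
apply/okTE; have E : domf T.[(i, x) <- a] = domf T.
  by rewrite dom_setf; apply/fsetP => p; rewrite in_fset1U;
  case: eqP => // ->; rewrite -(entry_gt0 okT0.1) tx.
split=> //; last by rewrite E.
split; first by rewrite E.
by move=> p v; apply: positive_set.
Qed.

Lemma increasing_shifted_setE (T : tableau) (i x a : nat) : okT T -> 0 < a -> 0 < i -> 0 < x ->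
  (increasing T.[(i, x) <- a] /\ shifted (domf T.[(i, x) <- a])) <-> okT T.[(i, x) <- a].
Proof.
move=> okT0 a0 i0 x0; split=> [[inc sh]|[Tp st]]; last first.
  by split; [exact: sh_increasing|exact: sh_shifted].
have [[Tb Tp] _ Ts] := (okTE T).2 okT0.
apply/okTE; split=> //; split; last by move=> p v; apply: positive_set.
by move=> p; rewrite dom_setf in_fset1U => /orP[/eqP->|/Tb] //=; lia.
Qed.

Lemma has_row (T : tableau) i : okT T -> 0 < i -> has (fun p : box => p.1 == i) (domf T) = (0 < entry T i i).
Proof.
move=> [Tp st] i0; apply/hasP/idP => [[[k l] /= p /eqP E]|]; last first.
  by rewrite entry_gt0 // => p; exists (i, i).
subst k; have t0 : 0 < entry T i l by rewrite entry_gt0.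
by have := sh_dom st t0 => ?; have [] := @sh_dist _ i i i l st t0; lia.
Qed.

(** The transition relation from which both algorithms are recovered.  The side
    conditions are stronger than those of the forward rules: they describe the
    steps between admissible states.  Read from the left they imply the conditions
    of the forward rule [r], read from the right those of the inverse rule, so a
    linked pair is matched by both maps ([link_fwd], [link_inv]); conversely
    every admissible state has a link to follow in each direction in which a
    transition exists ([exists_fwd], [exists_inv]). *)
Inductive link : state -> rule -> box -> state -> Prop :=
| LR1 (T : tableau) (i j a : nat) of okT T & okT T.[(i, j) <- a] & 0 < a & entry T i j = 0 :
    link (RowOuter T i a) R1 (i, j) (Terminal T.[(i, j) <- a])
| LR2 (T : tableau) (i j a : nat) of okT T & 0 < i < j & entry T i j = 0 & 0 < entry T i j.-1
    & (1 < i -> 0 < entry T i.-1 j) & a = maxn (entry T i j.-1) (entry T i.-1 j) :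
    link (RowOuter T i a) R2 (i, j) (Terminal T)
| LR3 (T : tableau) (i x a b : nat) of okT T & 0 < i < x & b = entry T i x & 0 < b
    & a = maxn (entry T i x.-1) (entry T i.-1 x)
    & (i.+1 < x) || (0 < entry T i.+1 i.+1) :
    link (RowOuter T i a) R3 (i, x) (RowOuter T i.+1 b)
| LR4 (T : tableau) (i x a b : nat) of okT T & okT T.[(i, x) <- a] & 0 < i < x
    & b = entry T i x & 0 < a < b :
    link (RowOuter T i a) R4 (i, x) (RowOuter T.[(i, x) <- a] i.+1 b)
| LD1 (T : tableau) (i a b : nat) of okT T & 0 < i & b = entry T i i.+1 & 0 < b
    & entry T i.+1 i.+1 = 0 & a = maxn (entry T i i) (entry T i.-1 i.+1)
    & ~~ odd b & ~~ odd (entry T i i) :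
    link (RowOuter T i a) D1 (i, i.+1) (ColOuter T i.+1 b)
| LD2 (T : tableau) (i a b : nat) of okT T & 1 < i & a = entry T i.-1 i & b = entry T i i
    & 0 < b & ~~ odd a & ~~ odd b & (entry T i.-1 i.-1).+2 <= a :
    link (RowOuter T i a) D2 (i, i) (ColOuter T i.+1 b)
| LD3 (T : tableau) (i a b : nat) of okT T & okT T.[(i, i) <- a] & b = entry T i i
    & 0 < a < b & ~~ odd a & ~~ odd b :
    link (RowOuter T i a) D3 (i, i) (ColOuter T.[(i, i) <- a] i.+1 b)
| LD4 (T : tableau) (i b : nat) of okT T & b = entry T i i & 0 < b & ~~ odd b :
    link (RowOuter T i b.-1) D4 (i, i) (ColOuter T i.+1 b.+1)
| LC1 (T : tableau) (i j a : nat) of okT T & okT T.[(i, j) <- a] & 0 < a & entry T i j = 0 & i < j :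
    link (ColOuter T j a) C1 (i, j) (Terminal T.[(i, j) <- a])
| LC2 (T : tableau) (i j a : nat) of okT T & 1 < i <= j & entry T i j = 0 & 0 < entry T i.-1 j
    & (i < j -> 0 < entry T i j.-1) & a = maxn (entry T i.-1 j) (entry T i j.-1) :
    link (ColOuter T j a) C2 (i, j) (Terminal T)
| LC3 (T : tableau) (x j a b : nat) of okT T & 1 < x <= j & b = entry T x j & 0 < b
    & a = maxn (entry T x.-1 j) (entry T x j.-1) & (x = j -> odd a) :
    link (ColOuter T j a) C3 (x, j) (ColOuter T j.+1 b)
| LC4 (T : tableau) (x j a b : nat) of okT T & okT T.[(x, j) <- a] & 0 < x < j
    & b = entry T x j & 0 < a < b :
    link (ColOuter T j a) C4 (x, j) (ColOuter T.[(x, j) <- a] j.+1 b).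

Lemma entry_setE (T : tableau) (i x a : nat) : entry T.[(i, x) <- a] = upd (entry T) i x a.
Proof. by apply/funext => k; apply/funext => l; rewrite entry_set. Qed.

Section UpdShape.
Variables (t : filling) (i x a : nat).
Hypotheses (st : shtab (upd t i x a)) (a0 : 0 < a).

Lemma upd_dom : 0 < i <= x.
Proof. by apply: (sh_dom st); rewrite upd_eq. Qed.

Lemma upd_left : i < x -> 0 < t i x.-1 < a.
Proof.
move=> ix; have := @sh_row _ st i x.-1; rewrite (_ : x.-1.+1 = x) ?upd_eq; last by lia.
by rewrite upd_ne2; [apply=> //|]; lia.
Qed.

Lemma upd_up : 1 < i -> 0 < t i.-1 x < a.
Proof.
move=> i1; have := @sh_col _ st i.-1 x; rewrite (_ : i.-1.+1 = i) ?upd_eq; last by lia.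
by rewrite upd_ne1; [apply=> //|]; lia.
Qed.

Lemma upd_right : 0 < t i x.+1 -> a < t i x.+1.
Proof.
have := upd_dom => d; have := @sh_row _ st i x; rewrite upd_eq upd_ne2; last by lia.
by move=> H t0; have := H _ t0; lia.
Qed.

Lemma upd_down : 0 < t i.+1 x -> a < t i.+1 x.
Proof.
have := upd_dom => d; have := @sh_col _ st i x; rewrite upd_eq upd_ne1; last by lia.
by move=> H t0; have := H _ t0; lia.
Qed.

End UpdShape.

Lemma entry_row_bound T i j : 0 < entry T i j -> i <= rows (domf T).
Proof. by case: (leqP i (rows (domf T))) => // /(@entry_rows T i j)->. Qed.
Lemma entry_col_bound T i j : 0 < entry T i j -> j <= cols (domf T).
Proof. by case: (leqP j (cols (domf T))) => // /(@entry_cols T i j)->. Qed.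

Lemma not_empty T i j : 0 < entry T i j -> T <> [fmap].
Proof. by move=> t0 E; rewrite E entry_fmap0 in t0. Qed.

(** Equality holds only after acting on [N_Theta], because of D4. *)
Lemma link_word U r p V : link U r p V ->
  act (hword U) (Some FTheta) = act (hword V) (Some FTheta).
Proof.
case=> {U r p V}.
- move=> T i j a ok ok' a0 t0.
  set N := rows (domf T) + cols (domf T) + i + j + 5.
  have st := ok.2; have st' := okT_set_sh ok'; have := upd_dom st' a0 => d.
  have := rows_set T i j a; have := cols_set T i j a => r' c'.
  rewrite (@hword_Row N) ?(@word_R1 N _ i j); try lia; last exact: ok.1.
    by rewrite /hword /= (row_wordE (N := N) ok'.1) ?entry_setE //; lia.
  move=> l jl; case: (posnP (entry T i l)) => // tl.
  by have [] := @sh_dist _ i j i l st tl; lia.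
- move=> T i j a ok ij t0 t1 t2 aE.
  set N := rows (domf T) + cols (domf T) + i + j + 5.
  rewrite (@hword_Row N) /hword /= ?(@row_wordE N); try lia; try exact: ok.1.
  by apply: (@word_R2 N _ ok.2 i j); lia.
- move=> T i x a b ok ix bE b0 aE c.
  set N := rows (domf T) + cols (domf T) + i + x + 5.
  have := @sh_dist _ i x.-1 i x ok.2 => d1.
  rewrite !(@hword_Row N); try lia; try exact: ok.1.
  by apply: (@word_R3 N _ ok.2 i x); lia.
- move=> T i x a b ok ok' ix bE ab.
  set N := rows (domf T) + cols (domf T) + i + x + 5.
  have st' := okT_set_sh ok'; have a0 : 0 < a by lia.
  have := rows_set T i x a; have := cols_set T i x a => r' c'.
  have := upd_left st' a0 => l.
  rewrite !(@hword_Row N) ?entry_setE; try lia; try exact: ok.1; try exact: ok'.1.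
  by apply: (@word_R4 N _ ok.2 i x); lia.
- move=> T i a b ok i0 bE b0 t0 aE ob ot.
  set N := rows (domf T) + cols (domf T) + i + 5.
  have := @sh_dist _ i i i i.+1 ok.2 => d1.
  rewrite (@hword_Row N) ?(@hword_Col N); try lia; try exact: ok.1.
  by apply: (@word_D1 N _ ok.2 i); lia.
- move=> T i a b ok i1 aE bE b0 oa ob ta.
  set N := rows (domf T) + cols (domf T) + i + 5.
  have := @sh_dist _ i.-1 i i i ok.2 => d1.
  rewrite (@hword_Row N) ?(@hword_Col N); try lia; try exact: ok.1.
  by apply: (@word_D2 N _ ok.2 i); lia.
- move=> T i a b ok ok' bE ab oa ob.
  set N := rows (domf T) + cols (domf T) + i + 5.
  have st' := okT_set_sh ok'; have a0 : 0 < a by lia.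
  have := rows_set T i i a; have := cols_set T i i a => r' c'.
  have := upd_dom st' a0 => d.
  rewrite (@hword_Row N) ?(@hword_Col N) ?entry_setE; try lia; try exact: ok.1; try exact: ok'.1.
  by apply: (@word_D3 N _ ok.2 i) => //; lia.
- move=> T i b ok bE b0 ob.
  set N := rows (domf T) + cols (domf T) + i + 5.
  have d : 0 < i <= i by apply: (sh_dom ok.2); rewrite -bE.
  rewrite (@hword_Row N) ?(@hword_Col N); try lia; try exact: ok.1.
  by apply: (@word_D4 N _ ok.2 i); lia.
- move=> T i j a ok ok' a0 t0 ij.
  set N := rows (domf T) + cols (domf T) + i + j + 5.
  have st := ok.2; have st' := okT_set_sh ok'; have := upd_dom st' a0 => d.
  have := rows_set T i j a; have := cols_set T i j a => r' c'.
  rewrite (@hword_Col N) ?(@word_C1 N _ i j); try lia; last exact: ok.1.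
    rewrite /hword /= (row_wordE (N := N) ok'.1) ?entry_setE; try lia.
    by apply: heq_sym; apply: heq_sh_row_col.
  move=> l jl; case: (posnP (entry T l j)) => // tl.
  by have := sh_dom st tl; have [] := @sh_dist _ i j l j st tl; lia.
- move=> T i j a ok ij t0 t1 t2 aE.
  set N := rows (domf T) + cols (domf T) + i + j + 5.
  rewrite (@hword_Col N) /hword /= ?(@row_wordE N); try lia; try exact: ok.1.
  rewrite (@word_C2 N _ ok.2 i j) //; try lia.
  by apply: heq_sym; apply: heq_sh_row_col; exact: ok.2.
- move=> T x j a b ok xj bE b0 aE c.
  set N := rows (domf T) + cols (domf T) + x + j + 5.
  have := @sh_dist _ x.-1 j x j ok.2 => d1.
  rewrite !(@hword_Col N); try lia; try exact: ok.1.
  by apply: (@word_C3 N _ ok.2 x j); lia.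
- move=> T x j a b ok ok' xj bE ab.
  set N := rows (domf T) + cols (domf T) + x + j + 5.
  have st' := okT_set_sh ok'; have a0 : 0 < a by lia.
  have := rows_set T x j a; have := cols_set T x j a => r' c'.
  have := upd_up st' a0 => l.
  rewrite !(@hword_Col N) ?entry_setE; try lia; try exact: ok.1; try exact: ok'.1.
  apply: (@word_C4 N _ ok.2 x j); try lia.
  by case: (ltnP 1 x) => [/l|x1]; [lia|]; have := @sh_dom _ ok.2 x.-1 j; lia.
Qed.

Lemma row_bound T i j : shtab (entry T) -> 0 < i -> (1 < i -> 0 < entry T i.-1 j) ->
  0 < i <= (rows (domf T)).+1.
Proof.
move=> st i0 H; rewrite i0 /=; case: (ltnP 1 i) => i1; last by lia.
by have := entry_row_bound (H i1); lia.
Qed.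

Lemma link_adm U r p V : link U r p V -> adm U /\ adm V.
Proof.
case=> {U r p V}.
- move=> T i j a ok ok' a0 t0; have st := ok.2; have st' := okT_set_sh ok'.
  have d := upd_dom st' a0; have l := upd_left st' a0; have u := upd_up st' a0.
  split; last by split=> //; apply: (@not_empty _ i j); rewrite entry_setE upd_eq.
  split=> //.
  + by apply: (@row_bound _ _ j) => //; lia.
  + by case: (ltnP 1 i) => i1; [right; exists j; lia|left; lia].
  + by have := @sh_dom _ st i.-1 i; have := @sh_dist _ i i i j.-1 st; have [E|] := eqVneq i j; subst; lia.
- move=> T i j a ok ij t0 t1 t2 aE; have st := ok.2.
  split; last by split=> //; apply: (@not_empty _ i j.-1).
  split=> //; try lia.
  + by apply: (@row_bound _ _ j) => //; lia.
  + by case: (ltnP 1 i) => i1; [right; exists j; lia|left; lia].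
  + by have := @sh_dist _ i i i j.-1 st; lia.
- move=> T i x a b ok ix bE b0 aE c; have st := ok.2.
  have tb : 0 < entry T i x by rewrite -bE.
  have l := @sh_dist _ i x.-1 i x st tb; have u := @sh_dist _ i.-1 x i x st tb.
  have dg := @sh_dist _ i i i x st tb.
  have rb := entry_row_bound tb.
  have dn := @sh_dist _ i x i.+1 x st.
  split; split=> //; try lia.
  + by case: (ltnP 1 i) => i1; [right; exists x; lia|left; lia].
  + by right; exists x; rewrite /= -bE; lia.
  + by move=> /= E; have := @sh_dist _ i i.+1 i x st tb; case: (eqVneq x i.+1) => [Ex|]; [subst x|]; lia.
- move=> T i x a b ok ok' ix bE ab; have st := ok.2; have st' := okT_set_sh ok'.
  have a0 : 0 < a by lia.
  have tb : 0 < entry T i x by lia.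
  have l := upd_left st' a0; have u := upd_up st' a0.
  have dg := @sh_dist _ i i i x st tb.
  have rb := entry_row_bound tb.
  have rb' : i <= rows (domf T.[(i, x) <- a]).
    by apply: (@entry_row_bound _ _ x); rewrite entry_setE upd_eq.
  have dn := @sh_dist _ i x i.+1 x st.
  split; split=> //; try lia.
  + by case: (ltnP 1 i) => i1; [right; exists x; lia|left; lia].
  + by right; exists x; rewrite entry_setE /= upd_eq upd_ne1 -?bE; lia.
  + rewrite entry_setE /= => E; exfalso; move: E.
    have [E|ne] := eqVneq x i.+1; first by subst x; rewrite upd_eq; lia.
    by rewrite upd_ne2; [have := @sh_dist _ i i.+1 i x st tb; lia|lia].
- move=> T i a b ok i0 bE b0 t0 aE ob ot; have st := ok.2.
  have tb : 0 < entry T i i.+1 by rewrite -bE.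
  have dg := @sh_dist _ i i i i.+1 st tb.
  have u := @sh_dist _ i.-1 i.+1 i i.+1 st tb.
  have rb := entry_row_bound tb; have cb := entry_col_bound tb.
  split; split=> //; try lia.
  + by case: (ltnP 1 i) => i1; [right; exists i.+1; lia|left; lia].
  + by left.
  + move=> x /= E; have d := @sh_dom _ st x i; have := @sh_dist _ x i i i st; lia.
- move=> T i a b ok i1 aE bE b0 oa ob ta; have st := ok.2.
  have tb : 0 < entry T i i by rewrite -bE.
  have u := @sh_dist _ i.-1 i i i st tb.
  have r := @sh_dist _ i i i i.+1 st.
  have rb := entry_row_bound tb; have cb := entry_col_bound tb.
  split; split=> //; try lia.
  + by right; exists i; lia.
  + by right; exists i; rewrite /=; lia.
  + by move=> /= E; lia.
  + by move=> x /= E; have d := @sh_dom _ st x i; have := @sh_dist _ x i i i st tb; lia.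
- move=> T i a b ok ok' bE ab oa ob; have st := ok.2; have st' := okT_set_sh ok'.
  have a0 : 0 < a by lia.
  have tb : 0 < entry T i i by lia.
  have d0 := upd_dom st' a0; have u := upd_up st' a0.
  have r := @sh_dist _ i i i i.+1 st.
  have rb := entry_row_bound tb.
  have cb' : i <= cols (domf T.[(i, i) <- a]).
    by apply: (@entry_col_bound _ i); rewrite entry_setE upd_eq.
  split; split=> //; try lia.
  + by case: (ltnP 1 i) => i1; [right; exists i; lia|left; lia].
  + by split=> //; lia.
  + by right; exists i; rewrite entry_setE /= upd_eq upd_ne2 -?bE; lia.
  + by rewrite entry_setE /= upd_ne2; lia.
  + move=> x; rewrite entry_setE /=; have [->|ne] := eqVneq x i; first by rewrite upd_eq; lia.
    rewrite upd_ne1 // => E; have d := @sh_dom _ st x i; have := @sh_dist _ x i i.-1 i st; lia.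
- move=> T i b ok bE b0 ob; have st := ok.2.
  have tb : 0 < entry T i i by rewrite -bE.
  have d0 := sh_dom st tb.
  have u := @sh_dist _ i.-1 i i i st tb.
  have r := @sh_dist _ i i i i.+1 st.
  have rb := entry_row_bound tb; have cb := entry_col_bound tb.
  split; split=> //; try lia.
  + by case: (ltnP 1 i) => i1; [right; exists i; lia|left; lia].
  + have [E|ne] := eqVneq (entry T i i.+1) b.+1; [by left|right; exists i].
    by rewrite /=; lia.
  + by move=> x /= E; have d := @sh_dom _ st x i; have := @sh_dist _ x i i i st tb; lia.
- move=> T i j a ok ok' a0 t0 ij; have st := ok.2; have st' := okT_set_sh ok'.
  have d := upd_dom st' a0; have l := upd_left st' a0; have u := upd_up st' a0.
  have l0 : 0 < entry T i j.-1 by lia.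
  have cb := entry_col_bound l0.
  split; last by split=> //; apply: (@not_empty _ i j); rewrite entry_setE upd_eq.
  split=> //; try lia.
  + by right; exists i; lia.
  + by move=> _; left; have := @sh_dist _ i j j j st; lia.
  + by move=> x E; have d' := @sh_dom _ st x j.-1; have := @sh_dist _ x j.-1 i j.-1 st l0; lia.
- move=> T i j a ok ij t0 t1 t2 aE; have st := ok.2.
  have cb := entry_col_bound t1.
  split; last by split=> //; apply: (@not_empty _ i.-1 j).
  split=> //; try lia.
  + by split=> //; lia.
  + case: (ltnP i j) => ij'; [right; exists i; lia|left].
    have E : i = j by lia.
    by subst j; have := @sh_dom _ st i i.-1; lia.
  + by move=> _; left; have := @sh_dist _ i j j j st; lia.
  + by move=> x E; have d' := @sh_dom _ st x j.-1; have := @sh_dist _ x j.-1 i.-1 j st t1; lia.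
- move=> T x j a b ok xj bE b0 aE c; have st := ok.2.
  have tb : 0 < entry T x j by rewrite -bE.
  have cb := entry_col_bound tb.
  have u := @sh_dist _ x.-1 j x j st tb; have l := @sh_dist _ x j.-1 x j st tb.
  have r := @sh_dist _ x j x j.+1 st.
  split; split=> //; try lia.
  + by split=> //; lia.
  + case: (ltnP x j) => ij'; [right; exists x; lia|left].
    have E : x = j by lia.
    by subst j; have := @sh_dom _ st x x.-1; lia.
  + case: (ltnP x j) => xj' E; last by right; apply: c; lia.
    by have := @sh_dist _ x j j.-1 j st; lia.
  + by move=> y E; have d' := @sh_dom _ st y j.-1; have := @sh_dist _ y j.-1 x.-1 j st; lia.
  + by right; exists x; rewrite /=; lia.
  + by move=> /= E; have := @sh_dist _ x j.+1 j j.+1 st; lia.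
  + by move=> y /= E; have d' := @sh_dom _ st y j; have := @sh_dist _ y j x.-1 j st; lia.
- move=> T x j a b ok ok' xj bE ab; have st := ok.2; have st' := okT_set_sh ok'.
  have a0 : 0 < a by lia.
  have tb : 0 < entry T x j by lia.
  have cb := entry_col_bound tb.
  have l := upd_left st' a0; have u := upd_up st' a0.
  have r := @sh_dist _ x j x j.+1 st.
  have cb' : j <= cols (domf T.[(x, j) <- a]).
    by apply: (@entry_col_bound _ x); rewrite entry_setE upd_eq.
  split; split=> //; try lia.
  + by right; exists x; lia.
  + by move=> E; have := @sh_dist _ x j j.-1 j st; lia.
  + by move=> y E; have d' := @sh_dom _ st y j.-1; have := @sh_dist _ y j.-1 x j.-1 st; lia.
  + by split=> //; lia.
  + by right; exists x; rewrite entry_setE /= upd_eq upd_ne2 -?bE; lia.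
  + by rewrite entry_setE /= upd_ne2; [have := @sh_dist _ x j.+1 j j.+1 st; lia|lia].
  + move=> y; rewrite entry_setE /=; have [->|ne] := eqVneq y x; first by rewrite upd_eq; lia.
    rewrite upd_ne1 // => E; have d' := @sh_dom _ st y j; have := @sh_dist _ y j x j st tb.
    have := @sh_dist _ x j y j st; lia.
Qed.

Section Searches.
Variable T : tableau.
Hypothesis ok : okT T.
Let st : shtab (entry T) := ok.2.
Let mem i j : ((i, j) \in domf T) = (0 < entry T i j) := esym (entry_gt0 ok.1 i j).

Lemma row_least_some i x a : 0 < i <= x -> a < entry T i x -> (i < x -> entry T i x.-1 <= a) ->
  least i (cols (domf T)) (fun x => ((i, x) \in domf T) && (a < entry T i x)) = Some x.
Proof.
move=> ix ax l; have tx : 0 < entry T i x by lia.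
have cb := entry_col_bound tx; apply: least_some; [lia|by rewrite mem; lia|].
by move=> y yx; rewrite mem; have := @sh_dist _ i y i x.-1 st; have := @sh_dist _ i x.-1 i x st; lia.
Qed.

Lemma row_least_none i j a : 0 < i <= j -> entry T i j = 0 -> (i < j -> 0 < entry T i j.-1 <= a) ->
  least i (cols (domf T)) (fun x => ((i, x) \in domf T) && (a < entry T i x)) = None.
Proof.
move=> ij t0 l; apply: least_none => y yx; rewrite mem.
case: (ltnP y j) => yj; last by have := @sh_dist _ i j i y st; lia.
by have := @sh_dist _ i y i j.-1 st; lia.
Qed.

Lemma row_end i j : 0 < i <= j -> entry T i j = 0 -> (i < j -> 0 < entry T i j.-1) ->
  least i (i + cols (domf T)) (fun j => (i, j) \notin domf T) = Some j.
Proof.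
move=> ij t0 l; apply: least_some; rewrite ?mem.
- case: (ltnP i j) => ij'; last by lia.
  by have := entry_col_bound (l ij'); lia.
- by rewrite t0.
- by move=> y yj; rewrite mem; have := @sh_dist _ i y i j.-1 st; lia.
Qed.

Lemma col_least_some x j a : 0 < x -> a < entry T x j -> (1 < x -> entry T x.-1 j <= a) ->
  least 1 (rows (domf T)) (fun x => ((x, j) \in domf T) && (a < entry T x j)) = Some x.
Proof.
move=> x0 ax l; have tx : 0 < entry T x j by lia.
have := sh_dom st tx => d.
have cb := entry_row_bound tx; apply: least_some; [lia|by rewrite mem; lia|].
by move=> y yx; rewrite mem; have := @sh_dist _ y j x.-1 j st; have := @sh_dist _ x.-1 j x j st; lia.
Qed.

Lemma col_least_none i j a : 0 < i <= j -> entry T i j = 0 -> (1 < i -> 0 < entry T i.-1 j <= a) ->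
  least 1 (rows (domf T)) (fun x => ((x, j) \in domf T) && (a < entry T x j)) = None.
Proof.
move=> ij t0 l; apply: least_none => y yx; rewrite mem.
case: (ltnP y i) => yi; last by have d := @sh_dom _ st y j; have := @sh_dist _ i j y j st; lia.
by have := @sh_dist _ y j i.-1 j st; lia.
Qed.

Lemma col_end i j : 0 < i <= j -> entry T i j = 0 -> (1 < i -> 0 < entry T i.-1 j) ->
  least 1 (rows (domf T)).+1 (fun i => (i, j) \notin domf T) = Some i.
Proof.
move=> ij t0 l; apply: least_some; rewrite ?mem.
- case: (ltnP 1 i) => ij'; last by lia.
  by have := entry_row_bound (l ij'); lia.
- by rewrite t0.
- by move=> y yi; rewrite mem; have := @sh_dist _ y j i.-1 j st; lia.
Qed.

Lemma row_greatest h x a : h < x -> 0 < entry T h x <= a ->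
  (0 < entry T h x.+1 -> a < entry T h x.+1) ->
  greatest h.+1 (cols (domf T)) (fun x => entry_le T h x a) = Some x.
Proof.
move=> hx xa r; have tx : 0 < entry T h x by lia.
have := sh_dom st tx => d.
have cb := entry_col_bound tx; apply: greatest_some; [lia|by rewrite (entry_leE ok.1)|].
by move=> y yx; rewrite (entry_leE ok.1); have := @sh_dist _ h x.+1 h y st; lia.
Qed.

Lemma col_greatest h x a : 0 < x < h -> 0 < entry T x h <= a ->
  (0 < entry T x.+1 h -> a < entry T x.+1 h) ->
  greatest 1 h.-1 (fun x => entry_le T x h a) = Some x.
Proof.
move=> hx xa r; apply: greatest_some; [lia|by rewrite (entry_leE ok.1)|].
by move=> y yx; rewrite (entry_leE ok.1); have := @sh_dist _ x.+1 h y h st; lia.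
Qed.

End Searches.

Lemma link_fwd U r p V : link U r p V -> fwd U = Some (r, p, V).
Proof.
case=> {U r p V}.
- move=> T i j a ok ok' a0 t0; have st' := okT_set_sh ok'.
  have d := upd_dom st' a0; have l := upd_left st' a0; have u := upd_up st' a0.
  rewrite /= /fwd_row (@row_least_none _ ok i j) //; last by lia.
  rewrite (@row_end _ ok i j) //=; last by lia.
  by rewrite asboolT //; apply/increasing_shifted_setE => //; lia.
- move=> T i j a ok ij t0 t1 t2 aE; have st := ok.2.
  have a0 : 0 < a by lia.
  rewrite /= /fwd_row (@row_least_none _ ok i j) //; try lia.
  rewrite (@row_end _ ok i j) //=; last by lia.
  rewrite asboolF // => /increasing_shifted_setE H.
  have st' : shtab (upd (entry T) i j a) by apply: okT_set_sh; apply: H => //; lia.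
  have l := upd_left st' a0; have u := upd_up st' a0.
  by have := @sh_dom _ st i.-1 j; lia.
- move=> T i x a b ok ix bE b0 aE c; have st := ok.2.
  have tb : 0 < entry T i x by rewrite -bE.
  have l := @sh_dist _ i x.-1 i x st tb; have u := @sh_dist _ i.-1 x i x st tb.
  have du := @sh_dom _ st i.-1 x.
  have a0 : 0 < a by lia.
  rewrite /= /fwd_row (@row_least_some _ ok i x a); try lia.
  rewrite ifT; last by lia.
  rewrite asboolF.
    by rewrite has_row // c -bE.
  move=> /increasing_setE H.
  have st' : shtab (upd (entry T) i x a) by apply: okT_set_sh; apply: H => //; lia.
  by have := upd_left st' a0; have := upd_up st' a0; lia.
- move=> T i x a b ok ok' ix bE ab; have st := ok.2; have st' := okT_set_sh ok'.
  have a0 : 0 < a by lia.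
  have l := upd_left st' a0; have u := upd_up st' a0.
  rewrite /= /fwd_row (@row_least_some _ ok i x a); try lia.
  rewrite ifT; last by lia.
  by rewrite asboolT -?bE //; apply/increasing_setE => //; lia.
- move=> T i a b ok i0 bE b0 t0 aE ob ot; have st := ok.2.
  have tb : 0 < entry T i i.+1 by rewrite -bE.
  have l := @sh_dist _ i i i i.+1 st tb; have u := @sh_dist _ i.-1 i.+1 i i.+1 st tb.
  have du := @sh_dom _ st i.-1 i.+1.
  have a0 : 0 < a by lia.
  rewrite /= /fwd_row (@row_least_some _ ok i i.+1 a) /=; try lia.
  rewrite ltnSn asboolF.
    by rewrite has_row // t0 orbF ltnn -bE.
  move=> /increasing_setE H.
  have st' : shtab (upd (entry T) i i.+1 a) by apply: okT_set_sh; apply: H => //; lia.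
  by have := upd_left st' a0; have := upd_up st' a0; rewrite /=; lia.
- move=> T i a b ok i1 aE bE b0 oa ob ta; have st := ok.2.
  have tb : 0 < entry T i i by rewrite -bE.
  have u := @sh_dist _ i.-1 i i i st tb.
  have a0 : 0 < a by lia.
  rewrite /= /fwd_row (@row_least_some _ ok i i a) /=; try lia.
  rewrite ltnn -bE (negbTE oa) (negbTE ob) /= asboolF //.
  move=> /increasing_setE H.
  have st' : shtab (upd (entry T) i i a) by apply: okT_set_sh; apply: H => //; lia.
  by have := upd_up st' a0; lia.
- move=> T i a b ok ok' bE ab oa ob; have st := ok.2; have st' := okT_set_sh ok'.
  have a0 : 0 < a by lia.
  have d := upd_dom st' a0.
  rewrite /= /fwd_row (@row_least_some _ ok i i a) /=; try lia.
  rewrite ltnn -bE (negbTE oa) (negbTE ob) /= asboolT //.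
  by apply/increasing_setE => //; lia.
- move=> T i b ok bE b0 ob; have st := ok.2.
  have tb : 0 < entry T i i by rewrite -bE.
  have d := sh_dom st tb.
  rewrite /= /fwd_row (@row_least_some _ ok i i b.-1) /=; try lia.
  by rewrite ltnn -bE ifF //; lia.
- move=> T i j a ok ok' a0 t0 ij; have st' := okT_set_sh ok'.
  have d := upd_dom st' a0; have l := upd_left st' a0; have u := upd_up st' a0.
  rewrite /= /fwd_col (@col_least_none _ ok i j) //; last by lia.
  rewrite (@col_end _ ok i j) //=; last by lia.
  by rewrite asboolT //; apply/increasing_shifted_setE => //; lia.
- move=> T i j a ok ij t0 t1 t2 aE; have st := ok.2.
  have a0 : 0 < a by lia.
  rewrite /= /fwd_col (@col_least_none _ ok i j) //; try lia.
  rewrite (@col_end _ ok i j) //=; last by lia.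
  rewrite asboolF // => /increasing_shifted_setE H.
  have st' : shtab (upd (entry T) i j a) by apply: okT_set_sh; apply: H => //; lia.
  have l := upd_left st' a0; have u := upd_up st' a0.
  by have := @sh_dom _ st i j.-1; lia.
- move=> T x j a b ok xj bE b0 aE c; have st := ok.2.
  have tb : 0 < entry T x j by rewrite -bE.
  have u := @sh_dist _ x.-1 j x j st tb; have l := @sh_dist _ x j.-1 x j st tb.
  have dl := @sh_dom _ st x j.-1.
  have a0 : 0 < a by lia.
  rewrite /= /fwd_col (@col_least_some _ ok x j a); try lia.
  rewrite asboolF -?bE // => /increasing_setE H.
  have st' : shtab (upd (entry T) x j a) by apply: okT_set_sh; apply: H => //; lia.
  by have := upd_left st' a0; have := upd_up st' a0; lia.
- move=> T x j a b ok ok' xj bE ab; have st := ok.2; have st' := okT_set_sh ok'.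
  have a0 : 0 < a by lia.
  have l := upd_left st' a0; have u := upd_up st' a0.
  rewrite /= /fwd_col (@col_least_some _ ok x j a); try lia.
  by rewrite asboolT -?bE //; apply/increasing_setE => //; lia.
Qed.

(** A terminal state has one inverse transition for each corner and direction; the
    rule and the label of the last forward transition select one of them. *)
Definition inv_terminal (r : rule) (V : tableau) (p : box) : option state :=
  match r with
  | R1 | R2 => inv_terminal_row V p.1 p.2
  | C1 | C2 => inv_terminal_col V p.1 p.2
  | _ => None
  end.

Definition inv0 (V : state) : option state :=
  match V with
  | Terminal _ => None
  | RowOuter T i a => if i == 1 then None else inv_row T i a
  | ColOuter T j a => inv_col T j a
  end.

Definition undo (r : rule) (p : box) (V : state) : option state :=
  if V is Terminal T then inv_terminal r T p else Defs.inv V.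

Lemma invE V : adm V -> alive (hword V) -> Defs.inv V = inv0 V.
Proof. by move=> ad al; rewrite /Defs.inv asboolT //; apply/admissibleE. Qed.

Lemma set_back (T : tableau) (i x a b : nat) : okT T -> 0 < b -> entry T i x = b ->
  T.[(i, x) <- a].[(i, x) <- b] = T.
Proof.
move=> ok b0 E; apply/fmapP => p; rewrite !fnd_set; case: eqP => // ->.
by apply/esym/fnd_entry.
Qed.

Lemma rem_back (T : tableau) (i x a : nat) : okT T -> entry T i x = 0 ->
  T.[(i, x) <- a].[~ (i, x)] = T.
Proof.
move=> ok E; apply/fmapP => p; rewrite fnd_rem1 fnd_set; case: (eqVneq p (i, x)) => //= ->.
by apply/esym/not_fnd; have := entry_eq0 ok.1 i x; rewrite E eqxx.
Qed.

Lemma inner_cornerE V i j : okT V -> inner_corner (domf V) i j =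
  [&& 0 < entry V i j, entry V i j.+1 == 0 & entry V i.+1 j == 0].
Proof. by move=> [Vp _]; rewrite /inner_corner entry_gt0 // !entry_eq0. Qed.

Lemma outer_cornerE V i j : okT V -> outer_corner (domf V) i j =
  [&& entry V i j == 0, (i == j) || (0 < entry V i j.-1) & (i == 1) || (0 < entry V i.-1 j)].
Proof. by move=> [Vp _]; rewrite /outer_corner entry_eq0 // !entry_gt0. Qed.

Lemma link_inv U r p V : link U r p V -> alive (hword V) -> undo r p V = Some U.
Proof.
move=> lk al; have [_ adV] := link_adm lk.
have iE := invE adV al; rewrite /undo; move: lk iE; case=> {U r p V al adV}.
- move=> T i j a ok ok' a0 t0 _; have st := ok.2; have st' := okT_set_sh ok'.
  have d := upd_dom st' a0; have r := upd_right st' a0; have dn := upd_down st' a0.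
  have h1 := @sh_dist _ i j i j.+1 st; have h2 := @sh_dist _ i j i.+1 j st.
  have h3 := @sh_dom _ st i.+1 j.
  rewrite /= /inv_terminal_row inner_cornerE // entry_setE upd_eq upd_ne2; last by lia.
  rewrite upd_ne1; last by lia.
  rewrite ifT; last by lia.
  by rewrite rem_back.
- move=> T i j a ok ij t0 t1 t2 aE _.
  rewrite /= /inv_terminal_row inner_cornerE // t0 /= outer_cornerE // ifT; last by lia.
  by rewrite /larger /= maxnC -aE.
- move=> T i x a b ok ix bE b0 aE c ->; have st := ok.2.
  rewrite /= ifF; last by lia.
  rewrite /inv_row /= (@row_greatest _ ok i x); first last.
  - by have := @sh_row _ st i x; lia.
  - by lia.
  - by lia.
  by rewrite -bE eqxx /larger /= -aE.
- move=> T i x a b ok ok' ix bE ab ->; have st := ok.2; have st' := okT_set_sh ok'.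
  rewrite /= ifF; last by lia.
  rewrite /inv_row /= (@row_greatest _ ok' i x); first last.
  - by rewrite entry_setE upd_ne2; have := @sh_row _ st i x; lia.
  - by rewrite entry_setE upd_eq; lia.
  - by lia.
  rewrite entry_setE upd_eq ifF; last by lia.
  by rewrite set_back //; lia.
- move=> T i a b ok i0 bE b0 t0 aE ob ot ->; have st := ok.2.
  have := @sh_dist _ i i i i.+1 st => d.
  rewrite /= /inv_col /= (entry_leE ok.1) ifT; last by lia.
  rewrite ifF; last by lia.
  rewrite (negbTE ob) ifT; first by rewrite /larger /= -aE.
  by apply/eqP/fnd_entry.
- move=> T i a b ok i1 aE bE b0 oa ob ta ->.
  rewrite /= /inv_col /= (entry_leE ok.1) ifT; last by lia.
  by rewrite ifT -?aE ?(negbTE oa) //; lia.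
- move=> T i a b ok ok' bE ab oa ob ->; have st := ok.2.
  have r := @sh_row _ st i i.
  rewrite /= /inv_col /= (entry_leE ok'.1) ifT; last by rewrite entry_setE upd_eq; lia.
  rewrite entry_setE upd_eq ifF; last by lia.
  rewrite (negbTE ob) ifF.
    rewrite (lt_entryE ok'.1) entry_setE upd_ne2; last by lia.
    rewrite ifT; last by lia.
    by rewrite set_back //; lia.
  apply/eqP => /fnd_entry; rewrite entry_setE upd_ne2; last by lia.
  by move=> H; have := H ltac:(lia); lia.
- move=> T i b ok bE b0 ob ->.
  rewrite /= /inv_col /= (entry_leE ok.1) ifT; last by lia.
  by rewrite ifF -?bE /= ?ob //; lia.
- move=> T i j a ok ok' a0 t0 ij _; have st := ok.2; have st' := okT_set_sh ok'.
  have d := upd_dom st' a0.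
  have h1 := @sh_dist _ i j i j.+1 st; have h2 := @sh_dist _ i j i.+1 j st.
  have h3 := @sh_dom _ st i.+1 j.
  rewrite /= /inv_terminal_col inner_cornerE // entry_setE upd_eq upd_ne2; last by lia.
  rewrite upd_ne1; last by lia.
  rewrite ifT; last by lia.
  by rewrite rem_back.
- move=> T i j a ok ij t0 t1 t2 aE _.
  rewrite /= /inv_terminal_col inner_cornerE // t0 /= outer_cornerE // ifT; last by lia.
  by rewrite /larger /= -aE.
- move=> T x j a b ok xj bE b0 aE c ->; have st := ok.2.
  have tb : 0 < entry T x j by lia.
  have h := @sh_dist _ x j j j st.
  have h1 := @sh_dist _ x.-1 j x j st.
  rewrite /= /inv_col /= (entry_leE ok.1).
  have [E|ne] := eqVneq x j.
    subst x; rewrite ifT; last by lia.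
    have z : entry T j j.-1 = 0 by have := @sh_dom _ st j j.-1; lia.
    rewrite ifT -?bE // (_ : entry T j.-1 j = a); last by lia.
    by rewrite c.
  rewrite ifF; last by lia.
  rewrite (@col_greatest _ ok j x); first last.
  - by have := @sh_col _ st x j; lia.
  - by lia.
  - by lia.
  by rewrite -bE eqxx /larger /= -aE.
- move=> T x j a b ok ok' xj bE ab ->; have st := ok.2; have st' := okT_set_sh ok'.
  have h := @sh_dist _ x j j j st.
  rewrite /= /inv_col /= (entry_leE ok'.1) ifF; last by rewrite entry_setE upd_ne1; lia.
  rewrite (@col_greatest _ ok' j x); first last.
  - by rewrite entry_setE upd_ne1; have := @sh_col _ st x j; lia.
  - by rewrite entry_setE upd_eq; lia.
  - by lia.
  rewrite entry_setE upd_eq ifF; last by lia.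
  by rewrite set_back //; lia.
Qed.

(** * Parity of entries near the diagonal *)

(** Switching [d, d+1] into [d, d-1] and braiding brings the odd letter [d-1] to
    the front. *)
Lemma dead_aba d v : 0 < d -> ~~ odd d -> act [:: d, d.+1, d & v] (Some FTheta) = None.
Proof.
move=> d0 od; rewrite -[[:: d, d.+1, d & v]]/([:: d; d.+1] ++ d :: v) act_cat act_switch //.
have H : heq [:: d, d.-1, d & v] [:: d.-1, d, d.-1 & v] by apply: heq_sym; apply: heq_aba; lia.
rewrite -act_cat H.
case E: act => [z|] //; have : alive [:: d.-1, d, d.-1 & v] by rewrite /alive E.
by move=> /alive_head od'; have := od' ltac:(lia); lia.
Qed.

Section Parity.
Variables (N : nat) (t : filling).
Hypothesis st : shtab t.

(** The letters read before a diagonal entry commute with it, hence it is even. *)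
Lemma diag_even_row i a : 0 < i <= N -> 0 < t i i -> alive (Wrow N t i a) -> ~~ odd (t i i).
Proof.
move=> iN ti; rewrite /Wrow (rowt_split iN ti) -catA catA => al.
apply: (alive_front ti _ _ al); first by rewrite all_cat posw_rowsw posw_vals.
rewrite all_cat; apply/andP; split.
  apply: all_rhi => k l ? ? tl0; rewrite /far; have := sh_dom st tl0 => ?.
  by have := @sh_dist t i i k l st; lia.
by apply: all_rowL => l ? tl0; have := sh_dom st tl0; lia.
Qed.

Lemma clo_prefix k j : 0 < k <= j -> exists s, clo N t j.+1 = clo N t k.+1 ++ s.
Proof.
move=> /andP[k0]; elim: j => [|j IH] kj; first by lia.
have [->|ne] := eqVneq k j.+1; first by exists [::]; rewrite cats0.
have [|s E] := IH; first by lia.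
by exists (s ++ colt N t j.+1); rewrite clo_rec // E catA.
Qed.

Lemma diag_even_col k j w : 0 < k <= j -> k <= N -> 0 < t k k ->
  alive (clo N t j.+1 ++ w) -> ~~ odd (t k k).
Proof.
move=> kj kN tk; have [s ->] := clo_prefix kj; have k0 : 0 < k by lia.
have kN' : 0 < k <= N by lia.
rewrite clo_rec // (colt_split kN' tk) -!catA catA => al.
apply: (alive_front tk _ _ al); first by rewrite all_cat posw_colsw posw_vals.
rewrite all_cat; apply/andP; split.
  apply: all_clo => i l ? ? tl0; rewrite /far; have := sh_dom st tl0 => ?.
  by have := @sh_dist t i l k k st; lia.
by apply: all_colD => l ? tl0; have := sh_dom st tl0; lia.
Qed.

(** Here row [i] is the last one.  Unless [t i i.+1] commutes with the diagonal
    entry [d] read before it, the word starts with [d, d+1, d], up to commuting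
    letters, and kills [N_Theta]. *)
Lemma above_diag_even i a : 0 < i <= N -> i < N -> 0 < t i i.+1 -> t i.+1 i.+1 = 0 ->
  (a = t i i \/ (t i i).+1 < t i i.+1) ->
  alive (Wrow N t i a) -> ~~ odd (t i i.+1).
Proof.
move=> iN iN' tb t0 ca al.
have dd := @sh_dist t i i i i.+1 st tb; have td : 0 < t i i by lia.
have od := diag_even_row iN td al.
have rh : rhi N t i = [::].
  rewrite /rhi; apply: flatten_nil => k; rewrite mem_rev mem_iota => ?.
  apply: vals_nil => l _; case: (posnP (t k l)) => // tl.
  by have := sh_dom st tl; have := @sh_dist t i.+1 i.+1 k l st tl; lia.
have rl : rowL t i i = [::].
  apply: vals_nil => l; rewrite mem_iota => ?; case: (posnP (t i l)) => // tl.
  by have := sh_dom st tl; lia.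
have E : Wrow N t i a = [:: t i i, t i i.+1 & rowR N t i i.+1 ++ a :: rlo N t i].
  by rewrite /Wrow rh (rowt_split iN td) rl rowR_rec.
rewrite E in al.
have [ne|bd] : (t i i).+1 < t i i.+1 \/ t i i.+1 = (t i i).+1 by lia.
  by apply: (@alive_front [:: t i i] _ _ tb _ _ al) => //=; rewrite ?td // /far; lia.
case: ca => [ca|]; last by lia.
exfalso; apply: al; rewrite ca bd -[LHS]/(act ([:: t i i; (t i i).+1] ++ rowR N t i i.+1 ++ t i i :: rlo N t i) (Some FTheta)).
have R : heq (rowR N t i i.+1 ++ t i i :: rlo N t i) (t i i :: rowR N t i i.+1 ++ rlo N t i).
  apply: heq_comm_r => //; first exact: posw_vals.
  apply: all_rowR => l ? tl0; rewrite /far.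
  by have := @sh_dist t i i.+1 i l st; lia.
by rewrite (heq_catl [:: t i i; (t i i).+1] R); apply: dead_aba.
Qed.

Lemma Wrow_below_diag i a : 0 < i <= N -> 0 < t i i -> 0 < a -> a.+1 < t i i ->
  alive (Wrow N t i a) -> ~~ odd a.
Proof.
move=> iN ti a0 ai; rewrite /Wrow catA => al.
apply: (alive_front a0 _ _ al); first by rewrite all_cat posw_rowsw posw_vals.
rewrite all_cat; apply/andP; split.
  apply: all_rhi => k l ? ? tl0; rewrite /far; have := sh_dom st tl0 => ?.
  by have := @sh_dist t i i k l st; lia.
apply: all_vals => l; rewrite mem_iota => ? tl0; have := sh_dom st tl0.
by rewrite /far; have := @sh_dist t i i i l st; lia.
Qed.

(** Were [a] the successor of the diagonal entry [e] above, then [e] would be odd.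
    But the letters [a, e, a] braid into [e, a, e], whose first letter can be
    moved to the front, so [e] is even. *)
Lemma Wrow_diag_gap i a : 1 < i <= N -> 0 < t i i -> a = t i.-1 i -> 0 < a -> ~~ odd a ->
  a.+1 < t i i -> alive (Wrow N t i a) -> (t i.-1 i.-1).+2 <= a.
Proof.
move=> iN ti aE a0 oa ai al.
have := @sh_dist t i.-1 i.-1 i.-1 i st => d.
have e0 : 0 < t i.-1 i.-1 by lia.
have [//|lt] := ltnP (t i.-1 i.-1).+1 a.
have ea : a = (t i.-1 i.-1).+1 by lia.
suff : ~~ odd (t i.-1 i.-1) by lia.
have iN' : 0 < i.-1 <= N by lia.
have rl : rowL t i.-1 i.-1 = [::].
  apply: vals_nil => l; rewrite mem_iota => ?; case: (posnP (t i.-1 l)) => // tl.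
  by have := sh_dom st tl; lia.
move: al; rewrite /Wrow -[i in rlo N t i](prednK (n := i)); last by lia.
rewrite rlo_rec; last by lia.
rewrite (rowt_split iN' e0) rl rowR_rec ?(prednK (n := i)) -?aE; try lia.
rewrite /= catA => al.
have lt' : t i.-1 i.-1 < a by lia.
have := alive_heq (heq_catl _ (heq_sym (heq_aba _ e0 lt'))) al.
apply: (alive_front e0); first by rewrite all_cat posw_rowsw posw_vals.
rewrite all_cat; apply/andP; split.
  apply: all_rhi => k l ? ? tl0; rewrite /far; have := sh_dom st tl0 => ?.
  by have := @sh_dist t i i k l st; lia.
apply: all_vals => l; rewrite mem_iota => ? tl0; have := sh_dom st tl0.
by rewrite /far; have := @sh_dist t i i i l st; lia.
Qed.

Lemma Wcol_above_diag j b : 0 < j <= N -> 0 < t j j -> (t j j).+1 < b ->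
  alive (Wcol N t j.+1 b) -> ~~ odd b.
Proof.
move=> jN tj bj; have b0 : 0 < b by lia.
rewrite /Wcol => al; apply: (alive_front b0 _ _ al); first exact: posw_colsw.
apply: all_clo => i l ? ? tl0; rewrite /far; have := sh_dom st tl0 => ?.
by have := @sh_dist t i l j j st; lia.
Qed.

End Parity.

(** * Every admissible state has matched transitions *)

(** Weak admissibility bounds from above the entry over the box where [a] lands,
    so that a failure of the bumped tableau to increase is an equality with one of
    the two neighbours; the parity conditions on the diagonal come from the reading
    word. *)
Lemma exists_fwd_row (T : tableau) (i a : nat) :
  adm (RowOuter T i a) -> alive (hword (RowOuter T i a)) ->
  exists r p V, link (RowOuter T i a) r p V.
Proof.
case=> ok ib a0 wa wd al; have st := ok.2.
set N := rows (domf T) + cols (domf T) + i + 5.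
have alN : alive (Wrow N (entry T) i a).
  by rewrite -hword_Row //; [exact: ok.1|lia|lia|lia].
case: (leastP i (cols (domf T)) (fun x => a < entry T i x)) =>
    [[x [_ ix ax min]]|[_ none]]; last first.
  have none' y : i <= y -> entry T i y <= a.
    move=> iy; case: (leqP y (cols (domf T))) => yc; last by rewrite entry_cols.
    by have := none y; lia.
  case: (leastP i (i + cols (domf T)) (fun j => entry T i j == 0)) =>
      [[j [_ ij /eqP t0 min]]|[_ /(_ (i + cols (domf T)))]]; last first.
    by rewrite entry_cols //; lia.
  have l : i < j -> 0 < entry T i j.-1 <= a.
    by move=> lt; have := none' j.-1; have := min j.-1; lia.
  have u : 1 < i -> 0 < entry T i.-1 j <= a.
    case: wa => [->|[y /and3P[iy uy ry]]] // i1.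
    have jy : j <= y by have := min y; have := none' y; lia.
    by have := @sh_dist _ i.-1 j i.-1 y st; lia.
  have r0 : entry T i j.+1 = 0.
    by have := @sh_dist _ i j i j.+1 st; lia.
  have d0 : entry T i.+1 j = 0.
    by have := @sh_dom _ st i.+1 j; have := @sh_dist _ i j i.+1 j st; lia.
  have [/andP[c1 c2]|c] := boolP (((i < j) ==> (entry T i j.-1 < a)) && ((1 < i) ==> (entry T i.-1 j < a))).
    exists R1, (i, j), (Terminal T.[(i, j) <- a]); apply: LR1 => //.
    apply: okT_set => //; apply: sh_upd => //; try lia; by left.
  have lt : i < j.
    by have [E|] := eqVneq i j; [subst j|]; lia.
  have z1 : i = 1 -> entry T i.-1 j = 0.
    by have := @sh_dom _ st i.-1 j; lia.
  by exists R2, (i, j), (Terminal T); apply: LR2 => //; lia.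
have tx : 0 < entry T i x by lia.
have l : i < x -> 0 < entry T i x.-1 <= a.
  by move=> lt; have := @sh_dist _ i x.-1 i x st; have := min x.-1; lia.
have u : 1 < i -> 0 < entry T i.-1 x <= a.
  case: wa => [->|[y /and3P[iy uy ry]]] // i1.
  have xy : x <= y.
    by have := min y; have := @sh_dist _ i y i x st; lia.
  by have := @sh_dist _ i.-1 x i.-1 y st; lia.
have r0 : entry T i x.+1 = 0 \/ a < entry T i x.+1.
  by have := @sh_row _ st i x; lia.
have d0 : entry T i.+1 x = 0 \/ a < entry T i.+1 x.
  by have := @sh_col _ st i x; lia.
have okT' : (i < x -> entry T i x.-1 < a) -> (1 < i -> entry T i.-1 x < a) ->
    okT T.[(i, x) <- a].
  by move=> c1 c2; apply: okT_set => //; apply: sh_upd => //; lia.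
have iN : 0 < i <= N by lia.
have z1 : i = 1 -> entry T i.-1 x = 0 by have := @sh_dom _ st i.-1 x; lia.
have td : 0 < entry T i i by have := @sh_dist _ i i i x st; lia.
have od := diag_even_row st iN td alN.
case: (ltnP i x) => lt; last first.
  have E : x = i by lia.
  subst x; clear l lt; set b := entry T i i in ax tx od td *.
  have [oa|oa] := boolP (odd a).
    have ab : a = b.-1.
      case: (ltnP a.+1 b) => ab; last by lia.
      by have := Wrow_below_diag st iN td a0 ab alN; rewrite oa.
    exists D4, (i, i), (ColOuter T i.+1 b.+1); rewrite ab; exact: LD4.
  have [c|c] := boolP ((1 < i) && (entry T i.-1 i == a)).
    exists D2, (i, i), (ColOuter T i.+1 b); apply: LD2 => //; try lia.
    by apply: (Wrow_diag_gap st _ td _ a0 oa _ alN); rewrite -/b; lia.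
  exists D3, (i, i), (ColOuter T.[(i, i) <- a] i.+1 b); apply: LD3 => //; try lia.
  by apply: okT'; lia.
have [/andP[c1 c2]|c] := boolP ((entry T i x.-1 < a) && ((1 < i) ==> (entry T i.-1 x < a))).
  exists R4, (i, x), (RowOuter T.[(i, x) <- a] i.+1 (entry T i x)).
  by apply: LR4 => //; [apply: okT'|..]; lia.
have aE : a = maxn (entry T i x.-1) (entry T i.-1 x).
  by lia.
have [c'|c'] := boolP ((i.+1 < x) || (0 < entry T i.+1 i.+1)).
  by exists R3, (i, x), (RowOuter T i.+1 (entry T i x)); apply: LR3 => //; lia.
have E : x = i.+1 by lia.
subst x; exists D1, (i, i.+1), (ColOuter T i.+1 (entry T i i.+1)).
apply: LD1 => //; try lia.
by apply: (above_diag_even st iN _ tx _ _ alN); rewrite /= in aE *; lia.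
Qed.

(** By the last clause of admissibility, an equality with the left neighbour only
    occurs below row 1; this gives C2 and C3 their labels below row 1. *)
Lemma exists_fwd_col (T : tableau) (j a : nat) :
  adm (ColOuter T j a) ->
  exists r p V, link (ColOuter T j a) r p V.
Proof.
case=> -[ok a0] jb wa wc wx; have st := ok.2.
case: (leastP 1 (rows (domf T)) (fun x => a < entry T x j)) =>
    [[x [_ x1 ax min]]|[_ none]]; last first.
  have none' y : 0 < y -> entry T y j <= a.
    move=> iy; case: (leqP y (rows (domf T))) => yc; last by rewrite entry_rows.
    by have := none y; lia.
  case: (leastP 1 (rows (domf T)).+1 (fun i => entry T i j == 0)) =>
      [[i [_ i1 /eqP t0 min]]|[_ /(_ (rows (domf T)).+1)]]; last first.
    by rewrite entry_rows //; lia.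
  have u : 1 < i -> 0 < entry T i.-1 j <= a.
    by move=> lt; have := none' i.-1; have := min i.-1; lia.
  have r0 : i <= j -> entry T i j.+1 = 0.
    by have := @sh_dist _ i j i j.+1 st; lia.
  have d0 : entry T i.+1 j = 0.
    by have := @sh_dom _ st i.+1 j; have := @sh_dist _ i j i.+1 j st; lia.
  case: wa => [wa|[y /and4P[y0 yj ly ry]]].
    have dj := @sh_dom _ st j.-1 j.
    have lj : entry T j j.-1 = 0 by have := @sh_dom _ st j j.-1; lia.
    have tj : entry T j j = 0.
      by have := @sh_col _ st j.-1 j; have := none' j; rewrite (_ : j.-1.+1 = j); lia.
    have E : i = j.
      have : i <= j by have := min j; lia.
      have : j.-1 < i by have := @sh_dist _ i j j.-1 j st; lia.
      lia.
    subst i; exists C2, (j, j), (Terminal T); apply: LC2 => //; lia.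
  have iy : i <= y by have := min y; have := none' y; lia.
  have l : 0 < entry T i j.-1 <= a.
    by have := @sh_dist _ i j.-1 y j.-1 st; have := @sh_dom _ st y j.-1; lia.
  have [/andP[c1 c2]|c] := boolP ((entry T i j.-1 < a) && ((1 < i) ==> (entry T i.-1 j < a))).
    exists C1, (i, j), (Terminal T.[(i, j) <- a]); apply: LC1 => //; try lia.
    by apply: okT_set => //; apply: sh_upd => //; lia.
  have i1' : 1 < i.
    have [E|] := eqVneq (entry T i j.-1) a; first exact: wx E.
    by lia.
  exists C2, (i, j), (Terminal T); apply: LC2 => //; lia.
have tx : 0 < entry T x j by lia.
have dx := sh_dom st tx.
have u : 1 < x -> 0 < entry T x.-1 j <= a.
  by move=> lt; have := @sh_dist _ x.-1 j x j st; have := min x.-1; lia.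
case: wa => [wa|[y /and4P[y0 yj ly ry]]].
  have dj := @sh_dom _ st j.-1 j.
  have lj : entry T j j.-1 = 0 by have := @sh_dom _ st j j.-1; lia.
  have E : x = j by have := @sh_dist _ x j j.-1 j st; lia.
  subst x; exists C3, (j, j), (ColOuter T j.+1 (entry T j j)); apply: LC3 => //; lia.
have xy : x <= y by have := min y; have := @sh_dist _ y j x j st; lia.
have l : 0 < entry T x j.-1 <= a.
  by have := @sh_dist _ x j.-1 y j.-1 st; have := @sh_dom _ st y j.-1; lia.
have [/andP[c1 c2]|c] := boolP ((entry T x j.-1 < a) && ((1 < x) ==> (entry T x.-1 j < a))).
  exists C4, (x, j), (ColOuter T.[(x, j) <- a] j.+1 (entry T x j)); apply: LC4 => //; try lia.
  apply: okT_set => //; apply: sh_upd => //; try lia.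
    by have := @sh_row _ st x j; lia.
  by have := @sh_col _ st x j; lia.
have x1' : 1 < x.
  have [E|] := eqVneq (entry T x j.-1) a; first exact: wx E.
  by lia.
by exists C3, (x, j), (ColOuter T j.+1 (entry T x j)); apply: LC3 => //; lia.
Qed.

(** The value [b] was bumped from the last box [(i, x)] of row [i] with an entry at
    most [b]: equality means that the box was left unchanged. *)
Lemma exists_inv_row (T : tableau) (i b : nat) : 0 < i ->
  adm (RowOuter T i.+1 b) -> exists U r p, link U r p (RowOuter T i.+1 b).
Proof.
move=> i0 [ok ib b0 wa wd]; have st := ok.2; rewrite /= in wa wd.
case: wa => [|[y /and3P[iy uy ry]]]; first by lia.
case: (leastP y.+1 (y + cols (domf T)).+1 (fun z => (entry T i z == 0) || (b < entry T i z))) =>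
    [[z [_ yz zb min]]|[_ /(_ (y + cols (domf T)).+1)]]; last first.
  by rewrite (@entry_cols _ i) //; lia.
have [x xE] : exists x, z = x.+1 by exists z.-1; lia.
subst z; have yx : y <= x by lia.
have xb : 0 < entry T i x <= b.
  by have [->//|ne] := eqVneq x y; have := min x; lia.
have dn : entry T i.+1 x = 0 \/ b < entry T i.+1 x.
  by have := @sh_dist _ i.+1 y i.+1 x st; lia.
have l : 0 < entry T i x.-1 < entry T i x.
  by have := @sh_dist _ i x.-1 i x st; lia.
have u : 1 < i -> 0 < entry T i.-1 x < entry T i x.
  by have := @sh_dist _ i.-1 x i x st; lia.
have z0 : i = 1 -> entry T i.-1 x = 0 by have := @sh_dom _ st i.-1 x; lia.
have [E|ne] := eqVneq (entry T i x) b.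
  exists (RowOuter T i (maxn (entry T i x.-1) (entry T i.-1 x))), R3, (i, x).
  apply: LR3 => //; try lia.
  by have [Ex|] := eqVneq x i.+1; [subst x; have := wd E|]; lia.
have ok' : okT T.[(i, x) <- b] by apply: okT_set => //; apply: sh_upd => //; lia.
exists (RowOuter T.[(i, x) <- b] i (entry T i x)), R4, (i, x).
have sb : T.[(i, x) <- b].[(i, x) <- entry T i x] = T by apply: set_back => //; lia.
have := @LR4 T.[(i, x) <- b] i x (entry T i x) b; rewrite sb; apply => //; try lia.
by rewrite entry_setE upd_eq.
Qed.

(** If the diagonal entry of column [j] is at most [b], the path turned there or
    passed through the diagonal box, and the parities of [b] and of the entry above
    the diagonal tell the rules apart. *)
Lemma exists_inv_col (T : tableau) (j b : nat) :
  adm (ColOuter T j.+1 b) -> alive (hword (ColOuter T j.+1 b)) ->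
  exists U r p, link U r p (ColOuter T j.+1 b).
Proof.
case=> -[ok b0] jb wa wc wx al; have st := ok.2; rewrite /= in wa wc wx.
set N := rows (domf T) + cols (domf T) + j + 5.
have alN : alive (Wcol N (entry T) j.+1 b).
  by rewrite -hword_Col //; [exact: ok.1|lia|lia|lia].
have j0 : 0 < j by case: wa => [E|[y]]; [have := @sh_dom _ st j j.+1|]; lia.
have jN : 0 < j <= N by lia.
have l0 : entry T j j.-1 = 0 by have := @sh_dom _ st j j.-1; lia.
have z0 k : j = 1 -> entry T j.-1 k = 0 by have := @sh_dom _ st j.-1 k; lia.
have u0 : 1 < j -> 0 < entry T j j -> 0 < entry T j.-1 j < entry T j j.
  by have := @sh_dist _ j.-1 j j j st; lia.
have dn0 : entry T j.+1 j = 0 by have := @sh_dom _ st j.+1 j; lia.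
have [tjb|tjb] := boolP (0 < entry T j j <= b).
  have tj : 0 < entry T j j by lia.
  have oj := diag_even_col (N := N) st (k := j) (j := j) ltac:(lia) ltac:(lia) tj alN.
  have [E|ne] := eqVneq (entry T j j) b.
    have j1 := wx j E; have u := u0 j1 tj.
    have [oa|oa] := boolP (odd (entry T j.-1 j)).
      exists (ColOuter T j (entry T j.-1 j)), C3, (j, j).
      by apply: LC3 => //; lia.
    exists (RowOuter T j (entry T j.-1 j)), D2, (j, j).
    apply: LD2 => //; try lia.
    have dd := @sh_dist _ j.-1 j.-1 j.-1 j st.
    have td : 0 < entry T j.-1 j.-1 by lia.
    by have := diag_even_col (N := N) st (k := j.-1) (j := j) ltac:(lia) ltac:(lia) td alN; lia.
  have [ob|ob] := boolP (odd b).
    have bE : b = (entry T j j).+1.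
      case: (ltnP (entry T j j).+1 b) => bj; last by lia.
      by have := Wcol_above_diag st jN tj bj alN; lia.
    exists (RowOuter T j (entry T j j).-1), D4, (j, j); rewrite bE.
    by apply: LD4.
  have [E|nE] := eqVneq (entry T j j.+1) b.
    have u1 : 1 < j -> 0 < entry T j.-1 j.+1 by have := @sh_dist _ j.-1 j.+1 j j.+1 st; lia.
    exists (RowOuter T j (maxn (entry T j j) (entry T j.-1 j.+1))), D1, (j, j.+1).
    by apply: LD1 => //; have := wc E; lia.
  have r : entry T j j.+1 = 0 \/ b < entry T j j.+1.
    case: wa => [|[y /and4P[y0 yj ly ry]]]; first by lia.
    by have := @sh_dist _ y j.+1 j j.+1 st; lia.
  have ok' : okT T.[(j, j) <- b] by apply: okT_set => //; apply: sh_upd => //; lia.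
  exists (RowOuter T.[(j, j) <- b] j (entry T j j)), D3, (j, j).
  have sb : T.[(j, j) <- b].[(j, j) <- entry T j j] = T by apply: set_back => //; lia.
  have := @LD3 T.[(j, j) <- b] j (entry T j j) b; rewrite sb; apply => //; try lia.
  by rewrite entry_setE upd_eq.
case: wa => [E|[y /and4P[y0 yj ly ry]]].
  by have := @sh_dist _ j j j j.+1 st; lia.
have yj' : y < j by have [E|] := eqVneq y j; [subst y|]; lia.
case: (leastP y.+1 j (fun z => (entry T z j == 0) || (b < entry T z j))) =>
    [[z [_ yz zb min]]|[_ /(_ j)]]; last by lia.
have [x xE] : exists x, z = x.+1 by exists z.-1; lia.
subst z; have yx : y <= x by lia.
have xb : 0 < entry T x j <= b.
  by have [->//|ne] := eqVneq x y; have := min x; lia.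
have r : entry T x j.+1 = 0 \/ b < entry T x j.+1.
  by have := @sh_dist _ y j.+1 x j.+1 st; lia.
have l : 0 < entry T x j.-1 < entry T x j.
  by have := @sh_dist _ x j.-1 x j st; lia.
have u : 1 < x -> 0 < entry T x.-1 j < entry T x j.
  by have := @sh_dist _ x.-1 j x j st; lia.
have [E|ne] := eqVneq (entry T x j) b.
  have x1 := wx x E.
  exists (ColOuter T j (maxn (entry T x.-1 j) (entry T x j.-1))), C3, (x, j).
  by apply: LC3 => //; lia.
have ok' : okT T.[(x, j) <- b] by apply: okT_set => //; apply: sh_upd => //; lia.
exists (ColOuter T.[(x, j) <- b] j (entry T x j)), C4, (x, j).
have sb : T.[(x, j) <- b].[(x, j) <- entry T x j] = T by apply: set_back => //; lia.
have := @LC4 T.[(x, j) <- b] x j (entry T x j) b; rewrite sb; apply => //; try lia.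
by rewrite entry_setE upd_eq.
Qed.

Section Corners.
Variables (V : tableau) (i j : nat).
Hypothesis ok : okT V.

Lemma sh_rem : 0 < entry V i j -> entry V i j.+1 = 0 -> entry V i.+1 j = 0 ->
  okT V.[~ (i, j)].
Proof.
move=> t0 r d; have st := ok.2; split; first exact: positive_rem ok.1.
have -> : entry V.[~ (i, j)] = upd (entry V) i j 0.
  by apply/funext => k; apply/funext => l; rewrite entry_rem.
split.
- by move=> k m; rewrite /upd; case: ifP => // _; exact: sh_dom.
- move=> k m km; rewrite /upd; case: ifP => // n1 tk.
  have tk' := sh_row st km tk.
  by rewrite ifF //; apply/negP => /andP[/eqP ek /eqP em]; subst; lia.
- move=> k m k0; rewrite /upd; case: ifP => // n1 tk.
  have tk' := sh_col st k0 tk.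
  by rewrite ifF //; apply/negP => /andP[/eqP ek /eqP em]; subst; lia.
Qed.

Lemma rem_set : 0 < entry V i j -> V.[~ (i, j)].[(i, j) <- entry V i j] = V.
Proof.
move=> t0; apply/fmapP => p; rewrite fnd_set fnd_rem1; case: (eqVneq p (i, j)) => //= ->.
by apply/esym/fnd_entry.
Qed.

Lemma link_inner_row : inner_corner (domf V) i j ->
  exists U, link U R1 (i, j) (Terminal V).
Proof.
rewrite inner_cornerE // => /and3P[t0 /eqP r /eqP d].
have ok' := sh_rem t0 r d.
exists (RowOuter V.[~ (i, j)] i (entry V i j)).
have := @LR1 V.[~ (i, j)] i j (entry V i j); rewrite rem_set //; apply=> //.
by rewrite entry_rem upd_eq.
Qed.

Lemma link_inner_col : inner_corner (domf V) i j -> i < j ->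
  exists U, link U C1 (i, j) (Terminal V).
Proof.
rewrite inner_cornerE // => /and3P[t0 /eqP r /eqP d] ij.
have ok' := sh_rem t0 r d.
exists (ColOuter V.[~ (i, j)] j (entry V i j)).
have := @LC1 V.[~ (i, j)] i j (entry V i j); rewrite rem_set //; apply=> //.
by rewrite entry_rem upd_eq.
Qed.

Lemma link_outer_row : outer_corner (domf V) i j -> 0 < i < j ->
  exists U, link U R2 (i, j) (Terminal V).
Proof.
rewrite outer_cornerE // => /and3P[/eqP t0 l u] ij.
exists (RowOuter V i (maxn (entry V i j.-1) (entry V i.-1 j))).
by apply: LR2 => //; lia.
Qed.

Lemma link_outer_col : outer_corner (domf V) i j -> 1 < i ->
  exists U, link U C2 (i, j) (Terminal V).
Proof.
rewrite outer_cornerE // => /and3P[/eqP t0 l u] i1.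
have d := @sh_dom _ ok.2 i j.-1.
exists (ColOuter V j (maxn (entry V i.-1 j) (entry V i j.-1))).
by apply: LC2 => //; lia.
Qed.

End Corners.

(** * Insertion paths *)

Definition terminal (U : state) : bool := if U is Terminal _ then true else false.

(** Equivalent to admissibility, by [admissibleE]. *)
Definition Adm (U : state) : Prop := adm U /\ alive (hword U).

Lemma exists_fwd U : Adm U -> ~~ terminal U -> exists r p V, link U r p V.
Proof.
case: U => [T|T i a|T j a] // [ad al] _; first exact: exists_fwd_row.
exact: exists_fwd_col.
Qed.

Definition initial (U : state) : bool := if U is RowOuter _ 1 _ then true else false.

Lemma exists_inv V : Adm V -> ~~ terminal V -> ~~ initial V -> exists U r p, link U r p V.
Proof.
case: V => [T|T [|[|i]] a|T [|j] a] // [ad al] _ _.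
- by case: ad.
- exact: exists_inv_row.
- by case: ad.
- exact: exists_inv_col.
Qed.

Lemma link_Adm U r p V : link U r p V -> Adm U <-> Adm V.
Proof.
by move=> lk; have [adU adV] := link_adm lk; rewrite /Adm /alive (link_word lk); split=> -[].
Qed.

Lemma link_source U r p V : link U r p V -> ~~ terminal U.
Proof. by case. Qed.

Lemma link_target U r p V : link U r p V -> ~~ initial V.
Proof. by case=> //= T [|i] x a b. Qed.

Definition sdom (U : state) : {fset box} :=
  domf (match U with Terminal T => T | RowOuter T _ _ => T | ColOuter T _ _ => T end).

Definition dims (U : state) : nat * nat := (rows (sdom U), cols (sdom U)).

(** The outer box moves down through the rows and, after turning at the diagonal,
    to the right through the columns, at most one past the shape. *)
Definition fwd_bound (U : state) : nat :=
  match U with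
  | Terminal _ => 0
  | RowOuter _ i _ => (dims U).1 + (dims U).2 + 3 - i
  | ColOuter _ j _ => (dims U).2 + 2 - j
  end.
Definition inv_bound (U : state) : nat :=
  match U with Terminal _ => 0 | RowOuter _ i _ => i.-1 | ColOuter _ j _ => j.-1 end.

Lemma link_bounds U r p V : link U r p V -> ~~ terminal V ->
  fwd_bound V < fwd_bound U /\ inv_bound U < inv_bound V.
Proof.
move=> lk nV; have [adU adV] := link_adm lk; move: lk adU adV nV; rewrite /fwd_bound /dims /sdom; case=> //=.
- by move=> T i x a b ok ix bE b0 aE c [_ ? _ _ _] _ _; split; lia.
- move=> T i x a b ok ok' ix bE ab [_ ? _ _ _] _ _.
  rewrite mem_fset1U; first by split; lia.
  by rewrite -(entry_gt0 ok.1) -bE; lia.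
- by move=> T i a b ok i0 bE b0 t0 aE ob ot [_ ? _ _ _] _ _; split; lia.
- by move=> T i a b ok i1 aE bE b0 oa ob ta [_ ? _ _ _] _ _; split; lia.
- move=> T i a b ok ok' bE ab oa ob [_ ? _ _ _] _ _.
  rewrite mem_fset1U; first by split; lia.
  by rewrite -(entry_gt0 ok.1) -bE; lia.
- by move=> T i b ok bE b0 ob [_ ? _ _ _] _ _; split; lia.
- by move=> T x j a b ok xj bE b0 aE c [_ ? _ _ _] _ _; split; lia.
- move=> T x j a b ok ok' xj bE ab [_ ? _ _ _] _ _.
  rewrite mem_fset1U; first by split; lia.
  by rewrite -(entry_gt0 ok.1) -bE; lia.
Qed.

Lemma link_sdom U r p V : link U r p V -> ~~ terminal V -> sdom U = sdom V.
Proof.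
case=> //.
- move=> T i x a b ok ok' ix bE ab _; rewrite /sdom /= mem_fset1U //.
  by rewrite -(entry_gt0 ok.1) -bE; lia.
- move=> T i a b ok ok' bE ab oa ob _; rewrite /sdom /= mem_fset1U //.
  by rewrite -(entry_gt0 ok.1) -bE; lia.
- move=> T x j a b ok ok' xj bE ab _; rewrite /sdom /= mem_fset1U //.
  by rewrite -(entry_gt0 ok.1) -bE; lia.
Qed.

Lemma fwd_bound_pos U : Adm U -> ~~ terminal U -> 0 < fwd_bound U.
Proof.
by case: U => [T|T i a|T j a] //= [[_ ? _ _ _] _] _; rewrite /dims /sdom /=; lia.
Qed.

Lemma fwd_pathS n U r p V : fwd U = Some (r, p, V) ->
  fwd_path n.+1 U = if V is Terminal T then Some (r, p, T) else fwd_path n V.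
Proof. by move=> /= ->. Qed.

Lemma inv_pathS n U : ~~ initial U -> inv_path n.+1 U = obind (inv_path n) (Defs.inv U).
Proof. by case: U => [T|T [|[|i]] a|T j a]. Qed.

Lemma fwd_path_mono k n U x : fwd_path k U = Some x -> k <= n -> fwd_path n U = Some x.
Proof.
elim: k n U => [|k IH] [|n] U //=; case: (fwd U) => [[[r p] [T|T i a|T j a]]|] //; exact: IH.
Qed.

Lemma inv_path_mono k n U x : inv_path k U = Some x -> k <= n -> inv_path n U = Some x.
Proof.
elim: k n U => [|k IH] n U; first by case: U n => [T|T [|[|i]] a|T j a] [|n].
case: n => [|n] //; have [|iU] := boolP (initial U).
  by case: U => [T|T [|[|i]] a|T j a].
rewrite !inv_pathS //; case: (Defs.inv U) => [W|] //=; exact: IH.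
Qed.

(** The inverse path out of [U] is carried along: each forward step prolongs it,
    until it starts at the predecessor of the terminal state. *)
Lemma fwd_path_complete n U x k : Adm U -> ~~ terminal U -> fwd_bound U <= n ->
    inv_path k U = Some x ->
  exists r p T W, [/\ fwd_path n U = Some (r, p, T), link W r p (Terminal T),
    exists k', inv_path k' W = Some x, Adm (Terminal T) /\ sdom U = sdom W &
    act (hword U) (Some FTheta) = act (row_word T) (Some FTheta)].
Proof.
elim: n U k => [|n IH] U k AU nU Un ix.
  by have := fwd_bound_pos AU nU; lia.
have [r [p [V lk]]] := exists_fwd AU nU.
have AV := (link_Adm lk).1 AU.
have fE := fwd_pathS n (link_fwd lk).
have [tV|tV] := boolP (terminal V).
  case: V tV lk AV fE => // T _ lk AV fE.
  exists r, p, T, U; split=> //; first by exists k.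
  by rewrite (link_word lk).
have [b1 b2] := link_bounds lk tV.
have iE : inv_path k.+1 V = Some x.
  have u := link_inv lk AV.2.
  rewrite inv_pathS ?(link_target lk) //.
  by case: (V) tV u => //= [T i a|T j a] _ ->.
have [|r' [p' [T [W [fT lW ex [AT dT] wT]]]]] := IH V k.+1 AV tV _ iE; first by lia.
exists r', p', T, W; split=> //; last by rewrite (link_word lk).
  by rewrite fE; case: (V) tV fT.
by rewrite (link_sdom lk).
Qed.

Lemma inv_path_complete n V : Adm V -> ~~ terminal V -> inv_bound V <= n ->
  exists T a, [/\ inv_path n V = Some (T, a), Adm (RowOuter T 1 a) /\ sdom V = domf T,
    act (hword V) (Some FTheta) = act (hword (RowOuter T 1 a)) (Some FTheta) &
    forall k x, fwd_path k V = Some x -> exists k', fwd_path k' (RowOuter T 1 a) = Some x].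
Proof.
elim: n V => [|n IH] V AV nV Vn; have [iV|iV] := boolP (initial V).
- case: V iV AV nV Vn => [T|T [|[|i]] a|T j a] // _ AV _ _.
  by exists T, a; split=> //; move=> k x ?; exists k.
- have [U [r [p lk]]] := exists_inv AV nV iV.
  by have [] := link_bounds lk nV; lia.
- case: V iV AV nV Vn => [T|T [|[|i]] a|T j a] // _ AV _ _.
  by exists T, a; split=> //; move=> k x ?; exists k.
have [U [r [p lk]]] := exists_inv AV nV iV.
have [b1 b2] := link_bounds lk nV.
have AU := (link_Adm lk).2 AV.
have [|T [a [iT [A1 dT] wT fT]]] := IH U AU (link_source lk); first by lia.
exists T, a; split=> //.
- have u := link_inv lk AV.2; rewrite inv_pathS //.
  by case: (V) nV u => //= [T' i b|T' j b] _ ->.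
- by rewrite -(link_sdom lk).
- by rewrite -(link_word lk).
- move=> k x kx; apply: (fT k.+1).
  by rewrite (fwd_pathS k (link_fwd lk)); case: (V) nV kx.
Qed.

Lemma hword_initial T a : okT T -> 0 < a -> hword (RowOuter T 1 a) = row_word T ++ [:: a].
Proof.
move=> ok a0; set N := rows (domf T) + cols (domf T) + 5.
rewrite (@hword_Row N) ?(@row_wordE N); try lia; try exact: ok.1.
by rewrite (@rword_split _ _ 1) /Wrow /rlo /= ?cats0 -?catA //; lia.
Qed.

Lemma adm_initial T a : okT T -> 0 < a -> adm (RowOuter T 1 a).
Proof.
move=> ok a0; split=> //; first by left.
by move=> /= E; have := @sh_dom _ ok.2 0 1; lia.
Qed.

Lemma link_terminal_bound U r p T : link U r p (Terminal T) ->
  inv_bound U <= rows (domf T) + cols (domf T) + 2.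
Proof.
move=> lk; have [adU _] := link_adm lk.
have sub (T0 : tableau) q (a : nat) : rows (domf T0) <= rows (domf T0.[q <- a]) /\
    cols (domf T0) <= cols (domf T0.[q <- a]).
  by split; [apply: rows_le => q'|apply: cols_le => q'] => q'T;
    [apply: rows_ge|apply: cols_ge]; rewrite dom_setf in_fset1U q'T orbT.
move: adU; move E : (Terminal T) lk => V lk; case: lk E => //.
- move=> T0 i j a _ _ _ _ [->] [_ ? _ _ _] /=.
  by have [] := sub T0 (i, j) a; rewrite /=; lia.
- by move=> T0 i j a _ _ _ _ _ _ [->] [_ ? _ _ _] /=; lia.
- move=> T0 i j a _ _ _ _ _ [->] [_ ? _ _ _] /=.
  by have [] := sub T0 (i, j) a; rewrite /=; lia.
- by move=> T0 i j a _ _ _ _ _ _ [->] [_ ? _ _ _] /=; lia.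
Qed.

(** Following the forward transitions from [T] with [a] added, every step can
    be undone, so the inverse path from the result leads back to [T] and [a]. *)
Lemma insertion_complete T a : okT T -> 0 < a -> alive (row_word T ++ [:: a]) ->
  exists r p V U, [/\ insertion T a = Some (r, p, V), link U r p (Terminal V),
    inv_path (rows (domf V) + cols (domf V) + 2) U = Some (T, a),
    Adm (Terminal V) /\ sdom U = domf T &
    act (row_word T ++ [:: a]) (Some FTheta) = act (row_word V) (Some FTheta)].
Proof.
move=> ok a0; rewrite -hword_initial // => al.
have A : Adm (RowOuter T 1 a) by split=> //; exact: adm_initial.
have [|r [p [V [U [fV lU [k ik] [AV dV] wV]]]]] :=
  @fwd_path_complete (rows (domf T) + cols (domf T) + 2) _ (T, a) 0 A isT _ erefl.
  by rewrite /= /dims /sdom /=; lia.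
exists r, p, V, U; split=> //.
have AU := (link_Adm lU).2 AV.
have [T' [a' [iT _ _ _]]] := inv_path_complete AU (link_source lU) (link_terminal_bound lU).
have le1 : k <= maxn k (rows (domf V) + cols (domf V) + 2) by lia.
have le2 : rows (domf V) + cols (domf V) + 2 <= maxn k (rows (domf V) + cols (domf V) + 2) by lia.
by rewrite iT -(inv_path_mono iT le2) (inv_path_mono ik le1).
Qed.

Lemma inv_path_terminal U r p V : link U r p (Terminal V) -> Adm (Terminal V) ->
  exists T a, [/\ inv_path (rows (domf V) + cols (domf V) + 2) U = Some (T, a),
    [/\ okT T, 0 < a & sdom U = domf T], alive (row_word T ++ [:: a]), insertion T a = Some (r, p, V) &
    act (row_word T ++ [:: a]) (Some FTheta) = act (row_word V) (Some FTheta)].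
Proof.
move=> lk AV; have AU := (link_Adm lk).2 AV.
have [T [a [iT [A1 dT] wT fT]]] := inv_path_complete AU (link_source lk) (link_terminal_bound lk).
have [[ok _ a0 _ _] al] := A1; rewrite hword_initial // in al wT.
exists T, a; split=> //; last by rewrite -wT (link_word lk).
have [r' [p' [V' [U' [ins _ _ _ _]]]]] := insertion_complete ok a0 al.
have f1 : fwd_path 1 U = Some (r, p, V) by rewrite (fwd_pathS 0 (link_fwd lk)).
have [k fk] := fT _ _ f1; rewrite ins; move: ins; rewrite /insertion => ins.
set n := rows _ + _ + _ in ins.
have le1 : k <= maxn k n by lia.
have le2 : n <= maxn k n by lia.
by rewrite -(fwd_path_mono ins le2) (fwd_path_mono fk le1).
Qed.

(** * Standard set-valued tableaux *)

Implicit Types Q : svtableau.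

Lemma letters_in Q p a : a \in letters_at Q p -> p \in domf Q.
Proof. by rewrite /letters_at; case: fndP => //= _; rewrite in_fset0. Qed.

Lemma fnd_letters Q p : p \in domf Q -> Q.[? p] = Some (letters_at Q p).
Proof. by move=> pD; rewrite /letters_at in_fnd. Qed.

Definition content Q : seq (box * letter) :=
  [seq (p, a) | p <- enum_fset (domf Q), a <- enum_fset (letters_at Q p)].

Lemma mem_content Q p a : ((p, a) \in content Q) = (a \in letters_at Q p).
Proof.
apply/allpairsPdep/idP => [[q [b [_ bq [-> ->]]]] //|ap].
by exists p, a; split=> //; apply: letters_in ap.
Qed.

Lemma size_content Q : size (content Q) = weight Q.
Proof.
rewrite /content size_allpairs_dep /weight sumnE big_map.
by apply: eq_bigr => p _; rewrite cardfE -cardfE.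
Qed.

Lemma uniq_content Q : uniq (content Q).
Proof.
apply: allpairs_uniq_dep => //; first exact: fset_uniq.
by move=> [p a] [q b] _ _ /= [-> ->].
Qed.

(** Standardness as statements about membership only; unlike the weight, these are
    easy to follow when the largest letter is added or removed. *)
Record Std Q (n : nat) : Prop := MkStd {
  Std_shifted : shifted (domf Q);
  Std_nonempty : forall p, p \in domf Q -> letters_at Q p != fset0;
  Std_range : forall p a, a \in letters_at Q p -> 0 < a.1 <= n;
  Std_ex : forall k, 0 < k <= n -> exists p b, (k, b) \in letters_at Q p;
  Std_uniq : forall p q a b, a \in letters_at Q p -> b \in letters_at Q q ->
    a.1 = b.1 -> p = q /\ a = b;
  Std_incr : forall p q a b, a \in letters_at Q p -> b \in letters_at Q q ->
    p != q -> p.1 <= q.1 -> p.2 <= q.2 -> letter_lt a b;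
  Std_diag : forall i k, (k, true) \notin letters_at Q (i, i) }.

Lemma appearsP a Q : reflect (exists p, a \in letters_at Q p) (appears a Q).
Proof.
apply: (iffP hasP) => [[p _ ap]|[p ap]]; exists p => //.
exact: letters_in ap.
Qed.

Lemma letters_fnd Q p E : Q.[? p] = Some E -> letters_at Q p = E.
Proof. by rewrite /letters_at => ->. Qed.

(** The [n] values 1, ..., n occur among the [n] letters of [Q], so by counting each
    of them occurs exactly once. *)
Lemma standardE Q n : standard_shifted Q /\ weight Q = n <-> Std Q n.
Proof.
pose L := [seq x.2.1 | x <- content Q].
have memL k : (k \in L) <-> exists p b, (k, b) \in letters_at Q p.
  split=> [/mapP[[p [k' b]]]|[p [b kb]]].
    by rewrite mem_content /= => kb ->; exists p, b.
  by apply/mapP; exists (p, (k, b)); rewrite ?mem_content.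
split=> [[[[[Qb Qp] Qs] Qi Qd Qx] wn]|[Qs Qn Qr Qe Qu Qi Qd]]; last first.
  have wn : weight Q = n.
    rewrite -size_content -(size_map (fun x : box * letter => x.2.1)) -/L.
    rewrite -(size_iota 1 n); apply: perm_size; apply: uniq_perm.
    - rewrite map_inj_in_uniq ?uniq_content // => -[p a] [q b].
      by rewrite !mem_content /= => ap bq ab; have [-> ->] := Qu _ _ _ _ ap bq ab.
    - exact: iota_uniq.
    - move=> k; rewrite mem_iota add1n ltnS; apply/idP/idP => [/memL[p [b kb]]|kn].
        exact: (Qr _ _ kb).
      by apply/memL; apply: Qe.
  split=> //; split.
  - split=> //; split.
      move=> [i j]; case: Qs => la _ -> /=; lia.
    move=> p E pE; have pD : p \in domf Q.
      by move: pE; case: fndP.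
    rewrite -(letters_fnd pE); split; first exact: Qn.
    by move=> a /Qr; lia.
  - move=> p q u v pu qv ne h1 h2; apply/allrelP => a b.
    by rewrite -(letters_fnd pu) -(letters_fnd qv) => ap bq; apply: Qi ap bq ne h1 h2.
  - by move=> i k; apply: Qd.
  - move=> k; rewrite wn => /Qe[p [b kb]].
    have ab : appears (k, b) Q by apply/appearsP; exists p.
    have nab : ~~ appears (k, ~~ b) Q.
      by apply/appearsP => -[q /(Qu _ _ _ _ kb)/(_ erefl)[_ []]]; case: (b).
    by case: b ab nab {kb} => /= -> /negbTE->.
have sub : {subset iota 1 n <= L}.
  move=> k; rewrite mem_iota => kn.
  have := Qx k; rewrite wn => /(_ ltac:(lia)) X; apply/memL; move: X.
  by case: appearsP => [[p kp] _|_ /appearsP[p kp]]; [exists p, false|exists p, true].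
have sz : size L <= size (iota 1 n).
  by rewrite size_map size_content wn size_iota.
have [_ eqi] := uniq_min_size (iota_uniq 1 n) sub sz.
have uL : uniq L by rewrite (leq_size_uniq (iota_uniq 1 n) sub sz).
split=> //.
- move=> p pD; have [] // := Qp p (letters_at Q p); exact: fnd_letters.
- move=> p [k b] kb; have : k \in L by apply/memL; exists p, b.
  by rewrite -eqi mem_iota /=; lia.
- by move=> k kn; apply/memL; apply: sub; rewrite mem_iota; lia.
- move=> p q a b ap bq ab.
  suff : (p, a) = (q, b) by case.
  have xP : (p, a) \in content Q by rewrite mem_content.
  have yP : (q, b) \in content Q by rewrite mem_content.
  have := uL; rewrite /L => /(uniqP 0) inj.
  rewrite -(nth_index (p, a) xP) -(nth_index (p, a) yP); congr nth.
  apply: inj; rewrite ?inE ?size_map ?index_mem //.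
  by rewrite !(nth_map (p, a)) ?index_mem // !nth_index.
- move=> p q a b ap bq ne h1 h2.
  have := Qi p q _ _ (fnd_letters (letters_in ap)) (fnd_letters (letters_in bq)) ne h1 h2.
  by move/allrelP; apply.
Qed.

Lemma sv_ext Q Q' : (forall p, p \in domf Q -> letters_at Q p != fset0) ->
  (forall p, p \in domf Q' -> letters_at Q' p != fset0) ->
  letters_at Q =1 letters_at Q' -> Q = Q'.
Proof.
move=> n n' E; apply/fmapP => p.
have mem R : (forall p, p \in domf R -> letters_at R p != fset0) ->
    (p \in domf R) = (letters_at R p != fset0).
  move=> nR; apply/idP/idP => [/nR //|/fset0Pn[a]]; exact: letters_in.
have [pD|pD] := boolP (p \in domf Q).
  have pD' : p \in domf Q' by rewrite mem // -E -mem.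
  by rewrite !fnd_letters // E.
have pD' : p \notin domf Q' by rewrite mem // -E -mem.
by rewrite !not_fnd.
Qed.

Lemma letters_add Q p a q :
  letters_at (add_letter Q p a) q = if q == p then a |` letters_at Q p else letters_at Q q.
Proof. by rewrite /letters_at fnd_set; case: ifP. Qed.

Lemma domf_add Q p a : domf (add_letter Q p a) = p |` domf Q.
Proof. exact: dom_setf. Qed.

Section MaxLetter.
Variables (Q : svtableau) (n : nat) (p : box) (b : bool).
Hypotheses (SQ : Std Q n.+1) (pb : (n.+1, b) \in letters_at Q p).

Lemma weight_Std : weight Q = n.+1.
Proof. by have [] := (standardE Q n.+1).2 SQ. Qed.

Lemma max_boxE : max_box Q = Some p.
Proof.
rewrite /max_box weight_Std.
set s := [seq q <- _ | _].
have sp q : q \in s -> q = p.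
  rewrite mem_filter => /andP[/orP[qa|qa] _].
    by have [] := Std_uniq SQ qa pb erefl.
  by have [] := Std_uniq SQ qa pb erefl.
have ps : p \in s.
  rewrite mem_filter; apply/andP; split; last exact: (letters_in pb).
  by case: (b) pb => ->; rewrite ?orbT.
by case: s sp ps => //= q s sp _; rewrite (sp q) // mem_head.
Qed.

Let E := letters_at Q p `\ (n.+1, false) `\ (n.+1, true).

Lemma letters_remove q :
  letters_at (remove_max Q) q = if q == p then E else letters_at Q q.
Proof.
rewrite /remove_max max_boxE weight_Std -/E /letters_at.
case: eqP => [E0|_]; last by rewrite fnd_set; case: ifP.
by rewrite fnd_rem1; case: (eqVneq q p) => [->|]; rewrite ?eqxx //= E0.
Qed.

Lemma mem_rest a : (a \in E) = (a \in letters_at Q p) && (a.1 != n.+1).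
Proof.
rewrite !in_fsetD1; case: a => k c; rewrite !xpair_eqE /=.
have [->|] := eqVneq k n.+1; last by rewrite /= andbT.
by case: c; rewrite /= ?andbF.
Qed.

Lemma mem_remove a q :
  (a \in letters_at (remove_max Q) q) = (a \in letters_at Q q) && (a.1 != n.+1).
Proof.
rewrite letters_remove; case: (eqVneq q p) => [->|ne]; first exact: mem_rest.
have [aq|//] := boolP (a \in letters_at Q q).
by apply/esym/eqP => ak; have [qp _] := Std_uniq SQ aq pb ak; rewrite qp eqxx in ne.
Qed.

Lemma domf_remove : domf (remove_max Q) = if E == fset0 then domf Q `\ p else domf Q.
Proof.
rewrite /remove_max max_boxE weight_Std -/E; case: ifP => _.
  by apply/fsetP => q; rewrite mem_remf1 in_fsetD1.
by rewrite dom_setf mem_fset1U // (letters_in pb).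
Qed.

Lemma nonempty_remove q : q \in domf (remove_max Q) -> letters_at (remove_max Q) q != fset0.
Proof.
rewrite letters_remove domf_remove; case: (eqVneq q p) => [->|ne].
  by case: ifP; rewrite ?in_fsetD1 ?eqxx //= => ->.
by case: ifP => _; rewrite ?in_fsetD1 ?ne; apply: (Std_nonempty SQ).
Qed.

Lemma Std_remove : shifted (domf (remove_max Q)) -> Std (remove_max Q) n.
Proof.
move=> sh; split=> //.
- exact: nonempty_remove.
- move=> q a; rewrite mem_remove => /andP[/(Std_range SQ)]; lia.
- move=> k kn; have [|q [c kc]] := Std_ex SQ (k := k); first by lia.
  by exists q, c; rewrite mem_remove kc /=; lia.
- move=> q q' a a'; rewrite !mem_remove => /andP[aq _] /andP[aq' _]; exact: Std_uniq SQ _ _ _ _ aq aq'.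
- move=> q q' a a'; rewrite !mem_remove => /andP[aq _] /andP[aq' _]; exact: Std_incr SQ _ _ _ _ aq aq'.
- by move=> i k; rewrite mem_remove negb_and (Std_diag SQ).
Qed.

Lemma remove_add : add_letter (remove_max Q) p (n.+1, b) = Q.
Proof.
apply: sv_ext.
- move=> q; rewrite domf_add in_fset1U letters_add; case: (eqVneq q p) => [_ _|ne /= qD].
    by apply/fset0Pn; exists (n.+1, b); rewrite in_fset1U eqxx.
  exact: nonempty_remove.
- exact: Std_nonempty SQ.
- move=> q; rewrite letters_add; case: (eqVneq q p) => [->|ne]; last by rewrite letters_remove (negbTE ne).
  apply/fsetP => a; rewrite in_fset1U mem_remove.
  have [->|na] := eqVneq a (n.+1, b); first by rewrite pb.
  have [ap|//] := boolP (a \in letters_at Q p).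
  apply/eqP => ak; have [_ ab] := Std_uniq SQ ap pb ak; by rewrite ab eqxx in na.
Qed.

(** A box weakly to the south-east would hold a larger letter. *)
Lemma max_inner : inner_corner (domf Q) p.1 p.2.
Proof.
have last q : q != p -> p.1 <= q.1 -> p.2 <= q.2 -> q \notin domf Q.
  move=> ne h1 h2; apply/negP => /(Std_nonempty SQ)/fset0Pn[[k c] aq].
  have pq : p != q by rewrite eq_sym.
  have := Std_incr SQ pb aq pq h1 h2; have /= ra := Std_range SQ aq.
  rewrite /letter_lt /= => lt; have ak : k = n.+1 by case/orP: lt => [lt|/and3P[/eqP<-]] //; lia.
  by have [qp _] := Std_uniq SQ aq pb ak; rewrite qp eqxx in ne.
apply/and3P; split.
- by rewrite -surjective_pairing; apply: letters_in pb.
- by apply: last => //=; case: (p) => i j; rewrite xpair_eqE /=; lia.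
- by apply: last => //=; case: (p) => i j; rewrite xpair_eqE /=; lia.
Qed.

Lemma max_diag : b -> p.1 != p.2.
Proof.
by move=> bT; apply/eqP => E'; have := Std_diag SQ p.1 n.+1; rewrite {2}E' -surjective_pairing -bT pb.
Qed.

Lemma rest_eq0 : (letters_at Q p == [fset (n.+1, b)]) = (E == fset0).
Proof.
apply/eqP/eqP => [Ep|E0]; apply/fsetP => a.
  rewrite mem_rest Ep in_fset1 in_fset0; by case: eqP => [->|//]; rewrite /= eqxx.
rewrite in_fset1; have [->|na] := eqVneq a (n.+1, b); first exact: pb.
have := mem_rest a; rewrite E0 in_fset0 => /esym/negbT; rewrite negb_and negbK.
case/orP=> [/negbTE//|/eqP ak]; apply/negbTE/negP => ap.
by have [_ ab] := Std_uniq SQ ap pb ak; rewrite ab eqxx in na.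
Qed.

Lemma max_neg : (n.+1, ~~ b) \notin letters_at Q p.
Proof. by apply/negP => h; have [_ []] := Std_uniq SQ h pb erefl; case: (b). Qed.

End MaxLetter.

(** * Recording the last transition *)

Section BoundaryBoxes.
Variable V : tableau.
Hypothesis ok : okT V.
Let st : shtab (entry V) := ok.2.

Lemma outer_corner_row_eq i j : 0 < i -> outer_corner (domf V) i j ->
  outer_corner_row (domf V) j = Some i.
Proof.
move=> i0 oc; move: (oc); rewrite outer_cornerE // => /and3P[/eqP t0 l u].
apply: least_some => //.
  by have := @entry_row_bound V i.-1 j; lia.
move=> y yi; rewrite outer_cornerE //.
by have := @sh_dist _ y j i.-1 j st; have := @sh_dom _ st i.-1 j; lia.
Qed.

Lemma outer_corner_col_eq i j : 1 < i -> outer_corner (domf V) i j ->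
  outer_corner_col (domf V) i = Some j.
Proof.
move=> i0 oc; move: (oc); rewrite outer_cornerE // => /and3P[/eqP t0 l u].
have tu : 0 < entry V i.-1 j by lia.
have du := sh_dom st tu; have cb := entry_col_bound tu.
apply: least_some => //; first by lia.
move=> y yi; rewrite outer_cornerE //.
have d1 := @sh_dom _ st i y.-1; have d2 := @sh_dom _ st i j.-1.
by have := @sh_dist _ i y i j.-1 st; lia.
Qed.

Lemma last_in_col_eq x c : 0 < entry V x c -> entry V x.+1 c = 0 ->
  last_in_col (domf V) c = (x, c).
Proof.
move=> tx t0; rewrite /last_in_col; have d := sh_dom st tx; have rb := entry_row_bound tx.
rewrite (@greatest_some _ _ _ x) //; first by lia.
  by rewrite -entry_gt0 //; case: ok.
move=> y yx; rewrite -entry_gt0; last by case: ok.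
by have := @sh_dom _ st y c; have := @sh_dist _ x.+1 c y c st; lia.
Qed.

Lemma last_in_row_eq i x : 0 < entry V i x -> entry V i x.+1 = 0 ->
  last_in_row (domf V) i = (i, x).
Proof.
move=> tx t0; rewrite /last_in_row; have d := sh_dom st tx; have cb := entry_col_bound tx.
rewrite (@greatest_some _ _ _ x) //; first by lia.
  by rewrite -entry_gt0 //; case: ok.
move=> y yx; rewrite -entry_gt0; last by case: ok.
by have := @sh_dist _ i x.+1 i y st; lia.
Qed.

Lemma column_end i c : 0 < entry V i c -> exists x, [/\ i <= x, 0 < entry V x c & entry V x.+1 c = 0].
Proof.
move=> ti; have rb := entry_row_bound ti.
case: (leastP i.+1 (rows (domf V)).+1 (fun z => entry V z c == 0)) =>
    [[z [_ iz /eqP z0 min]]|[_ /(_ (rows (domf V)).+1)]]; last by rewrite entry_rows //; lia.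
exists z.-1; split; [lia| |by rewrite prednK //; lia].
have [->|ne] := eqVneq z.-1 i; first by [].
by have := min z.-1; lia.
Qed.

Lemma row_end_box i c : 0 < entry V i c -> exists x, [/\ c <= x, 0 < entry V i x & entry V i x.+1 = 0].
Proof.
move=> ti; have rb := entry_col_bound ti.
case: (leastP c.+1 (cols (domf V)).+1 (fun z => entry V i z == 0)) =>
    [[z [_ iz /eqP z0 min]]|[_ /(_ (cols (domf V)).+1)]]; last by rewrite entry_cols //; lia.
exists z.-1; split; [lia| |by rewrite prednK //; lia].
have [->|ne] := eqVneq z.-1 c; first by [].
by have := min z.-1; lia.
Qed.

Lemma inner_corner_last i j q : inner_corner (domf V) i j -> q \in domf V ->
  q != (i, j) -> i <= q.1 -> j <= q.2 -> False.
Proof.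
case: q => k l; rewrite inner_cornerE // -(entry_gt0 ok.1) xpair_eqE /=.
move=> /and3P[t0 r d] tq ne ik jl; have d0 := sh_dom st t0.
have d1 := sh_dom st tq.
by have := @sh_dist _ i j.+1 k l st tq; have := @sh_dist _ i.+1 j k l st tq; lia.
Qed.

End BoundaryBoxes.

Definition primed (r : rule) : bool :=
  match r with C1 | C2 => true | _ => false end.

Definition target (D : {fset box}) (r : rule) (p : box) : box :=
  match r with
  | R2 => last_in_col D p.2.-1
  | C2 => last_in_row D p.1.-1
  | _ => p
  end.

(** How the label [p] is recovered from the box [q] that receives the new letter:
    it is [q] itself if [q] is new, and otherwise the outer corner in the next
    column or row. *)
Definition target_spec (W : state) (V : tableau) (r : rule) (p q : box) : Prop :=
  match r with
  | R1 | C1 => [/\ p = q, domf V = q |` sdom W & q \notin sdom W]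
  | R2 => [/\ sdom W = domf V, p.2 = q.2.+1 & outer_corner_row (domf V) q.2.+1 = Some p.1]
  | C2 => [/\ sdom W = domf V, p.1 = q.1.+1 & outer_corner_col (domf V) q.1.+1 = Some p.2]
  | _ => False
  end.

Lemma link_okT W r p V : link W r p (Terminal V) -> okT V.
Proof. by move=> /link_adm[_ []]. Qed.

Lemma link_targetP W r p V : link W r p (Terminal V) ->
  [/\ target_spec W V r p (target (sdom W) r p),
     inner_corner (domf V) (target (sdom W) r p).1 (target (sdom W) r p).2,
     primed r -> (target (sdom W) r p).1 < (target (sdom W) r p).2 &
     forall Q n, domf Q = sdom W ->
       record_letter Q n r p = Some (add_letter Q (target (sdom W) r p) (n, primed r))].
Proof.
move=> lk; have okV := link_okT lk; have := link_inv lk.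
move E : (Terminal V) lk => V' lk; case: lk E okV => //.
- move=> T i j a ok ok' a0 t0 [->] okV _; have st := ok.2; have st' := okT_set_sh ok'.
  have d := upd_dom st' a0; have rr := upd_right st' a0; have dn := upd_down st' a0.
  have h1 := @sh_dist _ i j i j.+1 st; have h2 := @sh_dist _ i j i.+1 j st.
  have h3 := @sh_dom _ st i.+1 j.
  split=> //.
  + split=> //.
    by have := entry_eq0 ok.1 i j; rewrite t0 eqxx.
  + change (is_true (inner_corner (domf T.[(i, j) <- a]) i j)).
    by rewrite inner_cornerE // entry_setE upd_eq upd_ne2 ?upd_ne1; lia.
- move=> T i j a ok ij t0 t1 t2 aE [->] okV _; have st := ok.2.
  have [x [ix tx x0]] := column_end t1.
  have lE : target (sdom (RowOuter T i a)) R2 (i, j) = (x, j.-1) := last_in_col_eq ok tx x0.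
  rewrite lE.
  have jE : j = j.-1.+1 by lia.
  have r0 : entry T x j = 0.
    by have := @sh_dist _ i j x j st; have := @sh_dom _ st x j; lia.
  split=> //.
  + split=> //=; rewrite -jE; apply: outer_corner_row_eq => //; first by lia.
    by rewrite outer_cornerE //; lia.
  + by rewrite inner_cornerE //= -jE; lia.
  + by move=> Q n DQ; rewrite -lE /record_letter DQ.
- move=> T i j a ok ok' a0 t0 ij [->] okV _; have st := ok.2; have st' := okT_set_sh ok'.
  have d := upd_dom st' a0; have rr := upd_right st' a0; have dn := upd_down st' a0.
  have h1 := @sh_dist _ i j i j.+1 st; have h2 := @sh_dist _ i j i.+1 j st.
  have h3 := @sh_dom _ st i.+1 j.
  split=> //.
  + split=> //.
    by have := entry_eq0 ok.1 i j; rewrite t0 eqxx.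
  + change (is_true (inner_corner (domf T.[(i, j) <- a]) i j)).
    by rewrite inner_cornerE // entry_setE upd_eq upd_ne2 ?upd_ne1; lia.
- move=> T i j a ok ij t0 t1 t2 aE [->] okV _; have st := ok.2.
  have [x [ix tx x0]] := row_end_box t1.
  have lE : target (sdom (ColOuter T j a)) C2 (i, j) = (i.-1, x) := last_in_row_eq ok tx x0.
  rewrite lE.
  have jE : i = i.-1.+1 by lia.
  have r0 : entry T i x = 0.
    by have := @sh_dist _ i j i x st; have := @sh_dom _ st i x; lia.
  split=> //.
  + split=> //=; rewrite -jE; apply: outer_corner_col_eq => //; first by lia.
    by rewrite outer_cornerE //; lia.
  + by rewrite inner_cornerE //= -jE; lia.
  + by move=> _ /=; lia.
  + by move=> Q n DQ; rewrite -lE /record_letter DQ.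
Qed.

Lemma mem_add Q p c q a :
  (a \in letters_at (add_letter Q p c) q) = (q == p) && (a == c) || (a \in letters_at Q q).
Proof.
by rewrite letters_add; case: (eqVneq q p) => [->|//]; rewrite in_fset1U.
Qed.

Lemma first_invE V Q n i j b : Adm (Terminal V) -> Std Q n.+1 ->
    (n.+1, b) \in letters_at Q (i, j) ->
  first_inv V Q =
    if letters_at Q (i, j) == [fset (n.+1, b)] then
      if b then inv_terminal_col V i j else inv_terminal_row V i j
    else if b then obind (fun s => inv_terminal_col V i.+1 s) (outer_corner_col (domf Q) i.+1)
    else obind (fun r => inv_terminal_row V r j.+1) (outer_corner_row (domf Q) j.+1).
Proof.
move=> AV SQ pb; rewrite /first_inv asboolT; last exact/admissibleE.
rewrite (max_boxE SQ pb) (weight_Std SQ).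
have nb := max_neg SQ pb.
have ne c : c != b -> (letters_at Q (i, j) == [fset (n.+1, c)]) = false.
  move=> cb; apply/eqP => E; move: pb; rewrite E in_fset1 xpair_eqE eqxx /= => /eqP bc.
  by rewrite bc eqxx in cb.
case: b pb nb ne => pb nb ne.
  by rewrite (ne false) //; rewrite /= in nb; rewrite (negbTE nb).
by rewrite (ne true) // pb.
Qed.

Lemma sdom_shifted U : adm U -> shifted (sdom U).
Proof.
rewrite /sdom; case: U => [T|T i a|T j a].
- by case=> -[Tp st] _; exact: sh_shifted.
- by case=> -[Tp st] _ _ _ _; exact: sh_shifted.
- by case=> -[[Tp st] _] _ _ _ _; exact: sh_shifted.
Qed.

Section Record.
Variables (W : state) (r : rule) (p : box) (V : tableau) (Q : svtableau) (n : nat).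
Hypotheses (lk : link W r p (Terminal V)) (AV : Adm (Terminal V)).
Hypotheses (SQ : Std Q n) (DQ : domf Q = sdom W).

Let q : box := target (sdom W) r p.
Let Q' : svtableau := add_letter Q q (n.+1, primed r).

Lemma target_domf : domf V = q |` sdom W.
Proof.
have [ts ic _ _] := link_targetP lk.
have qV : q \in domf V by case/and3P: ic; rewrite -surjective_pairing.
rewrite -/q in ts; clearbody q; case: (r) ts => //=.
- by case.
- by case=> -> _ _; rewrite mem_fset1U.
- by case.
- by case=> -> _ _; rewrite mem_fset1U.
Qed.

Lemma record_domf : domf Q' = domf V.
Proof. by rewrite domf_add DQ target_domf. Qed.

Lemma record_new : (n.+1, primed r) \in letters_at Q' q.
Proof. by rewrite mem_add !eqxx. Qed.

Lemma record_Std : Std Q' n.+1.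
Proof.
have [ts ic pd _] := link_targetP lk; rewrite -/q in ts ic pd.
have okV := link_okT lk.
have old q' a : a \in letters_at Q q' -> a.1 = n.+1 -> False.
  by move=> /(Std_range SQ); case: a => k c /=; lia.
split.
- by rewrite record_domf; case: okV => Vp st; apply: sh_shifted.
- move=> q'; rewrite domf_add in_fset1U => /orP[/eqP->|q'Q].
    by apply/fset0Pn; exists (n.+1, primed r); exact: record_new.
  have /fset0Pn[a aq] := Std_nonempty SQ q'Q.
  by apply/fset0Pn; exists a; rewrite mem_add aq orbT.
- by move=> q' [k c]; rewrite mem_add => /orP[/andP[_ /eqP[-> _]]|/(Std_range SQ)] /=; lia.
- move=> k kn; have [->|ne] := eqVneq k n.+1.
    by exists q, (primed r); exact: record_new.
  have [|q' [c kc]] := Std_ex SQ (k := k); first by lia.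
  by exists q', c; rewrite mem_add kc orbT.
- move=> q1 q2 a1 a2; rewrite !mem_add.
  case/orP=> [/andP[/eqP-> /eqP->]|h1]; case/orP=> [/andP[/eqP-> /eqP->]|h2] //=.
  + by move=> /esym /(old _ _ h2).
  + by move=> /(old _ _ h1).
  + exact: Std_uniq SQ _ _ _ _ h1 h2.
- move=> q1 q2 a1 a2; rewrite !mem_add => h1 h2 ne le1 le2.
  have q2V : q2 \in domf V.
    rewrite -record_domf domf_add in_fset1U.
    by case/orP: h2 => [/andP[-> _]//|/letters_in->]; rewrite orbT.
  case/orP: h1 => [/andP[/eqP E _]|h1].
    have ne' : q2 != (q.1, q.2) by rewrite -surjective_pairing eq_sym -E.
    by case: (inner_corner_last okV ic q2V ne'); rewrite -E.
  case/orP: h2 => [/andP[_ /eqP->]|h2]; last exact: Std_incr SQ _ _ _ _ h1 h2 ne le1 le2.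
  by have := Std_range SQ h1; rewrite /letter_lt; case: (a1) => k c /=; lia.
- move=> i k; rewrite mem_add negb_or (Std_diag SQ) andbT.
  apply/negP => /andP[/eqP iq /eqP[_ pr]].
  by have := pd (esym pr); rewrite -iq /= ltnn.
Qed.

Lemma remove_record : remove_max Q' = Q.
Proof.
apply: sv_ext.
- exact: nonempty_remove record_Std record_new.
- exact: Std_nonempty SQ.
- move=> q'; apply/fsetP => a; rewrite (mem_remove record_Std record_new) mem_add.
  have [aq|aq] := boolP (a \in letters_at Q q'); rewrite ?orbT ?orbF /=.
    by have := Std_range SQ aq; case: (a) => k c /=; lia.
  by case: eqP => //= _; case: eqP => [->|//]; rewrite eqxx.
Qed.

Lemma first_inv_record : first_inv V Q' = Some W.
Proof.
have [ts ic pd _] := link_targetP lk; rewrite -/q in ts ic pd.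
have SQ' := record_Std; have nw := record_new; have DV := record_domf.
have u := link_inv lk AV.2; rewrite /undo in u.
have lE : letters_at Q' q = (n.+1, primed r) |` letters_at Q q.
  by rewrite letters_add eqxx.
have one : q \notin domf Q -> letters_at Q' q = [fset (n.+1, primed r)].
  move=> qQ; rewrite lE; have -> : letters_at Q q = fset0.
    by rewrite /letters_at not_fnd.
  by rewrite fsetU0.
have two : q \in domf Q -> (letters_at Q' q == [fset (n.+1, primed r)]) = false.
  move=> /(Std_nonempty SQ)/fset0Pn[a aq]; apply/eqP => E.
  have : a \in letters_at Q' q by rewrite mem_add aq orbT.
  rewrite E in_fset1 => /eqP aE.
  by have := Std_range SQ aq; rewrite aE /=; lia.
have qV : q \in domf V by case/and3P: ic; rewrite -surjective_pairing.
have nw' : (n.+1, primed r) \in letters_at Q' (q.1, q.2) by rewrite -surjective_pairing.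
rewrite (first_invE AV SQ' nw') -surjective_pairing DV.
move: ts u one two; rewrite DQ; case: (r) => //=.
- by case=> pq _ qW u one _; rewrite (one qW) eqxx -pq.
- by case=> WV p2 oc u _ two; rewrite two ?WV // oc /= -p2.
- by case=> pq _ qW u one _; rewrite (one qW) eqxx -pq.
- by case=> WV p2 oc u _ two; rewrite two ?WV // oc /= -p2.
Qed.

End Record.

(** The largest letter lies in an inner corner, and whether it is primed or alone
    in its box tells which of R1, R2, C1, C2 recorded it.  For R2 there is an
    outer corner in the next column; for C2 there is one in the next row because
    primed letters are off the diagonal. *)
Lemma first_inv_complete V Q n : Adm (Terminal V) -> Std Q n.+1 -> domf Q = domf V ->
  exists W r p, [/\ first_inv V Q = Some W, link W r p (Terminal V),
    domf (remove_max Q) = sdom W, Std (remove_max Q) n &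
    record_letter (remove_max Q) n.+1 r p = Some Q].
Proof.
move=> AV SQ DQ; have okV : okT V by case: AV => -[].
have st := okV.2.
have [|[i j] [b pb]] := Std_ex SQ (k := n.+1); first by lia.
have /= ic := max_inner SQ pb; have dg := max_diag SQ pb; rewrite DQ /= in ic dg.
have fE := first_invE AV SQ pb.
have [tij /eqP tr /eqP td] : [/\ 0 < entry V i j, entry V i j.+1 == 0 & entry V i.+1 j == 0].
  by apply/and3P; rewrite -inner_cornerE.
have d := sh_dom st tij.
suff [W [r [p [fW lk tE bE dW]]]] : exists W r p, [/\ first_inv V Q = Some W,
    link W r p (Terminal V), target (sdom W) r p = (i, j), primed r = b &
    domf (remove_max Q) = sdom W].
  have [_ _ _ rec] := link_targetP lk.
  exists W, r, p; split=> //.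
    by apply: (Std_remove SQ pb); rewrite dW; apply: sdom_shifted; case: (link_adm lk).
  by rewrite (rec _ _ dW) tE bE (remove_add SQ pb).
have [E|nE] := boolP (letters_at Q (i, j) == [fset (n.+1, b)]).
  have dR : domf (remove_max Q) = domf V `\ (i, j).
    by rewrite (domf_remove SQ pb) -(rest_eq0 SQ pb) E DQ.
  have dW W r p : link W r p (Terminal V) -> (if primed r then r = C1 else r = R1) ->
      p = (i, j) -> domf (remove_max Q) = sdom W /\ target (sdom W) r p = (i, j).
    move=> lk rE pE; have [ts _ _ _] := link_targetP lk.
    have [ts' tE] : (domf V = (i, j) |` sdom W /\ (i, j) \notin sdom W) /\
        target (sdom W) r p = (i, j).
      by case: (r) rE ts => //= _; rewrite -pE => -[_ ? ?].
    by rewrite dR ts'.1 fsetU1K ?ts'.2.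
  rewrite E in fE; case: (b) fE dg => fE dg.
    have ij : i < j by have := dg isT; lia.
    have [W lk] := link_inner_col okV ic ij.
    have [d1 d2] := dW _ _ _ lk erefl erefl.
    exists W, C1, (i, j); split=> //.
    by rewrite fE; have := link_inv lk AV.2.
  have [W lk] := link_inner_row okV ic.
  have [d1 d2] := dW _ _ _ lk erefl erefl.
  exists W, R1, (i, j); split=> //.
  by rewrite fE; have := link_inv lk AV.2.
have dR : domf (remove_max Q) = domf V.
  by rewrite (domf_remove SQ pb) -(rest_eq0 SQ pb) (negbTE nE) DQ.
rewrite (negbTE nE) DQ in fE; case: (b) fE dg => fE dg.
  have ij : i < j by have := dg isT; lia.
  case: (leastP i.+1 j (fun s => entry V i.+1 s == 0)) =>
      [[s [_ sj s0 min]]|[_ /(_ j)]]; last by rewrite td; lia.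
  have oc : outer_corner (domf V) i.+1 s.
    rewrite outer_cornerE //=; have := @sh_dist _ i s i j st tij; have := min s.-1; lia.
  have [W lk] := link_outer_col okV oc (ltac:(lia) : 1 < i.+1).
  have [ts _ _ _] := link_targetP lk; case: ts => WV _ _.
  exists W, C2, (i.+1, s); split=> //; last by rewrite WV.
    by rewrite fE (outer_corner_col_eq okV _ oc) ?(ltac:(lia) : 1 < i.+1) //=; have := link_inv lk AV.2.
  by rewrite /target WV; exact: last_in_row_eq.
case: (leastP 1 i (fun s => entry V s j.+1 == 0)) =>
    [[s [_ sj s0 min]]|[_ /(_ i)]]; last by rewrite tr; lia.
have oc : outer_corner (domf V) s j.+1.
  rewrite outer_cornerE //=; have := @sh_dist _ s j i j st tij; have := min s.-1; lia.
have sj' : 0 < s < j.+1 by lia.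
have [W lk] := link_outer_row okV oc sj'.
have [ts _ _ _] := link_targetP lk; case: ts => WV _ _.
exists W, R2, (s, j.+1); split=> //; last by rewrite WV.
  by rewrite fE (outer_corner_row_eq okV _ oc) //=; [have := link_inv lk AV.2|lia].
by rewrite /target WV; exact: last_in_col_eq.
Qed.

(** * The bijection *)

Implicit Types (T P V : tableau).
Lemma tableau_empty (T : tableau) : domf T = fset0 -> T = [fmap].
Proof.
move=> D; apply/fmapP => p; rewrite fnd_fmap0 not_fnd //.
by rewrite -[p \in T]/(p \in domf T) D in_fset0.
Qed.

Lemma svtableau_empty Q : domf Q = fset0 -> Q = [fmap].
Proof.
move=> D; apply/fmapP => p; rewrite fnd_fmap0 not_fnd //.
by rewrite -[p \in Q]/(p \in domf Q) D in_fset0.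
Qed.

Lemma okT_empty : okT [fmap].
Proof.
split; first by move=> p v; rewrite fnd_fmap0.
by split=> i j; rewrite ?entry_fmap0 // => _; rewrite !entry_fmap0.
Qed.

Lemma row_word_empty : row_word [fmap] = [::].
Proof. by rewrite /row_word /rows big_seq_fset0. Qed.

Lemma Std_empty : Std [fmap] 0.
Proof.
have no p : letters_at [fmap] p = fset0 by rewrite /letters_at fnd_fmap0.
split=> [|p|p a|k|p q a b|p q a b|i k]; rewrite ?no ?in_fset0 //; last by lia.
by exists [::] => // i j; rewrite in_fset0 /=; lia.
Qed.

Lemma Std0 Q : Std Q 0 -> Q = [fmap].
Proof.
move=> SQ; apply: svtableau_empty; apply/eqP; rewrite -[_ == _]negbK; apply/negP => /fset0Pn[p].
by move=> /(Std_nonempty SQ)/fset0Pn[a] /(Std_range SQ); lia.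
Qed.

Lemma P_Sp_rcons w a : P_Sp (rcons w a) = obind (fun T => omap snd (insertion T a)) (P_Sp w).
Proof. by rewrite /P_Sp foldl_rcons. Qed.

Lemma Q_Sp_rcons w a : Q_Sp (rcons w a) =
  match Q_Sp w, obind (insertion^~ a) (P_Sp w) with
  | Some Q, Some (r, p, _) => record_letter Q (size w).+1 r p
  | _, _ => None
  end.
Proof. by rewrite /Q_Sp rev_rcons /= revK size_rev. Qed.

Lemma uninsertE V Q W T a w0 : first_inv V Q = Some W ->
  inv_path (rows (domf V) + cols (domf V) + 2) W = Some (T, a) ->
  obind uninsert (Some (V, Q, w0)) = Some (T, remove_max Q, a :: w0).
Proof. by rewrite /= => -> /= ->. Qed.

Definition good_pair (z : Finfty) (n : nat) (P : tableau) Q : Prop :=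
  [/\ okT P, act (row_word P) (Some FTheta) = Some z, Std Q n & domf P = domf Q].

(** Induction on prefixes: the first uninsertion undoes the last insertion. *)
Lemma insertion_correct w z : posw w -> act w (Some FTheta) = Some z ->
  exists P Q, [/\ P_Sp w = Some P, Q_Sp w = Some Q, good_pair z (size w) P Q &
    forall w0, iter (size w) (obind uninsert) (Some (P, Q, w0)) =
      Some ([fmap] : tableau, [fmap] : svtableau, w ++ w0)].
Proof.
elim/last_ind: w z => [|w a IH] z pw wz.
  exists [fmap], [fmap]; split=> //; split=> //.
  - exact: okT_empty.
  - by rewrite row_word_empty.
  - exact: Std_empty.
rewrite -cats1 all_cat /= andbT in pw; case/andP: pw => pw a0.
rewrite -cats1 act_cat in wz.
have [z' wz'] : exists z', act w (Some FTheta) = Some z'.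
  by case E: (act w _) wz => [z'|]; [exists z'|rewrite act_None].
have [P [Q [PE QE [ok rz SQ DQ] it]]] := IH z' pw wz'.
have az : act (row_word P ++ [:: a]) (Some FTheta) = Some z by rewrite act_cat rz -wz' wz.
have al : alive (row_word P ++ [:: a]) by rewrite /alive az.
have [r [p [V [U [ins lk ip [AV dU] wV]]]]] := insertion_complete ok a0 al.
have DQ' : domf Q = sdom U by rewrite dU DQ.
have [_ _ _ rec] := link_targetP lk.
exists V, (add_letter Q (target (sdom U) r p) ((size w).+1, primed r)); split.
- by rewrite P_Sp_rcons PE /= ins.
- by rewrite Q_Sp_rcons PE QE /= ins rec.
- split.
  + exact: link_okT lk.
  + by rewrite -wV.
  + by rewrite size_rcons; apply: record_Std lk SQ DQ'.
  + by apply/esym; apply: record_domf lk DQ'.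
- move=> w0; rewrite size_rcons iterSr (uninsertE _ (first_inv_record lk AV SQ DQ') ip).
  by rewrite (remove_record lk SQ DQ') it cat_rcons.
Qed.

Lemma uninsertion_correct n P Q z : good_pair z n P Q ->
  exists w, [/\ size w = n, posw w, act w (Some FTheta) = Some z,
    P_Sp w = Some P /\ Q_Sp w = Some Q &
    forall w0, iter n (obind uninsert) (Some (P, Q, w0)) =
      Some ([fmap] : tableau, [fmap] : svtableau, w ++ w0)].
Proof.
elim: n P Q z => [|n IH] P Q z [ok rz SQ DQ].
  have Q0 := Std0 SQ; have P0 : P = [fmap] by apply: tableau_empty; rewrite DQ Q0.
  by exists [::]; split=> //; rewrite ?P0 ?Q0 //; rewrite -rz P0 row_word_empty.
have AV : Adm (Terminal P).
  split; last by rewrite /alive /= rz.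
  split=> // P0; have [|p [b pb]] := Std_ex SQ (k := n.+1); first by lia.
  by have := letters_in pb; rewrite -DQ P0 in_fset0.
have [W [r [p [fW lk dW SQ' rec]]]] := first_inv_complete AV SQ (esym DQ).
have [T [a [ip [okT0 a0 dT] al ins wT]]] := inv_path_terminal lk AV.
have [z' Tz] : exists z', act (row_word T) (Some FTheta) = Some z'.
  by move: al; rewrite /alive act_cat; case: (act (row_word T)) => [z'|] //; exists z'.
have [|w [sw pw wz [PE QE] it]] := IH T (remove_max Q) z'.
  by split=> //; rewrite -dT dW.
exists (rcons w a); split.
- by rewrite size_rcons sw.
- by rewrite -cats1 all_cat pw /= a0.
- by rewrite -cats1 act_cat wz -Tz -act_cat wT.
- by rewrite P_Sp_rcons Q_Sp_rcons PE QE /= ins /= sw.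
- by move=> w0; rewrite iterSr (uninsertE _ fW ip) it cat_rcons.
Qed.

Lemma w_SpE P Q n w : weight Q = n ->
  (forall w0, iter n (obind uninsert) (Some (P, Q, w0)) =
      Some ([fmap] : tableau, [fmap] : svtableau, w ++ w0)) ->
  w_Sp (P, Q) = Some w.
Proof. by move=> wn it; rewrite /w_Sp /= wn it !eqxx cats0. Qed.

Lemma sp_bijection (z : Finfty) (n : nat) :
  inverse_bijections PQ_Sp w_Sp
    (fun w => sp_Hecke_word z w /\ size w = n)
    (fun PQ : tableau * svtableau =>
       [/\ is_increasing_shifted PQ.1 /\ sp_Hecke_word z (row_word PQ.1),
           standard_shifted PQ.2,
           weight PQ.2 = n &
           domf PQ.1 = domf PQ.2]).
Proof.
split=> [w [/sp_Hecke_wordE[w0 wz] sw]|[P Q] /= [[/okTE ok /sp_Hecke_wordE[_ rz]] sQ wQ DQ]].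
  rewrite -poswE in w0.
  have [P [Q [PE QE [ok rz SQ DQ] it]]] := insertion_correct w0 wz.
  have [sQ wQ] := (standardE Q (size w)).2 SQ.
  exists (P, Q); split.
  - by rewrite /PQ_Sp PE QE.
  - split=> //=; last by rewrite wQ.
    by split; [apply/okTE|apply/sp_Hecke_wordE; rewrite -poswE posw_row_word //; case: ok].
  - exact: w_SpE wQ it.
have SQ : Std Q n by apply/standardE.
have [|w [sw pw wz [PE QE] it]] := @uninsertion_correct n P Q z; first by split.
exists w; split.
- exact: w_SpE wQ it.
- by split=> //; apply/sp_Hecke_wordE; rewrite -poswE.
- by rewrite /PQ_Sp PE QE.
Qed.

Lemma size_row_word T : okT T -> size (row_word T) = #|` domf T|.
Proof.
move=> [Tp st]; set N := rows (domf T) + cols (domf T).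
rewrite (@row_wordE N) //; try lia.
rewrite /rword /rowsw /rowt (flatten_vals (entry T)) vals_filter size_map.
apply: perm_size; apply: uniq_perm; rewrite ?fset_uniq ?filter_uniq //.
  by apply: allpairs_uniq; rewrite ?rev_uniq ?iota_uniq // => -[? ?] [].
move=> [i j]; rewrite mem_filter /= entry_gt0 // -[in RHS](andbT (_ \in _)).
have [ijD|//] := boolP ((i, j) \in domf T).
have t0 : 0 < entry T i j by rewrite entry_gt0.
apply/allpairsP; exists (i, j); split=> //=; rewrite ?mem_rev mem_iota;
have := sh_dom st t0; have := entry_row_bound t0; have := entry_col_bound t0; rewrite /N; lia.
Qed.

Lemma leq_size_sum (I : eqType) (s : seq I) (f : I -> nat) : {in s, forall x, 0 < f x} ->
  size s <= \sum_(x <- s) f x /\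
  (\sum_(x <- s) f x <= size s -> {in s, forall x, f x = 1}).
Proof.
elim: s => [|x s IH] H; first by rewrite big_nil.
rewrite big_cons; have fx := H x (mem_head _ _).
have [y ys|h1 h2] := IH; first by apply: H; rewrite inE ys orbT.
split=> [/=|/= le]; first by lia.
move=> y; rewrite inE => /orP[/eqP->|]; first by lia.
by apply: h2; lia.
Qed.

(** Every box holds at least one letter, so the number of boxes bounds the weight,
    with equality when no box holds two. *)
Lemma weight_marked Q n : Std Q n -> #|` domf Q| <= n /\ (n <= #|` domf Q| <-> marked Q).
Proof.
move=> SQ; have [_ <-] := (standardE Q n).2 SQ.
have [p pD|h1 h2] := @leq_size_sum _ (enum_fset (domf Q)) (fun p => #|` letters_at Q p|).
  by rewrite cardfs_gt0; apply: Std_nonempty SQ _ pD.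
split=> //; split=> [le p E pE|mQ].
  rewrite -(letters_fnd pE); apply: h2 => //.
  by move: pE; case: fndP.
rewrite /weight big_seq_cond (eq_bigr (fun=> 1)); last first.
  by move=> p /andP[pD _]; apply: mQ (fnd_letters pD).
by rewrite -big_seq_cond sum1_size.
Qed.

Lemma size_row_word_weight n (P : tableau) (Q : svtableau) :
    is_increasing_shifted P -> standard_shifted Q -> weight Q = n -> domf P = domf Q ->
  size (row_word P) <= n /\ (n <= size (row_word P) <-> marked Q).
Proof.
move=> /okTE ok sQ wQ DQ; rewrite (size_row_word ok) DQ.
by apply: weight_marked; apply/standardE.
Qed.

Theorem theorem3p27 (z : Finfty) (n : nat) :
  inverse_bijections PQ_Sp w_Sp
    (fun w => sp_Hecke_word z w /\ size w = n)
    (fun PQ : tableau * svtableau =>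
       [/\ is_increasing_shifted PQ.1 /\ sp_Hecke_word z (row_word PQ.1),
           standard_shifted PQ.2,
           weight PQ.2 = n &
           domf PQ.1 = domf PQ.2]) /\
  inverse_bijections PQ_Sp w_Sp
    (fun w => FPF_involution_word z w /\ size w = n)
    (fun PQ : tableau * svtableau =>
       [/\ is_increasing_shifted PQ.1 /\ FPF_involution_word z (row_word PQ.1),
           standard_shifted PQ.2 /\ marked PQ.2,
           weight PQ.2 = n &
           domf PQ.1 = domf PQ.2]).
Proof.
have [bij1 bij2] := sp_bijection z n.
split; first by split; [exact: bij1 | exact: bij2].
split=> [w [[zw wmin] sw]|[P Q] /= [[okP [zP Pmin]] [sQ mQ] wQ DQ]].
  have [[P Q] [PQw /= [[okP zP] sQ wQ DQ] wPQ]] := bij1 w (conj zw sw).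
  have [le_n markedE] := size_row_word_weight okP sQ wQ DQ.
  have n_le : n <= size (row_word P) by rewrite -sw wmin.
  exists (P, Q); split=> //; split=> //=; last by split=> //; apply/markedE.
  by split=> //; split=> // v /wmin; rewrite sw; apply: leq_trans.
have [|w [wPQ [zw sw] PQw]] := bij2 (P, Q); first by split.
have [_ markedE] := size_row_word_weight okP sQ wQ DQ.
exists w; split=> //; split=> //; split=> // v /Pmin; apply: leq_trans.
by rewrite sw; apply/markedE.
Qed.
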